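(* Let $T>0$ and let $I\subseteq\mathbb R$ be a closed interval or the whole real line. Let $u_0\in C^1(I)$ be a probability density on $I$ (with finite second moment if $I=\mathbb R$), with $\|u_0\|_\infty<M$ and $\|u_0'\|_\infty<N$. Let $f\in C^2([-M,M])$ and assume that $G(x):=f(x)/x$ extends to a function of class $C^1([-M,M])$. Let $u$ be the classical solution of $$u_t+(f(u))_x=0\ \text{ on } I\times[0,T],\qquad u(\cdot,0)=u_0,$$ with zero-flux boundary conditions ($f(u(x,t))=0$ for $x$ on the boundary of $I$), and strictly before characteristic crossing, i.e., assume that for some $\alpha>0$ $$1+tf''(u_0(\xi))u_0'(\xi)\ge\alpha>0\qquad\text{for all }t\in[0,T],\ \xi\in I .$$ If $I$ is bounded with endpoints $a<b$, assume in addition that the velocity $v(x,t)=G(u(x,t))$ satisfies the no-outflow condition $v(a,t)=v(b,t)=0$. Then $\widehat u\in C^2([0,T];L^2(dr))$ and, with $\widehat{\mathcal M}_{[0,T]}:=\{\widehat u(\cdot,t):t\in[0,T]\}$, $$d_n\big(\widehat{\mathcal M}_{[0,T]};L^2(dr)\big)\le\frac{C\,T^2}{8\sqrt{\alpha}\,(n-1)^2}\qquad\text{for every integer } n\ge 2,$$ where $$C^2:=\int\frac{(u_0(\xi)f'(u_0(\xi))-f(u_0(\xi)))^4\,u_0'(\xi)^2}{u_0(\xi)^5}\,d\xi=\int u_0(\xi)^3\,(G'(u_0(\xi)))^4\,(u_0'(\xi))^2\,d\xi .$$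
   Context: CDT: $r$ is a fixed probability density supported on $I$ (with finite second moment if $I=\mathbb R$), the reference. For a probability density $w$ on $I$, $F_w(x)=\int_{I\cap(-\infty,x]}w(s)\,ds$, $F_w^\dagger(p)=\inf\{x\in I:F_w(x)\ge p\}$ for $p\in(0,1)$, and the cumulative distribution transform (CDT) of $w$ is $\widehat w(\xi)=F_w^\dagger(F_r(\xi))$, understood $r(\xi)d\xi$-a.e. For a time-dependent $u$, $\widehat u(\cdot,t)$ is the CDT of $u(\cdot,t)$, and $\widehat u$ is viewed as the curve $t\mapsto\widehat u(\cdot,t)$ in $L^2(dr)$, the $L^2$ space on $I$ with respect to the measure $r(\xi)\,d\xi$. Kolmogorov $n$-width: for a subset $\mathcal S$ of a Hilbert space $\mathcal H$, $d_n(\mathcal S;\mathcal H)=\inf_{V\subset\mathcal H,\ \dim V\le n}\ \sup_{w\in\mathcal S}\ \inf_{h\in V}\|w-h\|_{\mathcal H}$, the infimum being over linear subspaces $V$. Integrals without indicated domain are over $I$; the integrand in the first expression for $C^2$ is understood through the second expression where $u_0=0$. *)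

(* Defs.v *)
From HB Require Import structures.
From mathcomp Require Import all_boot all_order all_algebra.
From mathcomp Require Import all_classical all_reals all_analysis.
From mathcomp Require Import measurable_realfun.

Set Implicit Arguments.
Unset Strict Implicit.
Unset Printing Implicit Defensive.
Import Order.TTheory GRing.Theory Num.Theory.
Import numFieldNormedType.Exports.

Local Open Scope classical_set_scope.
Local Open Scope ring_scope.

(* Calculus relative to a set A: difference quotients only use points of A, so
   that at an endpoint of a closed interval the derivative is the one-sided
   one, and values of f outside A are irrelevant. *)
Section calculus_on_a_set.
Context {R : realType}.
Implicit Types (A B : set R) (f : R -> R) (u : R -> R -> R).

Definition derivable_in A f (x : R) : Prop :=
  cvg ((f y - f x) / (y - x) @[y --> within A x^']).

Definition derive_in A f (x : R) : R :=
  lim ((f y - f x) / (y - x) @[y --> within A x^']).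

Definition C1_on A f : Prop :=
  (forall x, A x -> derivable_in A f x) /\
  {within A, continuous (derive_in A f)}.

Definition C2_on A f : Prop := C1_on A f /\ C1_on A (derive_in A f).

Definition C1_on2 A B u : Prop :=
  [/\ forall x t, A x -> B t -> derivable_in A (u ^~ t) x,
      forall x t, A x -> B t -> derivable_in B (u x) t,
      {within A `*` B, continuous (fun p : R * R => u p.1 p.2)},
      {within A `*` B,
        continuous (fun p : R * R => derive_in A (u ^~ p.2) p.1)} &
      {within A `*` B, continuous (fun p : R * R => derive_in B (u p.1) p.2)}].

(* The supremum norm over A, in the extended reals: +oo when f is unbounded. *)
Definition sup_norm A f : \bar R := ereal_sup [set `|f x|%:E | x in A].

Definition boundary A : set R := closure A `\` interior A.

End calculus_on_a_set.

Section densities.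
Context {R : realType}.
Implicit Types (I : interval R) (w r : R -> R).

Definition line_or_segment I : Prop :=
  I = `]-oo, +oo[ \/ exists a b : R, a < b /\ I = `[a, b].

Definition is_density I w : Prop :=
  [/\ measurable_fun [set` I] w,
      forall x, x \in I -> 0 <= w x &
      (\int[lebesgue_measure]_(x in [set` I]) (w x)%:E = 1)%E].

Definition finite_second_moment I w : Prop :=
  (\int[lebesgue_measure]_(x in [set` I]) (x ^+ 2 * w x)%:E < +oo)%E.

Definition distr_fun I w (x : R) : R :=
  \int[lebesgue_measure]_(s in [set` I] `&` [set s | s <= x]) w s.

Definition quantile I w (p : R) : R :=
  inf [set x | x \in I /\ p <= distr_fun I w x].

(* The cumulative distribution transform of w with respect to r. It is only
   meaningful where 0 < distr_fun I r xi < 1, which is r(xi)dxi-almost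
   everywhere. *)
Definition CDT I r w (xi : R) : R := quantile I w (distr_fun I r xi).

Definition density_measure I r (hr : is_density I r)
    (A : set (measurableTypeR R)) : \bar R :=
  (\int[lebesgue_measure]_(x in A `&` [set` I]) (r x)%:E)%E.

Section density_measure_is_measure.
Variables (I : interval R) (r : R -> R) (hr : is_density I r).
Local Open Scope ereal_scope.

Let nu0 : density_measure hr set0 = 0.
Proof. by rewrite /density_measure set0I integral_set0. Qed.

Let nu_ge0 A : 0 <= density_measure hr A.
Proof.
have [_ r0 _] := hr.
by apply: integral_ge0 => x [_ /r0]; rewrite lee_fin.
Qed.

Let nu_additive : semi_sigma_additive (density_measure hr).
Proof.
have [mr r0 _] := hr; move=> F mF tF _; rewrite /density_measure.
have mI : measurable ([set` I] : set (measurableTypeR R)).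
  exact: measurable_itv.
rewrite setI_bigcupl ge0_integral_bigcup//=.
- apply: is_cvg_ereal_nneg_natsum_cond => n _ _.
  by apply: integral_ge0 => x [_ /r0]; rewrite lee_fin.
- by move=> k; exact: measurableI.
- apply/measurable_EFinP; apply: measurable_funS mr => //.
  by move=> x [k _ []].
- by move=> x [k _ [_ /r0]]; rewrite lee_fin.
- exact: trivIset_setIr.
Qed.

HB.instance Definition _ := isMeasure.Build _ _ _ (density_measure hr)
  nu0 nu_ge0 nu_additive.

End density_measure_is_measure.

End densities.

(* Elements of L^2(mu) are represented by functions in Lfun mu 2; every notion
   below only depends on their classes modulo mu-almost everywhere equality. *)
Section L2.
Context {d} {T : measurableType d} {R : realType}.
Variable mu : {measure set T -> \bar R}.
Implicit Types (A : set R) (g : R -> T -> R).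
Local Notation L2 := (Lfun mu 2%:E).

Definition L2dist (f h : T -> R) : \bar R :=
  Lnorm mu 2%:E (fun x => (f x - h x)%:E).

Definition L2_is_derive_in A g (t : R) (l : T -> R) : Prop :=
  L2dist (fun x => (g s x - g t x) / (s - t)) l @[s --> within A t^'] --> 0%E.

Definition L2_continuous_in A g (t : R) : Prop :=
  L2dist (g s) (g t) @[s --> within A (nbhs t)] --> 0%E.

Definition L2_C2_on A g : Prop :=
  exists g1 g2 : R -> T -> R,
    [/\ forall t, A t -> [/\ g t \in L2, g1 t \in L2 & g2 t \in L2],
        forall t, A t -> L2_is_derive_in A g t (g1 t),
        forall t, A t -> L2_is_derive_in A g1 t (g2 t) &
        forall t, A t -> L2_continuous_in A g2 t].

Definition L2_subspace_dim_le (n : nat) (V : set (T -> R)) : Prop :=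
  exists e : 'I_n -> T -> R,
    (forall i, e i \in L2) /\
    V = [set h | exists c : 'I_n -> R, h = fun x => \sum_(i < n) c i * e i x].

Definition kolmogorov_width (n : nat) (S : set (T -> R)) : \bar R :=
  ereal_inf [set ereal_sup [set ereal_inf [set L2dist w h | h in V] | w in S]
            | V in L2_subspace_dim_le n].

End L2.

Section conservation_law.
Context {R : realType}.

(* f is only meaningful on [-M, M], so a solution takes its values there. *)
Definition classical_solution (I : interval R) (T M : R) (f u0 : R -> R)
    (u : R -> R -> R) : Prop :=
  [/\ C1_on2 [set` I] `[0, T] u,
      forall x t, x \in I -> t \in `[0, T] -> u x t \in `[- M, M],
      forall x t, x \in I -> t \in `[0, T] ->
        derive_in `[0, T] (u x) t + derive_in [set` I] (fun y => f (u y t)) x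
        = 0 &
      forall x, x \in I -> u x 0 = u0 x].

Definition zero_flux (I : interval R) (T : R) (f : R -> R) (u : R -> R -> R) :=
  forall x t, boundary [set` I] x -> t \in `[0, T] -> f (u x t) = 0.

Definition Csq_integrand_G (I : interval R) (M : R) (G u0 : R -> R) (xi : R) : R :=
  u0 xi ^+ 3 * derive_in `[- M, M] G (u0 xi) ^+ 4
  * derive_in [set` I] u0 xi ^+ 2.

(* The quotient is 0/0 where u0 vanishes: there it is read as
   Csq_integrand_G. *)
Definition Csq_integrand_f (I : interval R) (M : R) (f G u0 : R -> R) (xi : R) : R :=
  if u0 xi == 0 then Csq_integrand_G I M G u0 xi else
  (u0 xi * derive_in `[- M, M] f (u0 xi) - f (u0 xi)) ^+ 4
  * derive_in [set` I] u0 xi ^+ 2 / u0 xi ^+ 5.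

End conservation_law.

(* Main.v *)
(** Along characteristics [u] is constant, so [u(x,t) = u0(foot t x)] with
    [foot t x = x - t f'(u(x,t))]; on a segment the boundary values are constant in
    time, so [u] is locally constant where the foot falls outside. The mass to the
    left of [x(t)] is conserved when [x' = G(u(x,t))], so for a fixed level [p] the
    quantile of [u(.,t)] is such a trajectory, and differentiating once more gives
    [x'' = - u G'(u)^2 u_x]. The law of [uhat(.,t)] under [r] has density [u(.,t)],
    hence the squared L2 norm of the second derivative of [uhat] is
    [\int u^3 G'(u)^4 u_x^2 dx]. Pulling this back along the foot map, with
    [u_x = u0' / (1 + t f''(u0) u0')], bounds it by [C^2 / alpha]. Finally the curve
    stays within [B h^2 / 8] of its piecewise linear interpolant on a mesh of step
    [h = T / (n - 1)] when its second derivative is bounded by [B], and the [n]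
    nodal values span a space of dimension at most [n]. *)
Require Import Defs.
From HB Require Import structures.
From mathcomp Require Import all_boot all_order all_algebra.
From mathcomp Require Import all_classical all_reals all_analysis.
From mathcomp Require Import measurable_realfun.
From mathcomp Require Import ring lra.

Set Implicit Arguments.
Unset Strict Implicit.
Unset Printing Implicit Defensive.
Import Order.TTheory GRing.Theory Num.Theory.
Import numFieldNormedType.Exports.

Local Open Scope classical_set_scope.
Local Open Scope ring_scope.

(** * Derivatives relative to a set *)

Section der_at.
Context {R : realType}.
Implicit Types (A B : set R) (f g : R -> R) (J : interval R).

(** The obstacle is that [u] may vanish, while implicit differentiation of the level equation
    divides by it. Regularity of a quantile trajectory is therefore proved only for levels whose
    quantile at time 0 has positive density. Positivity persists: a later zero of [u] on the
    trajectory could be followed back along its characteristic with [u] and the mass to the left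
    unchanged, down to time 0 or to the boundary, where it contradicts the choice of the level.
    Almost every [xi] gives such a level, because the transform at time 0 carries [r] to the initial
    density. On the line, total mass one at later times has to be proved: [u0] is Lipschitz and
    integrable, so it tends to 0 at infinity, and with it the flux, uniformly in time. Pointwise
    time derivatives become [L2] derivatives by bounded convergence, which needs a uniform bound on
    [ux]: from [N] and [alpha] on the line, from compactness on a segment. To work with plain
    continuity, all data are composed with retractions onto [I], [[0, T]] and [[-M, M]]. *)

Definition der_at A f (x l : R) : Prop :=
  (f y - f x) / (y - x) @[y --> within A x^'] --> l.

Lemma derivable_in_der_at A f x : derivable_in A f x ->
  der_at A f x (derive_in A f x).
Proof. by []. Qed.

(** Multiplying out the quotient makes the estimate trivial at [y = x], so the punctured
    neighbourhood becomes a full one and no later argument has to exclude [x]. *)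
Lemma der_atP A f x l : der_at A f x l <->
  forall e, 0 < e -> \forall y \near within A (nbhs x),
    `|f y - f x - l * (y - x)| <= e * `|y - x|.
Proof.
have E y : y != x ->
    `|f y - f x - l * (y - x)| = `|l - (f y - f x) / (y - x)| * `|y - x|.
  move=> yx; rewrite distrC -normrM; congr (`|_|).
  by rewrite mulrBl divfK// subr_eq0.
split=> [/cvgrPdist_le h e e0|h].
  move: (h _ e0); rewrite !near_withinE; apply: filterS => y yA Ay.
  have [->|yx] := eqVneq y x; first by rewrite !subrr mulr0 subr0 !normr0 mulr0.
  by rewrite E// ler_wpM2r//; exact: yA.
apply/cvgrPdist_le => e e0.
move: (h _ e0); rewrite !near_withinE; apply: filterS => y + yx Ay.
by move=> /(_ Ay); rewrite E// ler_pM2r// normr_gt0 subr_eq0.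
Qed.

Lemma der_at_ext A f g x l : A x -> {in A, f =1 g} ->
  der_at A f x l -> der_at A g x l.
Proof.
move=> Ax fg /der_atP h; apply/der_atP => e /h.
rewrite !near_withinE; apply: filterS => y + Ay.
by rewrite !fg ?inE//; exact.
Qed.

Lemma der_at_sub A B f x l : A `<=` B -> der_at B f x l -> der_at A f x l.
Proof.
move=> AB /der_atP h; apply/der_atP => e /h.
by rewrite !near_withinE; apply: filterS => y + /AB.
Qed.

Lemma der_at_cst A c x : der_at A (cst c) x 0.
Proof.
by apply/der_atP => e e0; near=> y; rewrite /= mul0r !subr0 subrr normr0 mulr_ge0// ltW.
Unshelve. all: by end_near. Qed.

Lemma der_at_id A x : der_at A id x 1.
Proof.
apply/der_atP => e e0; near=> y.
by rewrite mul1r subrr normr0 mulr_ge0// ltW.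
Unshelve. all: by end_near. Qed.

Lemma der_at_cvg A f x l : der_at A f x l -> f @ within A (nbhs x) --> f x.
Proof.
move=> /der_atP /(_ 1 ltr01) h; apply/cvgrPdist_le => e e0.
have d0 : 0 < e / (1 + `|l|) by rewrite divr_gt0// ltr_pwDl.
have hd : \forall y \near within A (nbhs x), `|x - y| <= e / (1 + `|l|).
  apply: cvg_within; apply: filterS (nbhsx_ballx x _ d0) => y.
  by rewrite /ball /= => /ltW.
near=> y.
have : `|f y - f x - l * (y - x)| <= 1 * `|y - x| by near: y.
rewrite mul1r => h1.
have h2 : `|y - x| <= e / (1 + `|l|).
  by rewrite distrC; near: y.
have -> : f x - f y = - (f y - f x - l * (y - x)) - l * (y - x) by ring.
rewrite (le_trans (ler_normB _ _))// normrN normrM.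
rewrite (le_trans (lerD h1 (lexx _)))//.
have -> : `|y - x| + `|l| * `|y - x| = `|y - x| * (1 + `|l|) by ring.
by rewrite -ler_pdivlMr// ltr_pwDl.
Unshelve. all: by end_near. Qed.

Lemma der_atD A f g x l m : der_at A f x l -> der_at A g x m ->
  der_at A (fun y => f y + g y) x (l + m).
Proof.
move=> hf hg; rewrite /der_at.
under eq_fun do rewrite opprD addrACA mulrDl.
exact: cvgD hf hg.
Qed.

Lemma der_atM A f g x l m : der_at A f x l -> der_at A g x m ->
  der_at A (fun y => f y * g y) x (l * g x + f x * m).
Proof.
move=> hf hg; rewrite /der_at.
have -> : (fun y => (f y * g y - f x * g x) / (y - x)) =
    fun y => (f y - f x) / (y - x) * g y + f x * ((g y - g x) / (y - x)).
  by apply/funext => y; ring.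
apply: cvgD; apply: cvgM => //; last exact: cvg_cst.
have := der_at_cvg hg; apply: cvg_trans; apply: cvg_app.
by move=> W; exact: nbhs_dnbhs.
Qed.

End der_at.

Section der_at_calculus.
Context {R : realType}.
Implicit Types (A B : set R) (f g : R -> R) (J : interval R).

Lemma der_atTP f (x l : R) : der_at setT f x l <-> is_derive x 1 f l.
Proof.
have E : (fun h : R => h^-1 *: (f (h *: (1 : R) + x) - f x)) =
    (fun y => (f y - f x) / (y - x)) \o shift x.
  by apply/funext => h /=; rewrite [h *: 1]mulr1 addrK mulrC.
have F : ((fun y => (f y - f x) / (y - x)) \o shift x) h @[h --> 0^'] --> l <->
    der_at setT f x l.
  rewrite /der_at; split => /cvgrPdist_le H; apply/cvgrPdist_le => e e0;
    move: (H e e0); rewrite !near_withinE.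
    move=> h; apply/(@nbhs0P R R^o); apply: filterS h => h /= H1 hx _.
    rewrite (addrC x h); apply: H1; apply: contra_neq hx => ->.
    by rewrite addr0.
  move/(@nbhs0P R R^o); apply: filterS => h /= + hx.
  by rewrite (addrC x h); apply => //; rewrite -subr_eq0 addrK.
split=> [/F d|[d1 d2]].
  have c : h^-1 *: (f (h *: (1 : R) + x) - f x) @[h --> 0^'] --> l by rewrite E.
  split; first exact: (cvgP _ c).
  exact: (cvg_lim (@Rhausdorff R) c).
by apply/F; rewrite -E -d2; exact: d1.
Qed.

Lemma der_at_is_derive A f (x l : R) :
  nbhs x A -> der_at A f x l -> is_derive x 1 f l.
Proof.
move=> xA /der_atP h; apply/der_atTP/der_atP => e /h.
rewrite !near_withinE => H; near=> y => _.
have yA : A y by near: y.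
by apply: (near H y) yA.
Unshelve. all: by end_near. Qed.

Lemma is_derive_der_at A f (x l : R) : is_derive x 1 f l -> der_at A f x l.
Proof. by move=> /der_atTP; exact: der_at_sub. Qed.

Lemma itv_convex J (a b z : R) : a \in J -> b \in J -> a <= z <= b -> z \in J.
Proof.
case: J => l r; rewrite !itv_boundlr => /andP[la ar] /andP[lb br] /andP[az zb].
by rewrite (le_trans la) ?leBSide//= (le_trans _ br)// leBSide.
Qed.

Lemma itv_nbhs J (a b z : R) : a \in J -> b \in J -> a < z < b ->
  nbhs z [set` J].
Proof.
move=> aJ bJ azb; have : nbhs z `]a, b[%classic.
  by apply: open_nbhs_nbhs; split; [exact: interval_open|rewrite /= in_itv].
apply: filterS => y /=; rewrite in_itv /= => /andP[ay yb].
by apply: itv_convex aJ bJ _; rewrite !ltW.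
Qed.

Lemma der_at_within_continuous J f f' :
  (forall x, x \in J -> der_at [set` J] f x (f' x)) ->
  {within [set` J], continuous f}.
Proof.
move=> h; apply/subspace_continuousP => x /= xJ.
exact: der_at_cvg (h x xJ).
Qed.

Lemma MVT_der_at J f f' (a b : R) : a < b -> a \in J -> b \in J ->
  (forall x, a < x < b -> der_at [set` J] f x (f' x)) ->
  {within `[a, b], continuous f} ->
  exists2 c, a < c < b & f b - f a = f' c * (b - a).
Proof.
move=> ab aJ bJ h cf.
have fd x : x \in `]a, b[ -> is_derive x 1 f (f' x).
  rewrite in_itv /= => xab.
  by apply: der_at_is_derive (h x xab); exact: (itv_nbhs aJ bJ).
by have [c + E] := MVT ab fd cf; rewrite in_itv /= => cab; exists c.
Qed.

Lemma MVT_itv J f f' (a b : R) : a < b -> a \in J -> b \in J ->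
  (forall x, x \in J -> der_at [set` J] f x (f' x)) ->
  exists2 c, a < c < b & f b - f a = f' c * (b - a).
Proof.
move=> ab aJ bJ h; apply: (MVT_der_at (J := J)) => //.
  by move=> x /andP[ax xb]; apply/h/(itv_convex aJ bJ); rewrite !ltW.
apply: (@continuous_subspaceW _ _ _ [set` J]); last exact: (der_at_within_continuous h).
by move=> x /=; rewrite in_itv; exact: itv_convex.
Qed.

(** Covers both orders of [a] and [b] and their equality. The bound on [c] makes the intermediate
    point tend to [a] whenever [b] does. *)
Lemma MVT_itv_le J f f' (a b : R) : a \in J -> b \in J ->
  (forall x, x \in J -> der_at [set` J] f x (f' x)) ->
  exists2 c, c \in J /\ `|c - a| <= `|b - a| & f b - f a = f' c * (b - a).
Proof.
move=> aJ bJ h; have [ab|ba|<-] := ltgtP a b.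
- have [c /andP[ac cb] E] := MVT_itv ab aJ bJ h; exists c => //.
  split; first by apply: itv_convex aJ bJ _; rewrite !ltW.
  by rewrite !ger0_norm; lra.
- have [c /andP[bc ca] E] := MVT_itv ba bJ aJ h; exists c => //.
    split; first by apply: itv_convex bJ aJ _; rewrite !ltW.
    by rewrite distrC [leRHS]distrC !ger0_norm; lra.
  by rewrite -(opprB (f a)) E -(opprB b a) mulrN opprK.
- by exists a; [rewrite subrr|rewrite !subrr mulr0].
Qed.

Lemma der_at_comp A B f g x (l m : R) : A x ->
  (forall y, A y -> B (f y)) ->
  der_at A f x l -> der_at B g (f x) m -> der_at A (g \o f) x (m * l).
Proof.
move=> Ax AB hf hg; apply/der_atP => e e0.
have cf := der_at_cvg hf.
move/der_atP : hf => hf.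
move/der_atP : hg => hg.
(* Chosen so that [d <= 1] and [d * (d + |l| + |m|) <= e], which is the total error of the two
   linearisations. *)
pose d := e / (`|m| + `|l| + 1 + e).
have D0 : 0 < `|m| + `|l| + 1 + e.
  by rewrite ltr_pwDr// addr_ge0// addr_ge0.
have d0 : 0 < d by rewrite divr_gt0.
have d1 : d <= 1.
  rewrite ler_pdivrMr// mul1r lerDr addr_ge0// addr_ge0//.
have {}hg : \forall y \near within A (nbhs x),
    `|g (f y) - g (f x) - m * (f y - f x)| <= d * `|f y - f x|.
  have := hg d d0; rewrite near_withinE => hg'.
  have := cf _ hg'; rewrite /= => hg2.
  move: hg2; rewrite !near_simpl /=.
  rewrite !near_withinE; apply: filterS => y + Ay.
  by move=> /(_ Ay); apply; exact: AB.
near=> y.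
have h1 : `|f y - f x - l * (y - x)| <= d * `|y - x| by near: y; exact: hf.
have h2 : `|g (f y) - g (f x) - m * (f y - f x)| <= d * `|f y - f x|.
  by near: y.
have h3 : `|f y - f x| <= (d + `|l|) * `|y - x|.
  have -> : f y - f x = (f y - f x - l * (y - x)) + l * (y - x) by ring.
  by rewrite (le_trans (ler_normD _ _))// mulrDl lerD// normrM.
have -> : (g \o f) y - (g \o f) x - m * l * (y - x) =
  (g (f y) - g (f x) - m * (f y - f x)) + m * (f y - f x - l * (y - x)).
  by rewrite /=; ring.
rewrite (le_trans (ler_normD _ _))// (le_trans (lerD h2 (lexx _)))//.
rewrite normrM.
rewrite (le_trans (lerD (ler_wpM2l (ltW d0) h3) (ler_wpM2l (normr_ge0 m) h1)))//.
have -> : d * ((d + `|l|) * `|y - x|) + `|m| * (d * `|y - x|) =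
  d * (d + `|l| + `|m|) * `|y - x| by ring.
rewrite ler_wpM2r// /d mulrAC ler_pdivrMr// ler_wpM2l//; first exact: ltW.
have := d1; rewrite /d; lra.
Unshelve. all: by end_near. Qed.

(** Chain rule along a curve without joint differentiability: the increment splits into a move in
    space at time [s], treated by the mean value theorem and continuity of [wx], and a move in time
    at the fixed point [y s0]. *)
Lemma der_at_curve (I J : interval R) (S : set R) (w wx : R -> R -> R) (wt : R)
    (y : R -> R) (s0 y' : R) :
  (forall x t, x \in I -> t \in J -> der_at [set` I] (w ^~ t) x (wx x t)) ->
  der_at [set` J] (w (y s0)) s0 wt ->
  {for (y s0, s0), continuous (fun p => wx p.1 p.2)} ->
  S `<=` [set` J] -> (forall s, S s -> y s \in I) -> S s0 ->
  der_at S y s0 y' ->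
  der_at S (fun s => w (y s) s) s0 (wx (y s0) s0 * y' + wt).
Proof.
move=> hx ht cx SJ Sy Ss0 dy.
have yI := Sy _ Ss0.
have s0J : s0 \in J by exact: SJ.
have [eta heta] : {eta : R -> R & forall s, S s ->
    `|eta s - y s0| <= `|y s - y s0| /\
    w (y s) s - w (y s0) s = wx (eta s) s * (y s - y s0)}.
  apply: (@choice _ _ (fun s e => S s -> `|e - y s0| <= `|y s - y s0| /\
    w (y s) s - w (y s0) s = wx e s * (y s - y s0))) => s.
  have [Ss|nSs] := pselect (S s); last by exists 0.
  have sJ : s \in J by exact: SJ.
  have [c [_ h1] h2] := @MVT_itv_le I (w ^~ s) (wx ^~ s) (y s0) (y s) yI
    (Sy _ Ss) (fun x xI => hx x s xI sJ).
  by exists c.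
have cy := der_at_cvg dy.
have ceta : eta @ within S (nbhs s0) --> y s0.
  apply/cvgrPdist_le => e e0.
  have : \forall s \near within S (nbhs s0), `|y s0 - y s| <= e.
    by move/cvgrPdist_le : cy; exact.
  rewrite !near_withinE; apply: filterS => s + Ss => /(_ Ss).
  by rewrite distrC => /(le_trans (heta s Ss).1); rewrite distrC.
rewrite /der_at.
have cw : wx (eta s) s @[s --> within S (nbhs s0)] --> wx (y s0) s0.
  apply: (@cvg_comp _ _ _ (fun s => (eta s, s)) (fun p => wx p.1 p.2) _
    (nbhs (y s0, s0))) => //.
  apply: (@cvg_pair _ _ _ (within S (nbhs s0)) (nbhs (y s0)) (nbhs s0)) => //.
  by move=> W; exact: cvg_within.
have H : wx (eta s) s * ((y s - y s0) / (s - s0)) +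
    (w (y s0) s - w (y s0) s0) / (s - s0) @[s --> within S s0^'] -->
    wx (y s0) s0 * y' + wt.
  apply: cvgD; last exact: (der_at_sub SJ).
  apply: cvgM => //.
  by apply: cvg_trans cw; apply: cvg_app => W; exact: nbhs_dnbhs.
apply: cvg_trans H; apply: near_eq_cvg.
rewrite near_withinE; near=> s => Ss.
have [_ h] := heta s Ss.
by rewrite mulrA -h -mulrDl; congr (_ / _); ring.
Unshelve. all: by end_near. Qed.

Lemma der_at_nondecreasing J f f' (a b : R) : a <= b -> a \in J -> b \in J ->
  (forall x, x \in J -> der_at [set` J] f x (f' x)) ->
  (forall x, x \in J -> 0 <= f' x) -> f a <= f b.
Proof.
rewrite le_eqVlt => /predU1P[->//|ab] aJ bJ h h0.
have [c /andP[ac cb] E] := MVT_itv ab aJ bJ h.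
rewrite -subr_ge0 E mulr_ge0//; last lra.
by apply/h0/(itv_convex aJ bJ); rewrite !ltW.
Qed.

Lemma der_at_eq0 J f (a b : R) : a \in J -> b \in J ->
  (forall x, x \in J -> der_at [set` J] f x 0) -> f a = f b.
Proof.
move=> aJ bJ h; have [c _ E] := @MVT_itv_le J f (cst 0) a b aJ bJ h.
by apply/esym/subr0_eq; rewrite E mul0r.
Qed.

(** The derivative of [f ^ 2] is at least [- 2 L f ^ 2], so [f ^ 2] times [expR (2 L x)] is
    nondecreasing; being zero at [b], it is zero at [a]. Information travels backwards, as along
    characteristics traced to earlier times. *)
Lemma gronwall0 f f' (a b L : R) : a <= b ->
  (forall x, x \in `[a, b] -> der_at `[a, b] f x (f' x)) ->
  (forall x, x \in `[a, b] -> `|f' x| <= L * `|f x|) ->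
  f b = 0 -> f a = 0.
Proof.
move=> ab h hL fb.
pose E x : R := expR ((2 * L) * x).
have dE x : x \in `[a, b] -> der_at `[a, b] E x (2 * L * E x).
  move=> xab.
  have -> : 2 * L * E x = E x * (0 * x + 2 * L * 1) by ring.
  apply: (@der_at_comp `[a, b] setT (fun y => 2 * L * y) expR) => //.
    by apply: der_atM; [exact: der_at_cst|exact: der_at_id].
  exact: is_derive_der_at (is_derive_expR _).
have : f a * f a * E a <= f b * f b * E b.
  apply: (@der_at_nondecreasing `[a, b] (fun x => f x * f x * E x)
    (fun x => (f' x * f x + f x * f' x) * E x + f x * f x * (2 * L * E x))) => //.
  - by rewrite in_itv /= lexx.
  - by rewrite in_itv /= lexx andbT.
  - by move=> x xab; apply: der_atM; [apply: der_atM; exact: h|exact: dE].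
  - move=> x xab.
    have -> : (f' x * f x + f x * f' x) * E x + f x * f x * (2 * L * E x) =
      2 * (f' x * f x + L * (f x * f x)) * E x by ring.
    rewrite mulr_ge0 ?expR_ge0// mulr_ge0//.
    have -> : f x * f x = `|f x| * `|f x| by rewrite -normrM ger0_norm// -expr2 sqr_ge0.
    have := ler_wpM2r (normr_ge0 (f x)) (hL x xab).
    rewrite -normrM -mulrA => h1.
    by have := ler_norm (- (f' x * f x)); rewrite normrN; lra.
rewrite fb !mul0r => h1.
have : f a * f a <= 0 by rewrite -(pmulr_lle0 _ (expR_gt0 (2 * L * a))).
rewrite -expr2 => h2; apply/eqP; rewrite -sqrf_eq0 eq_le h2 sqr_ge0 //.
Qed.

End der_at_calculus.

(** * Retractions onto intervals, bounds on segments, uniqueness of relative derivatives *)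

Section clamp.
Context {R : realType}.

Lemma continuous_comp_within {X Y Z : topologicalType} (A : set Y) (k : Y -> Z)
    (c : X -> Y) : {within A, continuous k} -> continuous c ->
  (forall x, A (c x)) -> continuous (k \o c).
Proof.
move=> /subspace_continuousP kA cc Ac x.
apply: (@cvg_comp _ _ _ c k _ (within A (nbhs (c x)))); last exact: kA.
move=> W /= ; rewrite /within /= => h.
have hc : nbhs x (c @^-1` [set z | A z -> W z]) by exact: cc.
by apply: (filterS _ hc) => z /=; apply; exact: Ac.
Qed.

Lemma continuous_pair_map {X Y Z W : topologicalType} (c : X -> Z) (d : Y -> W) :
  continuous c -> continuous d ->
  continuous (fun p : X * Y => (c p.1, d p.2)).
Proof.
move=> cc cd [x y]; apply: cvg_pair => /=.
  by apply: (@cvg_comp _ _ _ (@fst X Y) c _ (nbhs x)); [exact: cvg_fst|exact: cc].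
by apply: (@cvg_comp _ _ _ (@snd X Y) d _ (nbhs y)); [exact: cvg_snd|exact: cd].
Qed.

(** The retraction is the identity or clamping. The last clause, constancy beyond each endpoint, is
    what makes the clamped foot map locally constant where the foot lies outside [I]. *)
Lemma exists_retraction (I : interval R) : line_or_segment I ->
  exists c : R -> R, [/\ continuous c, forall x, c x \in I,
    forall x, x \in I -> c x = x &
    forall a b, I = `[a, b] -> forall x, (x < a -> c x = a) /\ (b < x -> c x = b)].
Proof.
case=> [->|[a [b [ab ->]]]].
  by exists id; split => // x; rewrite ?in_itv.
exists (fun x => Num.max a (Num.min x b)); split.
- move=> x; apply: (@continuous_max R R (cst a) (fun x => Num.min x b)).
    exact: cvg_cst.
  by apply: (@continuous_min R R id (cst b)); [exact: cvg_id|exact: cvg_cst].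
- by move=> x; rewrite in_itv /= le_max lexx /= ge_max (ltW ab) ge_min lexx orbT.
- move=> x; rewrite in_itv /= => /andP[ax xb].
  by rewrite (min_l xb) (max_r ax).
- move=> a' b' [<- <-] x; split=> [xa|bx].
    by rewrite (min_l (ltW (lt_trans xa ab))) (max_l (ltW xa)).
  by rewrite (min_r (ltW bx)) (max_r (ltW ab)).
Qed.

Lemma continuous_bounded_segment (k : R -> R) (a b : R) :
  {within `[a, b], continuous k} ->
  exists2 K, 0 <= K & forall x, x \in `[a, b] -> `|k x| <= K.
Proof.
move=> kc; have [ab|ba] := leP a b; last first.
  by exists 0 => // x; rewrite in_itv /= => /andP[/le_trans h /h]; rewrite leNgt ba.
have [|c cab hc] := @EVT_max R (fun x => `|k x|) a b ab.
  by move=> x; exact: (cvg_comp _ _ (kc x) (@norm_continuous _ R (k x))).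
by exists `|k c|.
Qed.

(** Limits are unique once the punctured filter is proper, that is, once [x] is an accumulation
    point of [J]. Two distinct points of [J] ensure this: approach [x] from the right if [x < b],
    and otherwise from the left. *)
Lemma der_at_unique (J : interval R) f (x l m a b : R) : a < b ->
  a \in J -> b \in J -> x \in J ->
  der_at [set` J] f x l -> der_at [set` J] f x m -> l = m.
Proof.
move=> ab aJ bJ xJ hl hm.
have FF : ProperFilter (within [set` J] x^').
  apply: Build_ProperFilter_ex => W.
  rewrite /within /= /dnbhs /within /= => -[e /= e0 hW].
  have [xb|bx] := ltP x b.
    have [d1 d2] : x < Num.min (x + e / 2) b /\ Num.min (x + e / 2) b < x + e.
      by rewrite lt_min gt_min; lra.
    exists (Num.min (x + e / 2) b); apply: hW; rewrite /= ?gt_eqF//.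
      by rewrite distrC ger0_norm ?subr_ge0 1?ltW//; lra.
    by apply: itv_convex xJ bJ _; rewrite (ltW d1) ge_min lexx orbT.
  have [d1 d2] : Num.max (x - e / 2) a < x /\ x - e < Num.max (x - e / 2) a.
    by rewrite gt_max lt_max; lra.
  exists (Num.max (x - e / 2) a); apply: hW; rewrite /= ?lt_eqF//.
    by rewrite ger0_norm ?subr_ge0 1?ltW//; lra.
  by apply: itv_convex aJ xJ _; rewrite (ltW d1) le_max lexx orbT.
exact: cvg_unique hl hm.
Qed.

Lemma der_at_near A f g (x l : R) : A x ->
  (\forall y \near within A (nbhs x), f y = g y) ->
  der_at A f x l -> der_at A g x l.
Proof.
move=> Ax fg /der_atP h; apply/der_atP => e /h h'.
have fgx : f x = g x by move: fg; rewrite near_withinE => /nbhs_singleton; exact.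
by apply: filterS (filterI h' fg) => y /= [+ <-]; rewrite fgx.
Qed.

End clamp.

(** * Characteristics *)

Definition boundary_pt {R : realType} (I : interval R) (x : R) : Prop :=
  exists a b, [/\ a < b, I = `[a, b] & x = a \/ x = b].

(* Classical solutions, with all functions extended continuously to the whole
   line (resp. plane) and their derivatives given explicitly. *)
Record solution {R : realType} (I : interval R) (T M N alpha : R)
    (f f1 f2 G G1 u0 u01 : R -> R) (u ux ut : R -> R -> R) : Prop := Solution {
  sol_I : line_or_segment I;
  sol_T : 0 < T;
  sol_M : 0 < M;
  sol_alpha : 0 < alpha;
  sol_cu : continuous (fun p : R * R => u p.1 p.2);
  sol_cux : continuous (fun p : R * R => ux p.1 p.2);
  sol_cut : continuous (fun p : R * R => ut p.1 p.2);
  sol_cf : continuous f;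
  sol_cf1 : continuous f1;
  sol_cf2 : continuous f2;
  sol_cG : continuous G;
  sol_cG1 : continuous G1;
  sol_cu0 : continuous u0;
  sol_cu01 : continuous u01;
  sol_uM : forall x t, u x t \in `[- M, M];
  sol_ux : forall x t, x \in I -> t \in `[0, T] ->
    der_at [set` I] (u ^~ t) x (ux x t);
  sol_ut : forall x t, x \in I -> t \in `[0, T] ->
    der_at `[0, T] (u x) t (ut x t);
  sol_f : forall v, v \in `[- M, M] -> der_at `[- M, M] f v (f1 v);
  sol_f1 : forall v, v \in `[- M, M] -> der_at `[- M, M] f1 v (f2 v);
  sol_G : forall v, v \in `[- M, M] -> der_at `[- M, M] G v (G1 v);
  sol_fG : forall v, v \in `[- M, M] -> f v = v * G v;
  sol_pde : forall x t, x \in I -> t \in `[0, T] ->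
    ut x t + f1 (u x t) * ux x t = 0;
  sol_init : forall x, x \in I -> u x 0 = u0 x;
  sol_u0 : forall x, x \in I -> der_at [set` I] u0 x (u01 x);
  sol_u0_ge0 : forall x, 0 <= u0 x;
  sol_u01 : forall x, `|u01 x| <= N;
  sol_char : forall t x, t \in `[0, T] -> x \in I ->
    alpha <= 1 + t * f2 (u0 x) * u01 x;
  sol_bd : forall x t, boundary_pt I x -> t \in `[0, T] -> G (u x t) = 0 }.

Lemma continuous_curve {R : realType} (w : R -> R -> R) (y z : R -> R) :
  continuous (fun p : R * R => w p.1 p.2) -> continuous y -> continuous z ->
  continuous (fun r => w (y r) (z r)).
Proof.
move=> cw cy cz r.
apply: (@cvg_comp _ _ _ (fun r => (y r, z r)) (fun p : R * R => w p.1 p.2) _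
  (nbhs (y r, z r))); last exact: (cw (y r, z r)).
apply: (@cvg_pair _ _ _ (nbhs r) (nbhs (y r)) (nbhs (z r))).
  exact: cy.
exact: cz.
Qed.

Section characteristics.
Context {R : realType} {I : interval R} {T M N alpha : R}
  {f f1 f2 G G1 u0 u01 : R -> R} {u ux ut : R -> R -> R}
  (S : solution I T M N alpha f f1 f2 G G1 u0 u01 u ux ut).

Let J : interval R := `[0, T].
Let V : interval R := `[- M, M].

Lemma boundary_pt_in x : boundary_pt I x -> x \in I.
Proof.
by move=> [a [b [ab -> [->|->]]]]; rewrite in_itv /= ?lexx ?(ltW ab).
Qed.

Lemma in0T : 0 \in J.
Proof. by rewrite in_itv /= lexx ltW// (sol_T S). Qed.

Lemma unique_J g t l m : t \in J -> der_at [set` J] g t l ->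
  der_at [set` J] g t m -> l = m.
Proof.
apply: (@der_at_unique R J g t l m 0 T); rewrite ?(sol_T S)// in_itv /= lexx.
  by rewrite ltW// (sol_T S).
by rewrite ltW// (sol_T S).
Qed.

Lemma unique_V g t l m : t \in V -> der_at [set` V] g t l ->
  der_at [set` V] g t m -> l = m.
Proof.
have M0 := sol_M S.
by apply: (@der_at_unique R V g t l m (- M) M); rewrite ?in_itv /=; lra.
Qed.

Lemma unique_I g x l m : x \in I -> der_at [set` I] g x l ->
  der_at [set` I] g x m -> l = m.
Proof.
have [->|[a [b [ab ->]]]] := sol_I S.
  by apply: (@der_at_unique _ _ _ _ _ _ 0 1); rewrite ?in_itv.
by apply: (@der_at_unique _ _ _ _ _ _ a b); rewrite ?in_itv /= ?lexx ?(ltW ab).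
Qed.

(** Product rule for [f v = v * G v] and uniqueness of the derivative. The characteristic speed thus
    differs from the velocity of mass by [v * G1 v], the source of the acceleration. *)
Lemma f1E v : v \in V -> f1 v = G v + v * G1 v.
Proof.
move=> vV; apply: (unique_V vV (sol_f S vV)).
rewrite -(mul1r (G v)).
apply: (@der_at_ext _ _ (fun v => v * G v)) => //.
  by move=> y; rewrite inE => yV; rewrite (sol_fG S).
by apply: der_atM; [exact: der_at_id|exact: (sol_G S)].
Qed.

Lemma f1_lipschitz : exists2 L, 0 <= L &
  forall v w, v \in V -> w \in V -> `|f1 v - f1 w| <= L * `|v - w|.
Proof.
have [L L0 hL] := @continuous_bounded_segment R f2 (- M) M
  (continuous_subspaceT (sol_cf2 S)).
exists L => // v w vV wV.
have [c [cV _] ->] := MVT_itv_le wV vV (sol_f1 S).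
by rewrite normrM ler_wpM2r//; exact: hL.
Qed.

(* The velocity G vanishes on the boundary, so G' vanishes along the boundary
   values wherever they vary in time; then so does the characteristic speed
   f' = G + u G', and the equation forces them to be constant. *)
Lemma boundary_value x t : boundary_pt I x -> t \in J -> u x t = u0 x.
Proof.
move=> bx tJ; have xI := boundary_pt_in bx.
rewrite -(sol_init S xI); apply: (@der_at_eq0 R J (u x)) => //; first exact: in0T.
move=> s sJ; have us := sol_uM S x s.
have [<-|/eqP ut0] := eqVneq (ut x s) 0; first exact: (sol_ut S).
have h1 : der_at `[0, T] (G \o u x) s (G1 (u x s) * ut x s).
  apply: (@der_at_comp _ _ `[- M, M]) => //.
  - by move=> y _; exact: (sol_uM S).
  - exact: (sol_ut S).
  - exact: (sol_G S).
have h2 : der_at `[0, T] (G \o u x) s 0.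
  apply: (@der_at_ext _ _ (cst 0)) => //; last exact: der_at_cst.
  by move=> y; rewrite inE /= => yJ; rewrite (sol_bd S).
have /eqP := unique_J sJ h1 h2; rewrite mulf_eq0 => /orP[/eqP G10|/eqP//].
have := sol_pde S xI sJ.
by rewrite f1E// G10 (sol_bd S)// mulr0 add0r mul0r addr0.
Qed.

Lemma affine_der_at A (x t c s : R) : der_at A (fun s => x - (t - s) * c) s c.
Proof.
apply/der_atP => e e0; apply: nearW => y.
have -> : x - (t - y) * c - (x - (t - s) * c) - c * (y - s) = 0 by ring.
by rewrite normr0 mulr_ge0// ltW.
Qed.

Lemma affine_continuous (x t c : R) : continuous (fun s => x - (t - s) * c).
Proof.
move=> s; apply: cvgB; first exact: cvg_cst.
apply: cvgM; last exact: cvg_cst.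
by apply: cvgB; [exact: cvg_cst|exact: cvg_id].
Qed.

Lemma char_in (x t s0 s c : R) : x \in I -> 0 <= s0 -> s0 <= s -> s <= t ->
  x - (t - s0) * c \in I -> x - (t - s) * c \in I.
Proof.
move=> xI s00 s0s st yI.
have [c0|c0] := leP 0 c.
  apply: itv_convex yI xI _; apply/andP; split.
    by rewrite lerD2l lerN2; apply: ler_wpM2r => //; lra.
  by rewrite gerDl oppr_le0 mulr_ge0// subr_ge0.
apply: itv_convex xI yI _; apply/andP; split.
  by rewrite lerDl oppr_ge0 mulr_ge0_le0 ?subr_ge0// ltW.
by rewrite lerD2l lerN2; apply: ler_wnM2r; [exact: ltW|lra].
Qed.

(** The line is drawn with the speed [c] frozen at its upper end, so no differential equation is
    solved. Along it the deviation of [u] from [u x t] has derivative [ux * (c - f1 u)], bounded by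
    a multiple of the deviation since [f1] is Lipschitz; Gronwall back from time [t] makes it
    vanish. *)
Lemma char_const (x t s0 : R) : x \in I -> t \in J -> 0 <= s0 <= t ->
  let c := f1 (u x t) in x - (t - s0) * c \in I ->
  forall s, s0 <= s <= t -> u (x - (t - s) * c) s = u x t.
Proof.
move=> xI tJ /andP[s00 s0t] c y0I s /andP[s0s st].
have tT : t <= T by move: tJ; rewrite in_itv /= => /andP[].
have s0' : 0 <= s by exact: le_trans s0s.
pose y r := x - (t - r) * c.
have yI r : r \in `[s, t] -> y r \in I.
  rewrite in_itv /= => /andP[sr rt].
  by apply: (@char_in x t s0) => //; exact: le_trans sr.
have rJ r : r \in `[s, t] -> r \in J.
  by rewrite !in_itv /= => /andP[sr rt]; rewrite (le_trans s0')//= (le_trans rt).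
have [L L0 hL] := f1_lipschitz.
have [K K0 hK] := @continuous_bounded_segment R (fun r => ux (y r) r) s t
  (continuous_subspaceT (continuous_curve (sol_cux S)
    (@affine_continuous x t c) (fun r => @cvg_id _ (nbhs r)))).
apply/eqP; rewrite -subr_eq0; apply/eqP.
apply: (@gronwall0 R (fun r => u (y r) r - u x t)
  (fun r => ux (y r) r * c + ut (y r) r + 0) s t (K * L)) => //.
- move=> r rst; apply: der_atD; last exact: der_at_cst.
  apply: (@der_at_curve R I J `[s, t] u ux (ut (y r) r) y r c) => //.
  + exact: (sol_ux S).
  + by apply: (sol_ut S); [exact: yI|exact: rJ].
  + exact: (sol_cux S).
  + exact: affine_der_at.
- move=> r rst; rewrite addr0.
  have -> : ux (y r) r * c + ut (y r) r = ux (y r) r * (c - f1 (u (y r) r)).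
    by have := sol_pde S (yI r rst) (rJ r rst); lra.
  rewrite normrM -mulrA ler_pM ?hK// distrC.
  by apply: hL; exact: (sol_uM S).
- by rewrite /y subrr mul0r subr0 subrr.
Qed.

Lemma char_exit_left (a x t c : R) : a <= x -> x - t * c < a -> 0 <= t ->
  exists s0, 0 <= s0 <= t /\ a = x - (t - s0) * c.
Proof.
move=> ax ya t0; have c0 : 0 < c.
  by rewrite ltNge; apply/negP => c0; have := mulr_ge0_le0 t0 c0; lra.
have h : (x - a) / c * c = x - a by rewrite divfK// gt_eqF.
have q0 : 0 <= (x - a) / c by apply: divr_ge0; lra.
have qt : (x - a) / c <= t by rewrite ler_pdivrMr//; lra.
exists (t - (x - a) / c); split; first by apply/andP; split; lra.
have -> : t - (t - (x - a) / c) = (x - a) / c by ring.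
by rewrite h; ring.
Qed.

Lemma char_exit_right (b x t c : R) : x <= b -> b < x - t * c -> 0 <= t ->
  exists s0, 0 <= s0 <= t /\ b = x - (t - s0) * c.
Proof.
move=> xb yb t0; have [] := @char_exit_left (- b) (- x) t (- c); [lra|lra|lra|].
move=> s0 [s0t E]; exists s0; split => //.
by rewrite -(opprK b) E; ring.
Qed.

(** The backward characteristic either stays in [I] down to time 0 or is stopped at the time when it
    crosses an endpoint. *)
Lemma char_foot x t : x \in I -> t \in J -> exists s0 y0,
  [/\ 0 <= s0 <= t, y0 \in I, y0 = x - (t - s0) * f1 (u x t) &
      s0 = 0 \/ boundary_pt I y0].
Proof.
move=> xI tJ; set c := f1 _.
have t0 : 0 <= t by move: tJ; rewrite in_itv /= => /andP[].
have [yI|yI] := boolP (x - (t - 0) * c \in I).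
  by exists 0, (x - (t - 0) * c); split => //; [rewrite lexx|left].
have [IE|[a [b [ab IE]]]] := sol_I S; first by rewrite IE in_itv in yI.
have [ax xb] : a <= x /\ x <= b.
  by move: xI; rewrite IE in_itv /= => /andP.
have aI : a \in I by rewrite IE in_itv /= lexx ltW.
have bI : b \in I by rewrite IE in_itv /= lexx ltW.
have bda : boundary_pt I a by exists a, b; split => //; left.
have bdb : boundary_pt I b by exists a, b; split => //; right.
move: yI; rewrite IE in_itv /= negb_and -!ltNge subr0 -IE => /orP[ya|yb].
  have [s0 [h1 h2]] := char_exit_left ax ya t0.
  by exists s0, a; split => //; right.
have [s0 [h1 h2]] := char_exit_right xb yb t0.
by exists s0, b; split => //; right.
Qed.

(** Wherever the backward characteristic stops, [u] takes there a value of [u0]: by the initial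
    condition, or by constancy of the boundary values. Nonnegativity of [u] follows at once. *)
Lemma u_value x t : x \in I -> t \in J -> exists s0 y0,
  [/\ 0 <= s0 <= t, y0 \in I, y0 = x - (t - s0) * f1 (u0 y0) & u x t = u0 y0].
Proof.
move=> xI tJ; have [s0 [y0 [/andP[s00 s0t] y0I y0E h]]] := char_foot xI tJ.
have E : u y0 s0 = u x t.
  rewrite y0E; apply: (@char_const x t s0) => //; rewrite -?y0E ?s00 ?lexx //.
have E' : u x t = u0 y0.
  rewrite -E; case: h => [->|b]; first exact: (sol_init S).
  apply: boundary_value => //.
  by move: tJ; rewrite !in_itv /= s00 => /andP[_]; exact: le_trans.
by exists s0, y0; split; rewrite -?E'// s00.
Qed.

Lemma u_ge0 x t : x \in I -> t \in J -> 0 <= u x t.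
Proof. by move=> xI tJ; have [? [? [_ _ _ ->]]] := u_value xI tJ; exact: (sol_u0_ge0 S). Qed.

Lemma u_foot x t : x \in I -> t \in J -> x - t * f1 (u x t) \in I ->
  u x t = u0 (x - t * f1 (u x t)).
Proof.
move=> xI tJ yI; have t0 : 0 <= t by move: tJ; rewrite in_itv => /andP[].
rewrite -[in LHS](@char_const x t 0 xI tJ _ _ 0) ?lexx ?subr0//.
exact: (sol_init S).
Qed.

Lemma u_foot_left x t a b : I = `[a, b] -> x \in I -> t \in J ->
  x - t * f1 (u x t) < a -> u x t = u0 a.
Proof.
move=> IE xI tJ ya; have /andP[t0 tT] : 0 <= t <= T by move: tJ; rewrite in_itv.
have [ax xb] : a <= x /\ x <= b by move: xI; rewrite IE in_itv /= => /andP.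
have [s0 [h1 h2]] := char_exit_left ax ya t0.
have aI : a \in I by rewrite IE in_itv /= lexx (le_trans ax).
(* A degenerate segment is excluded by [line_or_segment], which asks for strictly ordered
   endpoints. *)
have [abE|ab] := eqVneq a b.
  by have := sol_I S; rewrite IE => -[//|[a' [b' [ab' [e1 e2]]]]]; lra.
rewrite -(@char_const x t s0 xI tJ h1 _ s0); rewrite -?h2 ?lexx//; last first.
  by case/andP: h1.
apply: boundary_value.
  by exists a, b; split => //; [rewrite lt_neqAle ab (le_trans ax)|left].
by case/andP: h1 => s00 s0t; rewrite in_itv /= s00 (le_trans s0t).
Qed.

Lemma u_foot_right x t a b : I = `[a, b] -> x \in I -> t \in J ->
  b < x - t * f1 (u x t) -> u x t = u0 b.
Proof.
move=> IE xI tJ yb; have /andP[t0 tT] : 0 <= t <= T by move: tJ; rewrite in_itv.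
have [ax xb] : a <= x /\ x <= b by move: xI; rewrite IE in_itv /= => /andP.
have [s0 [h1 h2]] := char_exit_right xb yb t0.
have bI : b \in I by rewrite IE in_itv /= lexx (le_trans ax).
have [abE|ab] := eqVneq a b.
  by have := sol_I S; rewrite IE => -[//|[a' [b' [ab' [e1 e2]]]]]; lra.
rewrite -(@char_const x t s0 xI tJ h1 _ s0); rewrite -?h2 ?lexx//; last first.
  by case/andP: h1.
apply: boundary_value.
  by exists a, b; split => //; [rewrite lt_neqAle ab (le_trans ax)|right].
by case/andP: h1 => s00 s0t; rewrite in_itv /= s00 (le_trans s0t).
Qed.

End characteristics.

(** * Integrals compared through antiderivatives *)

Section integrals.
Context {R : realType}.
Implicit Types (k F : R -> R) (a b : R).
Local Notation mu := (@lebesgue_measure R).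

Lemma continuous_integrable k a b : continuous k ->
  mu.-integrable `[a, b] (EFin \o k).
Proof.
move=> ck; apply: continuous_compact_integrable; first exact: segment_compact.
exact: continuous_subspaceT.
Qed.

Lemma continuous_measurable k (D : set R) : continuous k -> measurable_fun D k.
Proof.
by move=> ck; apply: measurable_funTS; exact: continuous_measurable_fun.
Qed.

Lemma FTC2_der_at k F a b : a <= b -> continuous k ->
  (forall x, x \in `[a, b] -> der_at `[a, b] F x (k x)) ->
  (\int[mu]_(x in `[a, b]) (k x)%:E = (F b - F a)%:E)%E.
Proof.
rewrite le_eqVlt => /predU1P[<- _ _|ab ck dF].
  by rewrite set_itv1 integral_set1 subrr.
have d x : x \in `]a, b[ -> is_derive x 1 F (k x).
  rewrite in_itv /= => /andP[ax xb].
  apply: (@der_at_is_derive _ `[a, b]); last by apply: dF; rewrite in_itv /= !ltW.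
  by apply: (@itv_nbhs _ `[a, b] a b); rewrite ?in_itv /= ?lexx ?(ltW ab) ?ax.
rewrite EFinB; apply: continuous_FTC2 => //.
- exact: continuous_subspaceT.
- have /(continuous_within_itvP _ ab)[_ ha hb] : {within `[a, b], continuous F}.
    exact: (@der_at_within_continuous _ `[a, b] F k).
  by split => // x /d [].
- by move=> x /d dx; rewrite derive1E; exact: derive_val.
Qed.

Lemma exists_antiderivative k a b : a < b -> continuous k ->
  exists F, forall x, x \in `[a, b] -> der_at setT F x (k x).
Proof.
move=> ab ck.
(* The room from [a - 1] to [b + 1] makes the derivative two-sided at [a] and [b] too. *)
exists (fun x => \int[mu]_(t in `[a - 1, x]) k t) => x.
rewrite in_itv /= => /andP[ax xb].
have xb1 : x < b + 1 by lra.
have ax1 : a - 1 < x by lra.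
have [d1 d2] := continuous_FTC1_closed xb1
  (@continuous_integrable k (a - 1) (b + 1) ck) ax1 (ck x).
by apply/der_atTP; split; [exact: d1|rewrite -derive1E; exact: d2].
Qed.

(** Induction on the exceptional points: the interval is cut at each one that lies inside, and
    continuity of [F] glues the pieces. The exceptions will be the points whose foot is an endpoint
    of [I]. *)
Lemma nondecreasing_off_seq (l : seq R) F (F' : R -> R) a b : a <= b ->
  {within `[a, b], continuous F} ->
  (forall x, a < x < b -> x \notin l ->
    der_at `[a, b] F x (F' x) /\ 0 <= F' x) -> F a <= F b.
Proof.
elim: l a b => [|c l IH] a b; rewrite le_eqVlt => /predU1P[->//|ab] cF h.
  have [|||z /andP[az zb] E] := @MVT_der_at R `[a, b] F F' a b ab _ _ _ cF.
  - by rewrite in_itv /= lexx ltW.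
  - by rewrite in_itv /= lexx ltW.
  - by move=> x xab; exact: (h x xab _).1.
  rewrite -subr_ge0 E mulr_ge0//; last lra.
  by apply: (h z _ _).2; rewrite ?az.
have sub a' b' : a <= a' -> b' <= b -> `[a', b'] `<=` `[a, b].
  by move=> aa bb; apply: subset_itvScc; rewrite bnd_simp.
have [/andP[ac cb]|nc] := boolP (a < c < b).
  apply: (@le_trans _ _ (F c)).
    apply: (IH a c (ltW ac)).
      by apply: continuous_subspaceW cF; apply: sub => //; exact: ltW.
    move=> x /andP[ax xc] xl; have [||d1 d2] := h x.
    - by rewrite ax (lt_trans xc).
    - by rewrite inE negb_or lt_eqF.
    - by split => //; apply: der_at_sub d1; apply: sub => //; exact: ltW.
  apply: (IH c b (ltW cb)).
    by apply: continuous_subspaceW cF; apply: sub => //; exact: ltW.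
  move=> x /andP[cx xb] xl; have [||d1 d2] := h x.
  - by rewrite xb (lt_trans ac).
  - by rewrite inE negb_or gt_eqF.
  - by split => //; apply: der_at_sub d1; apply: sub => //; exact: ltW.
apply: IH => //; first exact: ltW.
move=> x xab xl; apply: h => //; rewrite inE negb_or xl andbT.
by apply: contra nc => /eqP <-.
Qed.

(** Apply the monotonicity criterion to [F - H] with [H] an antiderivative of [k]; in this way only
    [k] is integrated, never [F']. *)
Lemma integral_le_increment (l : seq R) k F (F' : R -> R) a b : a <= b ->
  continuous k -> {within `[a, b], continuous F} ->
  (forall x, a < x < b -> x \notin l ->
    der_at `[a, b] F x (F' x) /\ k x <= F' x) ->
  (\int[mu]_(x in `[a, b]) (k x)%:E <= (F b - F a)%:E)%E.
Proof.
rewrite le_eqVlt => /predU1P[<- *|ab ck cF h].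
  by rewrite set_itv1 integral_set1 subrr.
have [H dH] := exists_antiderivative ab ck.
have dH' x : x \in `[a, b] -> der_at `[a, b] H x (k x).
  by move=> /dH; exact: der_at_sub.
rewrite (FTC2_der_at (ltW ab) ck dH') lee_fin lerBlDr addrAC -lerBlDr opprK.
suff : F a + (-1) * H a <= F b + (-1) * H b by lra.
apply: (@nondecreasing_off_seq l (fun x => F x + (-1) * H x)
    (fun x => F' x + (-1) * k x)) => //; first exact: ltW.
  have cH : {within `[a, b], continuous H}.
    exact: (@der_at_within_continuous _ `[a, b] H k).
  move=> x; apply: cvgD; first exact: cF.
  by apply: cvgM; [exact: cvg_cst|exact: cH].
move=> x xab xl; have [d1 d2] := h x xab xl; split; last lra.
apply: der_atD => //.
have -> : -1 * k x = 0 * H x + -1 * k x by ring.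
apply: der_atM; first exact: der_at_cst.
by apply: dH'; case/andP: xab => ax xb; rewrite in_itv /= !ltW.
Qed.

(** On the line this is monotone convergence along the intervals [[-n, n]]. *)
Lemma integral_line_le (I : interval R) (k : R -> R) (C : \bar R) :
  line_or_segment I -> measurable_fun setT k -> (forall x, x \in I -> 0 <= k x) ->
  (forall a b, a <= b -> a \in I -> b \in I ->
    (\int[mu]_(x in `[a, b]) (k x)%:E <= C)%E) ->
  (\int[mu]_(x in [set` I]) (k x)%:E <= C)%E.
Proof.
move=> [->|[a [b [ab ->]]]] mk k0 h; last first.
  by apply: h; rewrite ?in_itv /= ?lexx ltW.
pose E (n : nat) : set R := [set` `[- n%:R, n%:R]].
have -> : [set` `]-oo, +oo[] = \bigcup_n E n.
  apply/seteqP; split => // x _; have := archi_boundP (normr_ge0 x).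
  set n := Num.bound _ => xn; exists n => //; rewrite /E /= in_itv /=.
  by rewrite -ler_norml ltW.
have nE : {homo E : n m / (n <= m)%N >-> (n <= m)%O}.
  move=> n m nm; apply/subsetPset => x; rewrite /E /= !in_itv /=.
  have : (n%:R : R) <= m%:R by rewrite ler_nat.
  by move=> ? /andP[? ?]; apply/andP; split; lra.
have mE n : measurable (E n : set (measurableTypeR R)) by exact: measurable_itv.
have cv : (\int[mu]_(x in E i) (k x)%:E @[i --> \oo] -->
    \int[mu]_(x in \bigcup_i E i) (k x)%:E)%E.
  apply: (@ge0_nondecreasing_set_cvg_integral _ (measurableTypeR R) R E
    (EFin \o k) mu nE mE).
  - by move=> n; exact/measurable_EFinP/measurable_funTS.
  - by move=> n x _; rewrite lee_fin k0// in_itv.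
rewrite -(cvg_lim _ cv)//.
apply: lime_le; first by apply: cvgP cv.
apply: nearW => n; apply: h; rewrite ?in_itv//.
by rewrite -subr_ge0 opprK addr_ge0.
Qed.

End integrals.

Lemma continuousX_fun {R : realType} (k : R -> R) n : continuous k ->
  continuous (fun x => k x ^+ n).
Proof.
move=> ck x; apply: (@cvg_comp _ _ _ k (fun y => y ^+ n)); first exact: ck.
exact: exprn_continuous.
Qed.

(** * The foot map and the energy estimate *)

Section energy.
Context {R : realType} {I : interval R} {T M N alpha : R}
  {f f1 f2 G G1 u0 u01 : R -> R} {u ux ut : R -> R -> R}
  (S : solution I T M N alpha f f1 f2 G G1 u0 u01 u ux ut).
Local Notation mu := (@lebesgue_measure R).

Definition foot t x := x - t * f1 (u x t).

Lemma foot_der x t : x \in I -> t \in `[0, T] ->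
  der_at [set` I] (foot t) x (1 - t * (f2 (u x t) * ux x t)).
Proof.
move=> xI tJ; rewrite /foot.
have -> : (fun x => x - t * f1 (u x t)) = (fun x => x + - t * f1 (u x t)).
  by apply/funext => y; ring.
have -> : 1 - t * (f2 (u x t) * ux x t) =
  1 + (0 * f1 (u x t) + - t * (f2 (u x t) * ux x t)) by ring.
apply: der_atD; first exact: der_at_id.
apply: der_atM; first exact: der_at_cst.
apply: (@der_at_comp _ _ `[- M, M] (u ^~ t) f1) => //.
- by move=> y _; exact: (sol_uM S).
- exact: (sol_ux S).
- by apply: (sol_f1 S); exact: (sol_uM S).
Qed.

Lemma foot_continuous t : continuous (foot t).
Proof.
move=> x; apply: cvgB; first exact: cvg_id.
apply: cvgM; first exact: cvg_cst.
have cu : continuous (fun y => u y t).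
  by apply: (continuous_curve (sol_cu S)) => y; [exact: cvg_id|exact: cvg_cst].
by apply: (@cvg_comp _ _ _ (fun y => u y t) f1); [exact: cu|exact: (sol_cf1 S)].
Qed.

(** With the foot interior, [u = u0 \o foot t] holds near [x], so [ux = u01 * p] for [p] the
    derivative of the foot map. Then [p * D = p + t f2 (u01 p) = p + t f2 ux = 1]: the derivative of
    the foot map is [D^-1]. *)
Lemma ux_inner x t : x \in I -> t \in `[0, T] -> nbhs (foot t x) [set` I] ->
  let D := 1 + t * f2 (u0 (foot t x)) * u01 (foot t x) in
  [/\ u x t = u0 (foot t x), ux x t * D = u01 (foot t x) &
      (1 - t * (f2 (u x t) * ux x t)) * D = 1].
Proof.
move=> xI tJ yI D.
have uE : u x t = u0 (foot t x) by apply: (u_foot S) => //; exact: nbhs_singleton yI.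
have E : ux x t = u01 (foot t x) * (1 - t * (f2 (u x t) * ux x t)).
  apply: (unique_I S xI (sol_ux S xI tJ)).
  have nI : \forall y \near x, [set` I] (foot t y) := foot_continuous yI.
  apply: (@der_at_near _ _ (u0 \o foot t)) => //.
    rewrite near_withinE; apply: filterS nI => y yI' yI''.
    by rewrite /= -(u_foot S).
  apply: (@der_at_near _ _ (fun y => u0 (foot t y))) => //.
    by rewrite near_withinE; apply: nearW.
  apply/der_atP => e e0.
  have l1 : der_at [set` I] u0 (foot t x) (u01 (foot t x)).
    by apply: (sol_u0 S); exact: nbhs_singleton yI.
  have l2 : der_at setT u0 (foot t x) (u01 (foot t x)).
    by apply/der_atTP/(der_at_is_derive yI).
  have := @der_at_comp _ _ setT (foot t) u0 x _ _ xI (fun _ _ => Logic.I)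
    (foot_der xI tJ) l2.
  by move/der_atP => /(_ e e0).
have E2 : (1 - t * (f2 (u x t) * ux x t)) * D = 1.
  rewrite /D -uE; set p := 1 - _ in E *.
  have -> : p * (1 + t * f2 (u x t) * u01 (foot t x)) =
    p + t * f2 (u x t) * (u01 (foot t x) * p) by ring.
  by rewrite -E /p; ring.
split => //.
by rewrite {1}E -mulrA E2 mulr1.
Qed.

Lemma ux_outer x t a b : I = `[a, b] -> x \in I -> t \in `[0, T] ->
  foot t x < a \/ b < foot t x -> ux x t = 0.
Proof.
move=> IE xI tJ yab; apply: (unique_I S xI (sol_ux S xI tJ)).
have [c hc] : exists c, \forall y \near within [set` I] (nbhs x), c = u y t.
  case: yab => yab.
    exists (u0 a); have n : \forall y \near x, foot t y < a.
      by exact: (cvgr_lt (foot t x) (@foot_continuous t x)).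
    rewrite near_withinE; apply: filterS n => y ya yI.
    by rewrite (u_foot_left S IE).
  exists (u0 b); have n : \forall y \near x, b < foot t y.
    by exact: (cvgr_gt (foot t x) (@foot_continuous t x)).
  rewrite near_withinE; apply: filterS n => y yb yI.
  by rewrite (u_foot_right S IE).
by apply: der_at_near hc _ => //; exact: der_at_cst.
Qed.

Definition energy_density x t := u x t ^+ 3 * G1 (u x t) ^+ 4 * ux x t ^+ 2.
Definition energy_density0 x := u0 x ^+ 3 * G1 (u0 x) ^+ 4 * u01 x ^+ 2.

(** The square of [ux = u01 * p] contains [p] twice: one factor is kept as the Jacobian of the foot
    map, the other is [D^-1] and is bounded by [alpha^-1]. *)
Lemma energy_density_le x t : x \in I -> t \in `[0, T] ->
  nbhs (foot t x) [set` I] ->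
  energy_density x t <= alpha^-1 *
    (energy_density0 (foot t x) * (1 - t * (f2 (u x t) * ux x t))).
Proof.
move=> xI tJ yI.
have /= [uE E1 E2] := ux_inner xI tJ yI.
have yI' : foot t x \in I by exact: nbhs_singleton yI.
have := sol_char S tJ yI'; have := sol_alpha S.
set D := 1 + _ in E1 E2 *; set p := 1 - _ in E2 * => a0 aD.
have D0 : 0 < D by exact: lt_le_trans aD.
have pE : p = D^-1 by rewrite -[p](mulfK (lt0r_neq0 D0)) E2 mul1r.
have uxE : ux x t = u01 (foot t x) * p by rewrite pE -E1 mulfK// gt_eqF.
have p0 : 0 < p by rewrite pE invr_gt0.
rewrite /energy_density /energy_density0 uE uxE.
set h3 := u0 _ ^+ 3; set h4 := G1 _ ^+ 4; set v := u01 _.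
have -> : h3 * h4 * (v * p) ^+ 2 = p * (h3 * h4 * v ^+ 2 * p) by ring.
apply: ler_wpM2r.
  apply: mulr_ge0; last exact: ltW.
  apply: mulr_ge0 (sqr_ge0 _); apply: mulr_ge0; last exact: exprn_even_ge0.
  by apply: exprn_ge0; exact: (sol_u0_ge0 S).
by rewrite pE lef_pV2.
Qed.

Lemma continuous_energy_density t : continuous (energy_density ^~ t).
Proof.
move=> x.
have cu : continuous (u ^~ t).
  by apply: (continuous_curve (sol_cu S)) => y; [exact: cvg_id|exact: cvg_cst].
have cux : continuous (ux ^~ t).
  by apply: (continuous_curve (sol_cux S)) => y; [exact: cvg_id|exact: cvg_cst].
have cG : continuous (fun y => G1 (u y t)).
  by move=> y; apply: (@cvg_comp _ _ _ (u ^~ t) G1); [exact: cu|exact: (sol_cG1 S)].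
by apply: cvgM; [apply: cvgM|]; exact: continuousX_fun.
Qed.

Lemma continuous_energy_density0 : continuous energy_density0.
Proof.
move=> x.
have cG : continuous (fun y => G1 (u0 y)).
  by move=> y; apply: (@cvg_comp _ _ _ u0 G1); [exact: (sol_cu0 S)|exact: (sol_cG1 S)].
apply: cvgM; [apply: cvgM|]; apply: continuousX_fun.
- exact: (sol_cu0 S).
- exact: cG.
- exact: (sol_cu01 S).
Qed.

Lemma energy_density0_ge0 x : 0 <= energy_density0 x.
Proof.
apply: mulr_ge0 (sqr_ge0 _); apply: mulr_ge0; last exact: exprn_even_ge0.
by apply: exprn_ge0; exact: (sol_u0_ge0 S).
Qed.

Lemma energy_density_ge0 x t : x \in I -> t \in `[0, T] -> 0 <= energy_density x t.
Proof.
move=> xI tJ; apply: mulr_ge0 (sqr_ge0 _).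
apply: mulr_ge0; last exact: exprn_even_ge0.
by apply: exprn_ge0; exact: (u_ge0 S).
Qed.

(* Pull back along x |-> foot t x, whose derivative is at most 1/alpha. Where the
   foot leaves I the solution is locally constant; the foot hits an endpoint of I
   at most twice. *)
Lemma energy_segment t a b : t \in `[0, T] -> a <= b -> a \in I -> b \in I ->
  (\int[mu]_(x in `[a, b]) (energy_density x t)%:E <=
   alpha^-1%:E * \int[mu]_(x in [set` I]) (energy_density0 x)%:E)%E.
Proof.
move=> tJ ab aI bI.
have [c [cc cI cid cout]] := exists_retraction (sol_I S).
(* Clamping keeps the foot in [I], so the increment of a primitive of [energy_density0] along [P0]
   only sees mass inside [I]. *)
pose P0 x := c (foot t x).
have cP0 : continuous P0.
  by move=> x; apply: (@cvg_comp _ _ _ (foot t) c);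
    [exact: foot_continuous|exact: cc].
have [K K0 hK] := @continuous_bounded_segment R P0 a b (continuous_subspaceT cP0).
(* The margin 1 makes the interval nondegenerate even if [K = 0]; it contains all values of [P0] on
   [[a, b]]. *)
have KK : - K - 1 < K + 1 by lra.
have [H dH] := exists_antiderivative KK continuous_energy_density0.
have P0K x : x \in `[a, b] -> - K <= P0 x <= K by move=> /hK; rewrite ler_norml.
have sI x : x \in `[a, b] -> x \in I by rewrite in_itv; exact: itv_convex.
have abI x : a < x < b -> x \in I.
  by move=> /andP[ax xb]; apply: sI; rewrite in_itv /= !ltW.
have [l hl] : exists l : seq R, forall x, a < x < b -> x \notin l ->
    nbhs (foot t x) [set` I] \/
    exists a' b', I = `[a', b'] /\ (foot t x < a' \/ b' < foot t x).
  have [->|[a' [b' [ab' IE]]]] := sol_I S.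
    by exists [::] => x _ _; left; rewrite set_itvE; exact: filterT.
  (* If the foot of [x] is the endpoint [y], then [u x t = u0 y], so [x] must be
     [y + t * f1 (u0 y)]: one candidate for each endpoint. *)
  exists [:: a' + t * f1 (u0 a'); b' + t * f1 (u0 b')] => x xab.
  have xI := abI x xab.
  have hit y : y \in I -> foot t x = y -> x = y + t * f1 (u0 y).
    move=> yI e; have := u_foot S xI tJ; rewrite -/(foot t x) e => /(_ yI) <-.
    by rewrite -e /foot; ring.
  rewrite !inE negb_or => /andP[/eqP xa /eqP xb].
  have a'I : a' \in I by rewrite IE in_itv /= lexx ltW.
  have b'I : b' \in I by rewrite IE in_itv /= lexx ltW.
  have [ya|ya|/esym/(hit _ a'I)//] := ltgtP a' (foot t x); last first.
    by right; exists a', b'; split => //; left.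
  have [yb|yb|/(hit _ b'I)//] := ltgtP (foot t x) b'; last first.
    by right; exists a', b'; split => //; right.
  by left; apply: (itv_nbhs a'I b'I); rewrite ya.
pose F' x := if foot t x \in I then alpha^-1 *
    (energy_density0 (foot t x) * (1 - t * (f2 (u x t) * ux x t))) else 0.
have dF x : a < x < b -> x \notin l ->
    der_at `[a, b] (fun x => alpha^-1 * H (P0 x)) x (F' x) /\
    energy_density x t <= F' x.
  move=> xab xl; have xI := abI x xab.
  have xab' : x \in `[a, b] by case/andP: xab => ? ?; rewrite in_itv /= !ltW.
  case: (hl x xab xl) => [yI|[a' [b' [IE yab]]]].
    have yI' : foot t x \in I by exact: nbhs_singleton yI.
    rewrite /F' yI'; split; last exact: energy_density_le.
    set p := _ * (1 - _).
    have -> : alpha^-1 * p = 0 * H (P0 x) + alpha^-1 * p by ring.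
    apply: der_atM; first exact: der_at_cst.
    apply: (@der_at_near _ _ (H \o foot t)) => //.
      have nI : \forall y \near x, [set` I] (foot t y) := foot_continuous yI.
      rewrite near_withinE; apply: filterS nI => y yI'' _.
      by rewrite /= /P0 cid.
    apply: (@der_at_comp _ _ setT) => //.
      by apply: (@der_at_sub _ _ [set` I]); [exact: sI|exact: foot_der].
    apply: dH; rewrite in_itv /= -(cid _ yI').
    by have := P0K x xab'; rewrite /P0; lra.
  have nyI : foot t x \in I = false.
    by rewrite IE in_itv /=; case: yab => h; apply/negbTE; rewrite negb_and -!ltNge h ?orbT.
  rewrite /F' nyI; split; last first.
    by rewrite /energy_density (ux_outer IE xI tJ yab) expr0n /= mulr0.
  have [z hz] : exists z, \forall y \near x, c (foot t y) = z.
    case: yab => yab.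
      exists a'; have n : \forall y \near x, foot t y < a'.
        by exact: (cvgr_lt (foot t x) (@foot_continuous t x)).
      by apply: filterS n => y /(cout _ _ IE _).1.
    exists b'; have n : \forall y \near x, b' < foot t y.
      by exact: (cvgr_gt (foot t x) (@foot_continuous t x)).
    by apply: filterS n => y /(cout _ _ IE _).2.
  apply: (@der_at_near _ _ (cst (alpha^-1 * H z))) => //; last exact: der_at_cst.
  by rewrite near_withinE; apply: filterS hz => y hy _; rewrite /P0 hy.
have cH : {within `[a, b], continuous (fun x => alpha^-1 * H (P0 x))}.
  apply/subspace_continuousP => x xab.
  apply: cvgM; first exact: cvg_cst.
  apply: cvg_within_filter.
  have cHx : {for P0 x, continuous H}.
    have : is_derive (P0 x) 1 H (energy_density0 (P0 x)).
      apply/der_atTP/dH; rewrite in_itv /=.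
      by have := P0K x xab; lra.
    by case=> d _; exact/differentiable_continuous/derivable1_diffP.
  by apply: (@cvg_comp _ _ _ P0 H); [exact: cP0|exact: cHx].
have le1 := integral_le_increment ab (@continuous_energy_density t) cH dF.
apply: (le_trans le1); rewrite -mulrBr EFinM lee_pmul2l//; last first.
  by rewrite lte_fin invr_gt0 (sol_alpha S).
have aab : a \in `[a, b] by rewrite in_itv /= lexx.
have bab : b \in `[a, b] by rewrite in_itv /= lexx ab.
have /andP[a1 a2] := P0K _ aab.
have /andP[b1 b2] := P0K _ bab.
have dH' p q : - K <= p -> q <= K -> forall x, x \in `[p, q] ->
    der_at `[p, q] H x (energy_density0 x).
  move=> pK qK x; rewrite in_itv /= => /andP[px xq].
  apply: (@der_at_sub _ _ setT) => //; apply: dH.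
  by rewrite in_itv /=; apply/andP; split; lra.
have e0 x : (0 <= (energy_density0 x)%:E)%E by rewrite lee_fin energy_density0_ge0.
(* In the order [P0 b < P0 a] the increment of the nondecreasing [H] is at most zero, so both orders
   of the clamped feet are covered. *)
have [pq|qp] := leP (P0 a) (P0 b).
  rewrite -(FTC2_der_at pq continuous_energy_density0 (dH' _ _ a1 b2)).
  apply: ge0_subset_integral => //=.
  - apply/measurable_EFinP; apply: continuous_measurable.
    exact: continuous_energy_density0.
  - by move=> x; rewrite /= in_itv /=; apply: itv_convex; exact: cI.
apply: (@le_trans _ _ 0%E); last by apply: integral_ge0.
rewrite lee_fin subr_le0.
apply: (@der_at_nondecreasing _ `[P0 b, P0 a] H energy_density0).
- exact: ltW.
- by rewrite in_itv /= lexx ltW.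
- by rewrite in_itv /= lexx ltW.
- exact: dH'.
- by move=> x _; exact: energy_density0_ge0.
Qed.

End energy.

(** * Quantiles and the transform *)

Section density.
Context {R : realType} (I : interval R) (w : R -> R) (hw : is_density I w).
Local Notation mu := (@lebesgue_measure R).
Local Notation nu := (density_measure hw).

Lemma measurable_line (J : interval R) :
  measurable ([set` J] : set (measurableTypeR R)).
Proof. exact: measurable_itv. Qed.

Lemma density_measureT : nu setT = 1%E.
Proof. by have [_ _ w1] := hw; rewrite /density_measure setTI. Qed.

HB.instance Definition _ := Measure_isProbability.Build _ _ _
  (density_measure hw) density_measureT.

Let nu0 : nu set0 = 0%E. Proof. exact: measure0. Qed.

Lemma density_integrable : mu.-integrable [set` I] (EFin \o w).
Proof.
have [mw w0 w1] := hw; apply/integrableP; split; first exact/measurable_EFinP.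
rewrite [X in (X < _)%E](_ : _ = 1%E) ?ltry// -w1.
by apply: eq_integral => x; rewrite inE /= => xI; rewrite ger0_norm// w0.
Qed.

Lemma le_set_itv (x : R) : [set s | s <= x] = [set` `]-oo, x]].
Proof. by apply/seteqP; split => y /=; rewrite in_itv. Qed.

Lemma distr_funE x : (distr_fun I w x)%:E = nu `]-oo, x].
Proof.
rewrite /distr_fun /density_measure /Rintegral fineK le_set_itv.
  by rewrite setIC.
apply: integrable_fin_num.
  by apply: measurableI; exact: measurable_line.
apply: integrableS density_integrable => //.
by apply: measurableI; exact: measurable_line.
Qed.

Lemma distr_fun_nondecreasing x y : x <= y -> distr_fun I w x <= distr_fun I w y.
Proof.
move=> xy; rewrite -lee_fin !distr_funE; apply: le_measure; rewrite ?inE//.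
by apply: subset_itvl; rewrite bnd_simp.
Qed.

Lemma distr_fun_ge0 x : 0 <= distr_fun I w x.
Proof. by rewrite -lee_fin distr_funE. Qed.

Lemma distr_fun_le1 x : distr_fun I w x <= 1.
Proof. by rewrite -lee_fin distr_funE; exact: probability_le1. Qed.

Lemma distr_fun_cvgy e : 0 < e -> exists x, forall y, x <= y ->
  1 - e < distr_fun I w y.
Proof.
move=> e0; pose E (n : nat) : set (measurableTypeR R) := [set` `]-oo, n%:R]].
have cv : nu (E n) @[n --> \oo] --> nu (\bigcup_n E n).
  apply: nondecreasing_cvg_mu => //.
  - by move=> n; exact: measurable_line.
  - by apply: bigcup_measurable => n _; exact: measurable_line.
  - move=> n m nm; apply/subsetPset; apply: subset_itvl.
    by rewrite bnd_simp ler_nat.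
have E1 : \bigcup_n E n = setT.
  apply/seteqP; split => // x _; have := archi_boundP (normr_ge0 x).
  set n := Num.bound _ => xn; exists n => //; rewrite /E /= in_itv /=.
  by rewrite (le_trans (ler_norm _))// ltW.
rewrite E1 density_measureT in cv.
have /fine_cvgP[_ /= cv'] := cv.
have e1 : 1 - e < 1 by lra.
have [n _ /(_ n (leqnn n)) /= hn] := cvgr_gt 1 cv' _ e1.
exists n%:R => y ny; apply: (lt_le_trans hn).
by rewrite -distr_funE; exact: distr_fun_nondecreasing.
Qed.

Lemma distr_fun_cvgNy e : 0 < e -> exists x, forall y, y <= x ->
  distr_fun I w y < e.
Proof.
move=> e0; pose E (n : nat) : set (measurableTypeR R) := [set` `]-oo, - n%:R]].
have cv : nu (E n) @[n --> \oo] --> nu (\bigcap_n E n).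
  apply: nonincreasing_cvg_mu => //.
  - by rewrite (le_lt_trans (probability_le1 _ _)) ?ltry//; exact: measurable_line.
  - by move=> n; exact: measurable_line.
  - by apply: bigcap_measurable => // n _; exact: measurable_line.
  - move=> n m nm; apply/subsetPset; apply: subset_itvl.
    by rewrite bnd_simp lerN2 ler_nat.
have E1 : \bigcap_n E n = set0.
  apply/seteqP; split => // x /(_ (Num.bound `|x|)) /(_ Logic.I).
  rewrite /E /= in_itv /= => xn; have := archi_boundP (normr_ge0 x).
  by have := ler_norm (- x); rewrite normrN; lra.
rewrite E1 nu0 in cv.
have /fine_cvgP[_ /= cv'] := cv.
have [n _ /(_ n (leqnn n)) /= hn] := cvgr_lt 0 cv' _ e0.
exists (- n%:R) => y ny; apply: le_lt_trans hn.
by rewrite -distr_funE; exact: distr_fun_nondecreasing.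
Qed.

Lemma distr_fun_increment x y : x <= y ->
  (distr_fun I w y - distr_fun I w x)%:E = nu `]x, y].
Proof.
move=> xy; have -> : [set` `]x, y]] = [set` `]-oo, y]] `\` [set` `]-oo, x]].
  apply/seteqP; split => z /=; rewrite !in_itv /=.
    by move=> /andP[xz zy]; split => //; rewrite leNgt xz.
  by move=> [zy /negP]; rewrite -ltNge => ->.
rewrite measureD//=.
- rewrite setIidr; first by rewrite EFinB !distr_funE.
  by apply: subset_itvl; rewrite bnd_simp.
- by rewrite -distr_funE ltry.
Qed.

(** Absolute continuity of the integral: intervals shorter than some [d] carry mass below [e],
    wherever they lie. *)
Lemma distr_fun_continuous : continuous (distr_fun I w).
Proof.
have iw : mu.-integrable setT (EFin \o (w \_ [set` I])).
  rewrite -restrict_EFin; apply/integrable_restrict => //=.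
  by rewrite setTI; exact: density_integrable.
have key e : 0 < e -> exists2 d, 0 < d & forall x y, x <= y -> y - x < d ->
    distr_fun I w y - distr_fun I w x < e.
  move=> e0.
  have [d [d0 hd]] := integral_normr_continuous iw e0.
  exists d => // x y xy yxd.
  have mxy : measurable ([set` `]x, y]] : set (measurableTypeR R)).
    exact: measurable_line.
  have /hd : (mu `]x, y] < d%:E)%E.
    by rewrite lebesgue_measure_itv /= lte_fin; case: ifP.
  move=> /(_ mxy); apply: le_lt_trans; rewrite -lee_fin.
  rewrite distr_fun_increment// /density_measure.
  rewrite /Rintegral fineK; last first.
    apply: integrable_fin_num => //.
    by apply: (integrableS measurableT) => //; exact: integrable_norm iw.
  rewrite integral_mkcondr; apply: ge0_le_integral => //=.
  - move=> z _; rewrite patchE; case: ifPn => // /set_mem zI.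
    by have [_ w0 _] := hw; rewrite lee_fin w0.
  - apply/(measurable_restrict _ (measurable_line I) mxy).
    rewrite setIC; apply: measurable_funS (measurable_int _ density_integrable) => //.
  - by apply: measurable_funTS; have /integrable_norm /measurable_int := iw.
  - by move=> z _; rewrite patchE /= patchE; case: ifPn => // _; rewrite lee_fin ler_norm.
move=> x; apply/cvgrPdist_lt => e e0; have [d d0 hd] := key e e0.
apply: filterS (nbhsx_ballx x _ d0) => y; rewrite /ball /= ltr_norml => /andP[h1 h2].
rewrite ltr_norml.
have [xy|yx] := leP x y.
  have := hd x y xy; have := distr_fun_nondecreasing xy; lra.
have := hd y x (ltW yx); have := distr_fun_nondecreasing (ltW yx); lra.
Qed.

(** The probability integral transform: under its own law a continuous distribution function is
    uniform. The sublevel set is a ray ending at its supremum [z], where continuity forces the value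
    [c]; it is everything when [c = 1], and it can be empty only when [c = 0]. *)
Lemma distr_fun_law c : 0 <= c <= 1 ->
  nu [set x | distr_fun I w x <= c] = c%:E.
Proof.
move=> /andP[c0]; rewrite le_eqVlt => /predU1P[->|c1].
  rewrite [X in nu X](_ : _ = setT) ?density_measureT//.
  by apply/seteqP; split => // x _ /=; exact: distr_fun_le1.
set A := [set x | _].
have [y hy] : exists y, c < distr_fun I w y.
  have c1' : 0 < 1 - c by rewrite subr_gt0.
  have [y /(_ y (lexx y)) hy] := distr_fun_cvgy c1'.
  by exists y; move: hy; lra.
have Aub : ubound A y.
  move=> x /= xA; rewrite leNgt; apply/negP => yx.
  by have := distr_fun_nondecreasing (ltW yx); rewrite /A /= in xA; lra.
have [[x0 x0A]|nA] := pselect (A !=set0); last first.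
  have A0 : A = set0 by apply/seteqP; split => // x xA; case: nA; exists x.
  rewrite A0 nu0; congr (_%:E); apply/eqP; rewrite eq_le c0 /= leNgt.
  apply/negP => cp; have [x /(_ x (lexx x)) hx] := distr_fun_cvgNy cp.
  have : A x by exact: ltW.
  by rewrite A0.
pose z := sup A.
have hsA : has_sup A by split; [exists x0|exists y].
have cF := @distr_fun_continuous z.
have Fz1 : distr_fun I w z <= c.
  rewrite leNgt; apply/negP => cz.
  have := cvgr_gt (distr_fun I w z) cF _ cz.
  move=> [d /= d0 hd].
  have [a Aa az] := sup_adherent d0 hsA.
  have aleq : a <= z by apply: ub_le_sup => //; exact: hsA.2.
  have : c < distr_fun I w a.
    by apply: hd => /=; rewrite ger0_norm ?subr_ge0//; rewrite /z; lra.
  by rewrite ltNge Aa.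
have Fz2 : c <= distr_fun I w z.
  rewrite leNgt; apply/negP => cz.
  have := cvgr_lt (distr_fun I w z) cF _ cz.
  move=> [d /= d0 hd].
  have : A (z + d / 2).
    rewrite /A /=; apply/ltW/hd => /=.
    by rewrite opprD addrA subrr sub0r normrN gtr0_norm; lra.
  move=> /(ub_le_sup hsA.2); rewrite -/z; lra.
have AE : A = [set` `]-oo, z]].
  apply/seteqP; split => x /=; rewrite in_itv /=.
    by move=> xA; apply: ub_le_sup => //; exact: hsA.2.
  by move=> /distr_fun_nondecreasing h; exact: le_trans Fz1.
by rewrite AE -distr_funE; congr (_%:E); apply/eqP; rewrite eq_le Fz1.
Qed.

End density.

(** Rays determine the half-open intervals by subtraction; these are stable under intersection,
    generate the Borel sets, and cover the line by []-n, n]]. *)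
Lemma measure_rays_unique {R : realType}
    (P Q : probability (measurableTypeR R) R) :
  (forall x : R, P [set` `]-oo, x]] = Q [set` `]-oo, x]]) ->
  forall A, measurable A -> P A = Q A.
Proof.
move=> PQ; pose g (n : nat) : set (measurableTypeR R) := [set` `](- n%:R), n%:R]].
have oc (m : probability (measurableTypeR R) R) (x y : R) : x < y ->
    m [set` `]x, y]] = (m [set` `]-oo, y]] - m [set` `]-oo, x]])%E.
  move=> xy; have -> : [set` `]x, y]] = [set` `]-oo, y]] `\` [set` `]-oo, x]].
    apply/seteqP; split => z /=; rewrite !in_itv /=.
      by move=> /andP[xz zy]; split => //; rewrite leNgt xz.
    by move=> [zy /negP]; rewrite -ltNge => ->.
  rewrite measureD//=; first rewrite setIidr//.
    by apply: subset_itvl; rewrite bnd_simp ltW.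
  by rewrite (le_lt_trans (probability_le1 _ _)) ?ltry.
move=> B mB; apply: (measure_unique (@ocitv R : set (set (measurableTypeR R))) g) => //.
- exact: ocitvI.
- by move=> n; exists (- n%:R, n%:R).
- apply/seteqP; split => // x _; have := archi_boundP (normr_ge0 x).
  set n := Num.bound _ => xn; exists n => //; rewrite /g /= in_itv /=.
  have := ler_norm (- x); have := ler_norm x; rewrite normrN.
  by move=> h1 h2; apply/andP; split; lra.
- move=> A /ocitvP[->|[[x y] /= xy ->]]; first by rewrite !measure0.
  by rewrite !oc// !PQ.
- by move=> n; rewrite (le_lt_trans (probability_le1 _ _)) ?ltry//; exact: measurable_line.
Qed.

Section density_integral.
Context {R : realType} (I : interval R) (w : R -> R) (hw : is_density I w).
Local Notation mu := (@lebesgue_measure R).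
Local Notation nu := (density_measure hw).

(** The Radon-Nikodym derivative of [nu] has the same integral over every measurable set as [w] cut
    off outside [I], hence equals it almost everywhere; the change of variables for the former then
    gives the formula. *)
Lemma integral_density (k : R -> \bar R) :
  (forall x, 0 <= k x)%E -> measurable_fun setT k ->
  (\int[nu]_x k x = \int[mu]_(x in [set` I]) (k x * (w x)%:E))%E.
Proof.
move=> k0 mk; have [mw w0 _] := hw.
have mwI : measurable_fun (setT : set (measurableTypeR R)) ((EFin \o w) \_ [set` I]).
  apply/(measurable_restrictT _ (measurable_line I)); exact/measurable_EFinP.
have numu : nu `<< mu.
  apply/null_content_dominatesP => A mA A0.
  rewrite /density_measure; apply: null_set_integral => //.
  - by apply: measurableI => //; exact: measurable_line.
  - apply: measurable_funS (_ : measurable_fun [set` I] _) => //.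
    exact/measurable_EFinP.
  - by apply: subset_measure0 A0 => //; apply: measurableI => //; exact: measurable_line.
rewrite -(Radon_Nikodym_SigmaFinite.change_of_variables numu k0 measurableT)//.
rewrite [RHS]integral_mkcond; apply: ae_eq_integral => //.
- apply: emeasurable_funM => //.
  exact: measurable_int (Radon_Nikodym_SigmaFinite.f_integrable numu).
- rewrite [X in measurable_fun _ X](_ : _ = (fun x => k x * ((EFin \o w) \_ [set` I]) x)%E).
    exact: emeasurable_funM.
  by apply/funext => x; rewrite !patchE; case: ifPn => //; rewrite mule0.
have : ae_eq mu setT (Radon_Nikodym_SigmaFinite.f nu mu) ((EFin \o w) \_ [set` I]).
  apply: integral_ae_eq => //.
    exact: Radon_Nikodym_SigmaFinite.f_integrable.
  move=> E _ mE; rewrite -Radon_Nikodym_SigmaFinite.f_integral//.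
  by rewrite -(integral_mkcondr mu E [set` I] (EFin \o w)).
apply: filterS => x /= /(_ Logic.I) E _.
by rewrite E !patchE; case: ifPn => //; rewrite mule0.
Qed.

End density_integral.

(** * The quantile function, and the transform as a map carrying [r] to [w] *)

Section transform.
Context {R : realType} (I : interval R) (r w : R -> R)
  (hI : line_or_segment I) (hr : is_density I r) (hw : is_density I w).
Local Notation nu := (density_measure hr).
Local Notation Fr := (distr_fun I r).
Local Notation F := (distr_fun I w).

Lemma distr_fun_left a b x : I = `[a, b] -> x <= a -> F x = 0.
Proof.
move=> IE xa; apply/eqP; rewrite eq_le (distr_fun_ge0 hw) andbT.
rewrite (le_trans (distr_fun_nondecreasing hw xa))//.
rewrite /distr_fun le_set_itv IE.
have [ab|ba] := leP a b; last first.
  rewrite (_ : _ `&` _ = set0) ?Rintegral_set0//.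
  apply/seteqP; split => // z /=; rewrite !in_itv /= => -[/andP[az zb] _].
  by have := le_trans az zb; rewrite leNgt ba.
rewrite (_ : _ `&` _ = [set a]) ?Rintegral_set1//.
apply/seteqP; split => z /=; rewrite !in_itv /=.
  by move=> [/andP[az _] za]; apply/eqP; rewrite eq_le za.
by move=> ->; rewrite !lexx ab.
Qed.

Lemma distr_fun_right a b x : I = `[a, b] -> b <= x -> F x = 1.
Proof.
move=> IE bx; apply: EFin_inj; rewrite (distr_funE hw) -(density_measureT hw).
rewrite /density_measure setTI; congr integral.
apply/seteqP; split => [z []//|z zI /=]; split => //.
by move: zI; rewrite /= IE !in_itv /= => /andP[_ /le_trans]; exact.
Qed.

Lemma distr_fun_below x y : y \in I -> 0 < F x -> x <= y -> x \in I.
Proof.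
have [->|[a [b [ab IE]]]] := hI; first by rewrite in_itv.
move=> yI Fx xy; move: yI; rewrite IE !in_itv /= => /andP[ay yb].
rewrite (le_trans xy)// andbT leNgt; apply/negP => /ltW xa.
by move: Fx; rewrite (distr_fun_left IE xa) ltxx.
Qed.

(** Continuity of [F] makes the infimum attained with value exactly [p]. The last clause is the
    Galois connection between quantile and distribution function, the form in which positions are
    compared later; it holds for all real [x], also outside [I]. *)
Lemma quantileP p : 0 < p < 1 ->
  let q := quantile I w p in
  [/\ q \in I, F q = p & forall x, (q <= x) = (p <= F x)].
Proof.
move=> /andP[p0 p1] q; pose A := [set x | x \in I /\ p <= F x].
have Fmono := distr_fun_nondecreasing hw.
have Fc := @distr_fun_continuous R I w hw.
have [lo hlo] := distr_fun_cvgNy hw p0.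
have lbA : lbound A lo.
  move=> x [_ px]; rewrite leNgt; apply/negP => xlo.
  by have := hlo x (ltW xlo); rewrite ltNge px.
have [x1 [x1I px1]] : A !=set0.
  have [IE|[a [b [ab IE]]]] := hI.
    have p1' : 0 < 1 - p by lra.
    have [hi /(_ hi (lexx hi)) hhi] := distr_fun_cvgy hw p1'.
    by exists hi; split; [rewrite IE in_itv|lra].
  have bI : b \in I by rewrite IE in_itv /= lexx ltW.
  by exists b; split => //; rewrite (distr_fun_right IE (lexx b)) ltW.
have hiA : has_inf A by split; [exists x1|exists lo].
have Fq1 : p <= F q.
  rewrite leNgt; apply/negP => Fqp.
  have [d /= d0 hd] := cvgr_lt (F q) (Fc q) _ Fqp.
  have [x [xI px] xq] := inf_adherent d0 hiA.
  have qx : q <= x by apply: ge_inf => //; exact: hiA.2.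
  have : F x < p.
    by apply: hd => /=; rewrite distrC ger0_norm ?subr_ge0// /q /quantile -/A; lra.
  by rewrite ltNge px.
have qI : q \in I.
  apply: (distr_fun_below x1I); first exact: lt_le_trans Fq1.
  by apply: ge_inf => //; exact: hiA.2.
have Fq2 : F q <= p.
  rewrite leNgt; apply/negP => pFq.
  have [d /= d0 hd] := cvgr_gt (F q) (Fc q) _ pFq.
  have h : p < F (q - d / 2).
    by apply: hd => /=; rewrite opprB addrCA subrr addr0 gtr0_norm; lra.
  have : A (q - d / 2).
    split; last exact: ltW.
    by apply: (distr_fun_below qI); [exact: lt_trans h|lra].
  by move=> /(ge_inf hiA.2); rewrite -/A -[inf A]/q; lra.
split => //; first by apply/eqP; rewrite eq_le Fq2.
move=> x; apply/idP/idP => [qx|px]; first exact: le_trans (Fmono _ _ qx).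
apply: contraT; rewrite -ltNge => xq.
have xI : x \in I by apply: (distr_fun_below qI); [exact: lt_le_trans px|exact: ltW].
have : q <= x by apply: ge_inf => //; exact: hiA.2.
by rewrite leNgt xq.
Qed.

Let X := CDT I r w.

(** True also at the degenerate levels 0 and 1: on the line there is nothing to show, and on a
    segment the set defining the quantile always contains [b]. *)
Lemma CDT_in x : X x \in I.
Proof.
rewrite /X /CDT.
have [IE|[a [b [ab IE]]]] := hI; first by rewrite IE in_itv.
have aI : a \in I by rewrite IE in_itv /= lexx ltW.
have bI : b \in I by rewrite IE in_itv /= lexx ltW.
have Fb := distr_fun_right IE (lexx b).
rewrite /quantile; set A := [set y | _].
have Ab : A b by split => //; rewrite Fb (distr_fun_le1 hr).
have lA : lbound A a by move=> y [+ _]; rewrite IE in_itv /= => /andP[].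
rewrite IE in_itv /=; apply/andP; split.
  by apply: lb_le_inf => //; exists b.
by apply: ge_inf => //; exists a.
Qed.

(** At the levels 0 and 1 the quantile is a single number, perhaps a default value of [inf];
    splitting them off makes the transform measurable everywhere, not only almost everywhere. *)
Lemma CDT_preimage x : [set y | X y <= x] =
  ([set y | Fr y <= 0] `&` [set _ | quantile I w 0 <= x]) `|`
  (([set y | 1 <= Fr y] `&` [set _ | quantile I w 1 <= x]) `|`
   ([set y | 0 < Fr y] `&` [set y | Fr y < 1] `&` [set y | Fr y <= F x])).
Proof.
apply/seteqP; split => y /=; rewrite /X /CDT.
  move=> yx; have [F0|F0] := leP (Fr y) 0.
    left; split => //.
    by rewrite (_ : 0 = Fr y)//; apply/eqP; rewrite eq_le (distr_fun_ge0 hr).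
  have [F1|F1] := leP 1 (Fr y).
    right; left; split => //.
    by rewrite (_ : 1 = Fr y)//; apply/eqP; rewrite eq_le (distr_fun_le1 hr) F1.
  right; right; split => //.
  have F01 : 0 < Fr y < 1 by rewrite F0.
  by have [_ _ <-] := quantileP F01.
case=> [[F0]|[[F1]|[[F0 F1]]]].
- by rewrite (_ : 0 = Fr y)//; apply/eqP; rewrite eq_le (distr_fun_ge0 hr).
- by rewrite (_ : 1 = Fr y)//; apply/eqP; rewrite eq_le (distr_fun_le1 hr) F1.
- move=> h; have F01 : 0 < Fr y < 1 by rewrite F0.
  by have [_ _ ->] := quantileP F01.
Qed.

Let mFr (D : set (measurableTypeR R)) : measurable_fun D Fr.
Proof. by apply: continuous_measurable; exact: distr_fun_continuous. Qed.

Lemma measurable_level c : measurable ([set y | Fr y <= c] : set (measurableTypeR R)).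
Proof.
rewrite -[X in measurable X]setTI.
have := mFr (measurableT) (measurable_line `]-oo, c]).
by rewrite (_ : Fr @^-1` _ = [set y | Fr y <= c])//;
   apply/seteqP; split => y /=; rewrite in_itv.
Qed.

Lemma measurable_level_lt c : measurable ([set y | c < Fr y] : set (measurableTypeR R)).
Proof.
rewrite (_ : [set y | _] = ~` [set y | Fr y <= c]).
  by apply: measurableC; exact: measurable_level.
by apply/seteqP; split => y /=; rewrite ltNge => /negP.
Qed.

Lemma measurable_level_gt c : measurable ([set y | Fr y < c] : set (measurableTypeR R)).
Proof.
rewrite -[X in measurable X]setTI.
have := mFr (measurableT) (measurable_line `]-oo, c[).
by rewrite (_ : Fr @^-1` _ = [set y | Fr y < c])//;
   apply/seteqP; split => y /=; rewrite in_itv.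
Qed.

Lemma measurable_level_ge c : measurable ([set y | c <= Fr y] : set (measurableTypeR R)).
Proof.
rewrite (_ : [set y | _] = ~` [set y | Fr y < c]).
  by apply: measurableC; exact: measurable_level_gt.
by apply/seteqP; split => y /=; rewrite leNgt => /negP.
Qed.

Let measurable_prop (P : Prop) : measurable ([set _ | P] : set (measurableTypeR R)).
Proof.
have [p|p] := pselect P.
  by rewrite (_ : [set _ | P] = setT)//; apply/seteqP; split.
by rewrite (_ : [set _ | P] = set0)//; apply/seteqP; split.
Qed.

Lemma measurable_CDT_level x : measurable ([set y | X y <= x] : set (measurableTypeR R)).
Proof.
rewrite CDT_preimage; apply: measurableU.
  by apply: measurableI; [exact: measurable_level|exact: measurable_prop].
apply: measurableU.
  by apply: measurableI; [exact: measurable_level_ge|exact: measurable_prop].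
apply: measurableI; last exact: measurable_level.
by apply: measurableI; [exact: measurable_level_lt|exact: measurable_level_gt].
Qed.

Lemma measurable_CDT : measurable_fun (setT : set (measurableTypeR R)) X.
Proof.
apply: (measurability (@RGenOInfty.G R)); first exact: RGenOInfty.measurableE.
move=> _ [_ [x ->] <-]; rewrite setTI.
rewrite (_ : X @^-1` _ = ~` [set y | X y <= x]).
  by apply: measurableC; exact: measurable_CDT_level.
by apply/seteqP; split => y /=; rewrite in_itv /= andbT ltNge => /negP.
Qed.

(** The level 0 is the uniform law at [c = 0]. The level 1 lies in the complement of the sublevel
    set of [1 - e], of mass [e], for every small [e]. *)
Lemma distr_fun_extreme_null :
  nu ([set y | Fr y <= 0] `|` [set y | 1 <= Fr y]) = 0%E.
Proof.
apply/eqP; rewrite -measure_le0.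
apply: (le_trans (measureU2 _ (measurable_level 0) (measurable_level_ge 1))).
have h0 : (0 : R) <= 0 <= (1 : R) by apply/andP; split; lra.
rewrite [X in (X + _ <= _)%E](distr_fun_law hr h0) add0e.
apply/lee_addgt0Pr => e e0; rewrite add0e.
have [e1|e1] := leP 1 e.
  apply: (@le_trans _ _ 1%E); last by rewrite lee_fin.
  exact: probability_le1 (measurable_level_ge 1).
have h : 0 <= 1 - e <= 1 by apply/andP; split; lra.
have -> : (e%:E = 1 - (1 - e)%:E)%E by rewrite -EFinB; congr (_%:E); lra.
rewrite -(distr_fun_law hr h) -(probability_setC nu (measurable_level _)).
apply: le_measure; rewrite ?inE.
- exact: measurable_level_ge.
- by apply: measurableC; exact: measurable_level.
- by move=> y /= h1 h2; have := le_lt_trans (le_trans h1 h2); lra.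
Qed.

(** Up to the null set of degenerate levels, the Galois connection turns [X y <= x] into
    [Fr y <= F x], whose mass is [F x] since [Fr] is uniform. *)
Lemma CDT_law x : nu [set y | X y <= x] = (F x)%:E.
Proof.
have h : 0 <= F x <= 1 by rewrite (distr_fun_ge0 hw) (distr_fun_le1 hw).
rewrite -(distr_fun_law hr h).
have mN := measurableU _ _ (measurable_level 0) (measurable_level_ge 1).
rewrite -[LHS](measureU0 (measurable_CDT_level x) mN distr_fun_extreme_null).
rewrite -[RHS](measureU0 (measurable_level (F x)) mN distr_fun_extreme_null).
congr (nu _); apply/seteqP; split => y /=.
  case=> h1; last by right.
  have [F0|F0] := leP (Fr y) 0; first by right; left.
  have [F1|F1] := leP 1 (Fr y); first by right; right.
  have F01 : 0 < Fr y < 1 by rewrite F0.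
  by left; have [_ _ <-] := quantileP F01.
case=> h1; last by right.
have [F0|F0] := leP (Fr y) 0; first by right; left.
have [F1|F1] := leP 1 (Fr y); first by right; right.
have F01 : 0 < Fr y < 1 by rewrite F0.
by left; have [_ _ hq] := quantileP F01; rewrite /X /CDT hq.
Qed.

Lemma CDT_measure (A : set (measurableTypeR R)) : measurable A ->
  nu (X @^-1` A) = density_measure hw A.
Proof.
move=> mA.
pose Xm : {mfun measurableTypeR R >-> measurableTypeR R} :=
  HB.pack X (isMeasurableFun.Build _ _ (measurableTypeR R) (measurableTypeR R) X
    measurable_CDT).
apply: (@measure_rays_unique _ (distribution nu Xm) (density_measure hw)) => //.
move=> x; transitivity (F x)%:E; last exact: distr_funE.
transitivity (nu [set y | X y <= x]); last exact: CDT_law.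
change (nu (X @^-1` [set` `]-oo, x]]) = nu [set y | X y <= x]).
by congr (nu _); apply/seteqP; split => y /=; rewrite in_itv.
Qed.

Lemma integral_CDT (k : R -> \bar R) :
  (forall x, 0 <= k x)%E -> measurable_fun (setT : set (measurableTypeR R)) k ->
  (\int[nu]_x k (X x) =
   \int[lebesgue_measure]_(x in [set` I]) (k x * (w x)%:E))%E.
Proof.
move=> k0 mk; rewrite -(integral_density hw k0 mk).
pose Xm : {mfun measurableTypeR R >-> measurableTypeR R} :=
  HB.pack X (isMeasurableFun.Build _ _ (measurableTypeR R) (measurableTypeR R) X
    measurable_CDT).
transitivity (\int[distribution nu Xm]_x k x)%E.
  by rewrite ge0_integral_distribution.
by apply: eq_measure_integral => A mA _; exact: CDT_measure.
Qed.

End transform.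

Section density_increments.
Context {R : realType} (I : interval R) (w : R -> R) (hw : is_density I w).
Local Notation mu := (@lebesgue_measure R).

Lemma distr_fun_incr_integral x y : x \in I -> y \in I -> x <= y ->
  (distr_fun I w y - distr_fun I w x)%:E = (\int[mu]_(z in `[x, y]) (w z)%:E)%E.
Proof.
move=> xI yI xy; rewrite distr_fun_increment// /density_measure.
have xyI : [set` `]x, y]] `<=` [set` I].
  by move=> z /=; rewrite in_itv /= => /andP[xz zy]; apply: itv_convex xI yI _; rewrite zy ltW.
rewrite (setIidl xyI) integral_itv_obnd_cbnd//.
by apply: measurable_funS (measurable_int _ (density_integrable hw)).
Qed.

Lemma distr_fun_der x : continuous w -> x \in I ->
  der_at [set` I] (distr_fun I w) x (w x).
Proof.
move=> cw xI; have xx : x - 1 < x + 1 by lra.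
have [H dH] := exists_antiderivative xx cw.
have xin : x \in `[x - 1, x + 1] by rewrite in_itv /=; apply/andP; split; lra.
have dHx := der_at_sub (@subsetT _ [set` I]) (dH x xin).
apply: (@der_at_near _ _ (fun y => H y + (distr_fun I w x - H x))) => //; last first.
  by rewrite -[w x]addr0; apply: der_atD => //; exact: der_at_cst.
rewrite near_withinE; apply: filterS (nbhsx_ballx x 1 ltr01) => y.
rewrite /ball /= ltr_norml => /andP[h1 h2] yI.
have sub p q : x - 1 <= p -> q <= x + 1 -> forall z, z \in `[p, q] ->
    der_at `[p, q] H z (w z).
  move=> p1 q1 z; rewrite in_itv /= => /andP[pz zq].
  apply: (@der_at_sub _ _ setT) => //; apply: dH.
  by rewrite in_itv /=; apply/andP; split; lra.
have [xy|/ltW yx] := leP x y.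
  have := distr_fun_incr_integral xI yI xy.
  rewrite (FTC2_der_at xy cw (sub x y _ _)); [move=> [E]|lra|lra]; lra.
have := distr_fun_incr_integral yI xI yx.
rewrite (FTC2_der_at yx cw (sub y x _ _)); [move=> [E]|lra|lra]; lra.
Qed.

End density_increments.

(** Compactness of the segment makes the modulus of continuity in time uniform in [z]. *)
Lemma tube {R : realType} (g : R -> R -> R) (a b t e : R) :
  continuous (fun p : R * R => g p.1 p.2) -> 0 < e ->
  exists2 d, 0 < d & forall s, `|s - t| < d -> forall z, z \in `[a, b] ->
    `|g z s - g z t| <= e.
Proof.
move=> cg e0.
have := (compact_near_coveringP _).1 (@segment_compact R a b) R (nbhs t)
  (fun s z => `|g z s - g z t| <= e) _.
have H : forall z, [set` `[a, b]] z ->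
    \forall z' \near z & s \near t, `|g z' s - g z' t| <= e.
  move=> z _; have e2 : 0 < e / 2 by lra.
  have /cvgrPdist_lt /(_ _ e2) := cg (z, t).
  case=> -[A B] /= [Az Bt] hAB; exists (A, B) => // -[z' s] /= [Az' Bs].
  have h1 := hAB (z', s) (conj Az' Bs).
  have h2 := hAB (z', t) (conj Az' (nbhs_singleton Bt)).
  rewrite /= in h1 h2.
  have -> : g z' s - g z' t = (g z t - g z' t) - (g z t - g z' s) by ring.
  by rewrite (le_trans (ler_normB _ _))//; lra.
move=> /(_ _ H) [d /= d0 hd]; exists d => // s sd z zab.
by apply: hd => //=; rewrite distrC.
Qed.

(** * Time derivative of the mass in a fixed interval *)

Section mass.
Context {R : realType} {I : interval R} {T M N alpha : R}
  {f f1 f2 G G1 u0 u01 : R -> R} {u ux ut : R -> R -> R}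
  (S : solution I T M N alpha f f1 f2 G G1 u0 u01 u ux ut)
  (hu0 : is_density I u0).
Local Notation mu := (@lebesgue_measure R).
Local Notation J := `[0, T].
Local Notation F0 := (distr_fun I u0).

Lemma continuous_u t : continuous (u ^~ t).
Proof.
by apply: (continuous_curve (sol_cu S)) => y; [exact: cvg_id|exact: cvg_cst].
Qed.

Lemma continuous_ut t : continuous (ut ^~ t).
Proof.
by apply: (continuous_curve (sol_cut S)) => y; [exact: cvg_id|exact: cvg_cst].
Qed.

Lemma integral_ut x y t : x \in I -> y \in I -> x <= y -> t \in J ->
  \int[mu]_(z in `[x, y]) ut z t = f (u x t) - f (u y t).
Proof.
move=> xI yI xy tJ; rewrite /Rintegral.
rewrite (@FTC2_der_at _ (ut ^~ t) (fun z => -1 * f (u z t)) x y xy)/=.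
- by ring.
- exact: continuous_ut.
move=> z zxy; have zI : z \in I by move: zxy; rewrite in_itv; exact: itv_convex.
have -> : ut z t = 0 * f (u z t) + -1 * (f1 (u z t) * ux z t).
  by have := sol_pde S zI tJ; lra.
apply: der_atM; first exact: der_at_cst.
apply: (@der_at_comp _ _ `[- M, M] (u ^~ t) f) => //.
- by move=> ? _; exact: (sol_uM S).
- apply: (@der_at_sub _ _ [set` I]); last exact: (sol_ux S).
  by move=> ? /=; rewrite in_itv; exact: itv_convex.
- by apply: (sol_f S); exact: (sol_uM S).
Qed.

(** Differentiation under the integral: by the mean value theorem in time the increment of [u z] is
    [ut z c * (s - t)], and [ut z c] is uniformly close to [ut z t] by [tube]. *)
Lemma slab_der x y t : x \in I -> y \in I -> x <= y -> t \in J ->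
  der_at `[0, T] (fun t => \int[mu]_(z in `[x, y]) u z t) t (f (u x t) - f (u y t)).
Proof.
move=> xI yI xy tJ; rewrite -(integral_ut xI yI xy tJ).
apply/der_atP => e e0.
(* The pointwise tolerance integrates to at most [e]; the [+ 1] allows [x = y]. *)
have e'0 : 0 < e / (y - x + 1) by rewrite divr_gt0//; lra.
have [d d0 hd] := @tube R ut x y t _ (sol_cut S) e'0.
rewrite near_withinE; apply: filterS (nbhsx_ballx t _ d0) => s.
rewrite /ball /= distrC => sd sJ.
have iu r : mu.-integrable `[x, y] (EFin \o (u ^~ r)).
  by apply: continuous_integrable; exact: continuous_u.
have iut : mu.-integrable `[x, y] (EFin \o (ut ^~ t)).
  by apply: continuous_integrable; exact: continuous_ut.
have mxy : measurable ([set` `[x, y]] : set (measurableTypeR R)) := measurable_line _.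
have iutM : mu.-integrable `[x, y] (EFin \o (fun z => ut z t * (s - t))).
  apply: continuous_integrable => z; apply: cvgM; first exact: (@continuous_ut t z).
  exact: cvg_cst.
have iuu : mu.-integrable `[x, y] (EFin \o (fun z => u z s - u z t)).
  apply: continuous_integrable => z.
  by apply: cvgB; [exact: (@continuous_u s z)|exact: (@continuous_u t z)].
have ck : continuous (fun z => u z s - u z t - ut z t * (s - t)).
  move=> z; apply: cvgB.
    by apply: cvgB; [exact: (@continuous_u s z)|exact: (@continuous_u t z)].
  by apply: cvgM; [exact: (@continuous_ut t z)|exact: cvg_cst].
have ik := @continuous_integrable R _ x y ck.
rewrite -RintegralB// -RintegralZr// -RintegralB//.
apply: (le_trans (le_normr_Rintegral mxy ik)).
have cc : continuous (cst (e / (y - x + 1) * `|s - t|) : R -> R).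
  exact: cst_continuous.
apply: (@le_trans _ _ (\int[mu]_(z in `[x, y]) (e / (y - x + 1) * `|s - t|))).
  apply: le_Rintegral => //.
  - by apply: continuous_integrable => z; apply: cvg_norm; exact: ck.
  - exact: continuous_integrable.
  move=> z zxy; have zI : z \in I by move: zxy; rewrite /= in_itv; exact: itv_convex.
  have [c [cJ cst] ->] := MVT_itv_le tJ sJ (fun r rJ => sol_ut S zI rJ).
  rewrite -mulrBl normrM ler_wpM2r//; apply: hd => //.
  exact: le_lt_trans sd.
rewrite Rintegral_cst// [X in fine X](lebesgue_measure_itv `[x, y]) /= lte_fin.
have h : e / (y - x + 1) * (y - x) <= e.
  rewrite mulrAC ler_pdivrMr; last lra.
  by rewrite ler_wpM2l ?(ltW e0)//; lra.
case: ifP => [xy'|_] /=; last by rewrite mulr0 mulr_ge0// ltW.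
by rewrite mulrAC ler_wpM2r.
Qed.

End mass.

(** * Conservation of mass *)

Section conservation_of_mass.
Context {R : realType} {I : interval R} {T M N alpha : R}
  {f f1 f2 G G1 u0 u01 : R -> R} {u ux ut : R -> R -> R}
  (S : solution I T M N alpha f f1 f2 G G1 u0 u01 u ux ut)
  (hu0 : is_density I u0).
Local Notation mu := (@lebesgue_measure R).
Local Notation F0 := (distr_fun I u0).

Lemma G_bound : exists2 K, 0 <= K & forall v, v \in `[- M, M] -> `|G v| <= K.
Proof. exact: continuous_bounded_segment (continuous_subspaceT (sol_cG S)). Qed.

Lemma f1_bound : exists2 K, 0 <= K & forall v, v \in `[- M, M] -> `|f1 v| <= K.
Proof. exact: continuous_bounded_segment (continuous_subspaceT (sol_cf1 S)). Qed.

(** [A x t] is the mass that has crossed [x] up to time [t]: an antiderivative in time of the flux,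
    normalised at 0. *)
Lemma exists_total_flux : exists A : R -> R -> R, (forall x, A x 0 = 0) /\
  forall x t, t \in `[0, T] -> der_at `[0, T] (A x) t (f (u x t)).
Proof.
have [A hA] : {A : R -> R -> R & forall x t, t \in `[0, T] ->
    der_at setT (A x) t (f (u x t))}.
  apply: (@choice _ _ (fun x A => forall t, t \in `[0, T] ->
    der_at setT A t (f (u x t)))) => x.
  apply: (exists_antiderivative (sol_T S)) => t.
  apply: (@cvg_comp _ _ _ (u x) f); last exact: (sol_cf S).
  have cu : continuous (u x).
    apply: (@continuous_curve _ u (cst x) id (sol_cu S)) => y; first exact: cvg_cst.
    exact: cvg_id.
  exact: cu.
exists (fun x t => A x t + - A x 0); split=> [x|x t tJ]; first by rewrite subrr.
rewrite -[f (u x t)]addr0; apply: der_atD; last exact: der_at_cst.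
by apply: (@der_at_sub _ _ setT) => //; exact: hA.
Qed.

Context (A : R -> R -> R) (A0 : forall x, A x 0 = 0)
  (dA : forall x t, t \in `[0, T] -> der_at `[0, T] (A x) t (f (u x t))).

(** The initial mass to the left of [x] minus what has flowed out through [x]: the expected
    distribution function of [u(.,t)], available before [u(.,t)] is known to be a density. *)
Definition mass x t := F0 x - A x t.

(** The mass in [[x, y]] plus the net outflow [A y - A x] has zero time derivative, and at time 0 it
    is the increment of [F0]. *)
Lemma mass_increment x y t : x \in I -> y \in I -> x <= y -> t \in `[0, T] ->
  (\int[mu]_(z in `[x, y]) (u z t)%:E = (mass y t - mass x t)%:E)%E.
Proof.
move=> xI yI xy tJ.
have iu r : mu.-integrable `[x, y] (EFin \o (u ^~ r)).
  by apply: continuous_integrable; exact: (continuous_u S).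
have E r : (\int[mu]_(z in `[x, y]) (u z r)%:E =
    (\int[mu]_(z in `[x, y]) u z r)%:E)%E.
  by rewrite /Rintegral fineK//; apply: integrable_fin_num => //; exact: iu.
have c : 0 \in `[0, T] := in0T S.
have := @der_at_eq0 R `[0, T] (fun t => \int[mu]_(z in `[x, y]) u z t +
  (A y t + -1 * A x t)) 0 t c tJ.
have d s : s \in `[0, T] -> der_at `[0, T] (fun t => \int[mu]_(z in `[x, y]) u z t +
    (A y t + -1 * A x t)) s 0.
  move=> sJ.
  rewrite [X in der_at _ _ _ X](_ : _ =
    f (u x s) - f (u y s) + (f (u y s) + (0 * A x s + -1 * f (u x s)))); last ring.
  apply: der_atD; first exact: (slab_der S).
  apply: der_atD; first exact: dA.
  by apply: der_atM; [exact: der_at_cst|exact: dA].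
move=> /(_ d); rewrite !A0 mulr0 !addr0 => h.
have := distr_fun_incr_integral hu0 xI yI xy.
have -> : (\int[mu]_(z in `[x, y]) (u0 z)%:E = \int[mu]_(z in `[x, y]) (u z 0)%:E)%E.
  apply: eq_integral => z; rewrite inE /= in_itv /= => zxy.
  by rewrite (sol_init S)//; exact: itv_convex zxy.
rewrite !E h /mass => -[E1]; congr (_%:E); move: E1; lra.
Qed.

Lemma mass_nondecreasing x y t : x \in I -> y \in I -> x <= y ->
  t \in `[0, T] -> mass x t <= mass y t.
Proof.
move=> xI yI xy tJ; rewrite -subr_ge0 -lee_fin -mass_increment//.
apply: integral_ge0 => z /=; rewrite in_itv /= => zxy; rewrite lee_fin.
by apply: (u_ge0 S) => //; exact: itv_convex zxy.
Qed.

Lemma mass_endpoints a b t : I = `[a, b] -> t \in `[0, T] ->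
  mass a t = 0 /\ mass b t = 1.
Proof.
move=> IE tJ.
have [a' [b' [ab IE']]] : exists a' b', a' < b' /\ I = `[a', b'].
  by case: (sol_I S) => // IE'; rewrite IE' in IE.
move: (IE'); rewrite IE => -[ea eb]; subst a' b'.
have A_bd x : boundary_pt I x -> A x t = 0.
  move=> bx; rewrite -(A0 x); apply/esym.
  apply: (@der_at_eq0 R `[0, T] (A x) 0 t (in0T S) tJ) => s sJ.
  have := @dA x s sJ; rewrite (sol_fG S) ?(sol_uM S)//.
  by rewrite (sol_bd S)// mulr0.
rewrite /mass (distr_fun_left hu0 IE (lexx a)) (distr_fun_right hu0 IE (lexx b)).
rewrite !A_bd ?subr0//.
  by exists a, b; split => //; right.
by exists a, b; split => //; left.
Qed.

(** An integrable Lipschitz function vanishes at infinity. Far out, an interval of length [d] has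
    mass below [e * d / 2], so [u0] is below [e / 2] somewhere in it; as [d * N <= e / 2], it is at
    most [e] at its left end. *)
Lemma u0_decay e : 0 < e -> I = `]-oo, +oo[ ->
  exists2 X, 0 <= X & forall x, X <= `|x| -> u0 x <= e.
Proof.
move=> e0 IE; have inI x : x \in I by rewrite IE in_itv.
have N0 : 0 <= N by apply: le_trans (sol_u01 S 0).
pose d := e / (2 * (N + 1)).
have d0 : 0 < d by rewrite divr_gt0// mulr_gt0//; lra.
have dN : d * N <= e / 2.
  have h : d * (N + 1) = e / 2 by rewrite /d invfM; field; lra.
  by nra.
have ed : 0 < e * d / 2 by rewrite divr_gt0// mulr_gt0.
have [hi hhi] := distr_fun_cvgy hu0 ed.
have [lo hlo] := distr_fun_cvgNy hu0 ed.
have key x : F0 (x + d) - F0 x < e * d / 2 -> u0 x <= e.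
  move=> h; have xd : x < x + d by lra.
  have [c /andP[xc cd] E] := MVT_itv xd (inI x) (inI (x + d))
    (fun z zI => distr_fun_der hu0 (sol_cu0 S) zI).
  have [c' _ E'] := MVT_itv xc (inI x) (inI c) (sol_u0 S).
  have := sol_u01 S c'; rewrite ler_norml => /andP[b1 b2].
  rewrite E in h; have h' : u0 c < e / 2.
    by rewrite -(ltr_pM2r d0); move: h; lra.
  have : - (u0 c - u0 x) <= d * N.
    rewrite E' -mulNr (@le_trans _ _ (N * (c - x)))//.
      by apply: ler_wpM2r; lra.
    by rewrite mulrC; apply: ler_wpM2r => //; lra.
  by lra.
exists (`|hi| + `|lo| + d); first by rewrite !addr_ge0// ltW.
move=> x; have n1 := ler_norm hi; have n2 := ler_norm (- lo).
have n3 := normr_ge0 hi; have n4 := normr_ge0 lo.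
rewrite normrN in n2.
have [x0|x0] := leP 0 x.
  rewrite (ger0_norm x0) => hx; apply: key.
  have h1 := hhi x; have h2 := distr_fun_le1 hu0 (x + d).
  by have := h1 ltac:(lra); lra.
rewrite (ltr0_norm x0) => hx; apply: key.
have h1 := hlo (x + d); have h2 := distr_fun_ge0 hu0 x.
by have := h1 ltac:(lra); lra.
Qed.

(** Values of [u] are values of [u0] at feet displaced by at most [T * L], hence small far out,
    uniformly in time. The flux is at most [K] times [u], and it acts for a time at most [T]. *)
Lemma total_flux_decay e : 0 < e -> I = `]-oo, +oo[ ->
  exists2 X, 0 <= X & forall x t, X <= `|x| -> t \in `[0, T] -> `|A x t| <= e.
Proof.
move=> e0 IE; have inI x : x \in I by rewrite IE in_itv.
have [K K0 hK] := G_bound; have [L L0 hL] := f1_bound.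
have T0 := sol_T S.
pose e' := e / (T * (K + 1)).
have e'0 : 0 < e' by rewrite divr_gt0// mulr_gt0//; lra.
have [X X0 hX] := u0_decay e'0 IE.
exists (X + T * L); first by apply: addr_ge0 => //; apply: mulr_ge0 => //; exact: ltW.
move=> x t xX tJ.
have ub s : s \in `[0, T] -> u x s <= e'.
  move=> sJ; rewrite (u_foot S)//; apply: hX.
  have s0T : 0 <= s <= T by move: sJ; rewrite in_itv.
  have := hL _ (sol_uM S x s).
  set v := f1 _ => vL.
  have : `|s * v| <= T * L.
    rewrite normrM; apply: ler_pM => //; rewrite ger0_norm; lra.
  have := lerB_dist x (s * v); lra.
have [c [cJ _] E] := MVT_itv_le (in0T S) tJ (fun s sJ => @dA x s sJ).
rewrite A0 !subr0 in E; rewrite E normrM (sol_fG S) ?(sol_uM S)// normrM.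
have t0T : 0 <= t <= T by move: tJ; rewrite in_itv.
have -> : e = e' * K * T + e' * T by rewrite /e'; field; lra.
apply: (@le_trans _ _ (e' * K * T)); last first.
  by rewrite lerDl; apply: mulr_ge0; exact: ltW.
apply: ler_pM => //.
  apply: ler_pM => //; last exact: hK (sol_uM S x c).
  by rewrite ger0_norm ?ub// (u_ge0 S).
by rewrite ger0_norm; lra.
Qed.

Lemma mass_limits e : 0 < e -> I = `]-oo, +oo[ ->
  exists2 X, 0 <= X & forall x t, t \in `[0, T] ->
    (x <= - X -> `|mass x t| <= e) /\ (X <= x -> `|mass x t - 1| <= e).
Proof.
move=> e0 IE; have e2 : 0 < e / 2 by lra.
have [X X0 hX] := total_flux_decay e2 IE.
have [hi hhi] := distr_fun_cvgy hu0 e2.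
have [lo hlo] := distr_fun_cvgNy hu0 e2.
have n1 := ler_norm hi; have n2 := ler_norm (- lo).
have n3 := normr_ge0 hi; have n4 := normr_ge0 lo.
rewrite normrN in n2.
exists (X + `|hi| + `|lo|); first by rewrite !addr_ge0.
move=> x t tJ; split=> hx.
  have : `|A x t| <= e / 2 by apply: hX => //; rewrite ler0_norm; lra.
  rewrite /mass !ler_norml; have := distr_fun_ge0 hu0 x.
  by have := hlo x ltac:(lra); lra.
have : `|A x t| <= e / 2 by apply: hX => //; rewrite ger0_norm; lra.
rewrite /mass !ler_norml; have := distr_fun_le1 hu0 x.
by have := hhi x ltac:(lra); lra.
Qed.

(** On a segment the total mass is the increment of [mass] between the endpoints. On the line the
    increments over bounded intervals are squeezed by the limits 0 and 1 of [mass] at infinity. *)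
Lemma u_density_flux t : t \in `[0, T] -> is_density I (u ^~ t).
Proof.
move=> tJ; split.
- by apply: continuous_measurable; exact: (continuous_u S).
- by move=> x xI; exact: (u_ge0 S).
have [IE|[a [b [ab IE]]]] := sol_I S; last first.
  have aI : a \in I by rewrite IE in_itv /= lexx ltW.
  have bI : b \in I by rewrite IE in_itv /= lexx ltW.
  have := mass_increment aI bI (ltW ab) tJ; rewrite -IE => ->.
  by have [-> ->] := mass_endpoints IE tJ; rewrite subr0.
have inI x : x \in I by rewrite IE in_itv.
have u0' z : (0 <= (u z t)%:E)%E by rewrite lee_fin (u_ge0 S).
have muT : measurable_fun (setT : set (measurableTypeR R)) (EFin \o (u ^~ t)).
  by apply/measurable_EFinP; apply: continuous_measurable; exact: (continuous_u S).
apply/eqP; rewrite eq_le; apply/andP; split.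
  apply: integral_line_le.
  - by left.
  - by apply: continuous_measurable; exact: (continuous_u S).
  - by move=> x xI; rewrite (u_ge0 S).
  move=> a b ab _ _; rewrite mass_increment//.
  apply/lee_addgt0Pr => e e0; rewrite -EFinD lee_fin.
  have e2 : 0 < e / 2 by lra.
  have [X X0 hX] := mass_limits e2 IE.
  have h1 : mass b t <= mass (Num.max b X) t.
    by apply: mass_nondecreasing => //; rewrite le_max lexx.
  have h2 : mass (Num.min a (- X)) t <= mass a t.
    by apply: mass_nondecreasing => //; rewrite ge_min lexx.
  have := (hX (Num.max b X) t tJ).2; rewrite le_max lexx orbT => /(_ isT).
  have := (hX (Num.min a (- X)) t tJ).1; rewrite ge_min lexx orbT => /(_ isT).
  by rewrite !ler_norml; lra.
apply/lee_addgt0Pr => e e0.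
have e2 : 0 < e / 2 by lra.
have [X X0 hX] := mass_limits e2 IE.
have h1 : (1%:E <= (\int[mu]_(z in [set` `[- X, X]%R]) (u z t)%:E) + e%:E)%E.
  rewrite mass_increment//; last lra.
  rewrite -EFinD lee_fin.
  have := (hX X t tJ).2 (lexx _); have := (hX (- X) t tJ).1 (lexx _).
  by rewrite !ler_norml; lra.
apply: (le_trans h1).
rewrite leeD2r//; apply: ge0_subset_integral => //=.
  by apply: measurable_funS muT.
by move=> z _; exact: inI.
Qed.

(** Both functions have the same increments and the same value or limit 0 at the left end of [I]. *)
Lemma distr_fun_mass x t : x \in I -> t \in `[0, T] ->
  distr_fun I (u ^~ t) x = mass x t.
Proof.
move=> xI tJ; have ht := u_density_flux tJ.
have incr y : y \in I -> y <= x ->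
    distr_fun I (u ^~ t) x - distr_fun I (u ^~ t) y = mass x t - mass y t.
  move=> yI yx; apply: EFin_inj.
  by rewrite (distr_fun_incr_integral ht yI xI yx) mass_increment.
have [IE|[a [b [ab IE]]]] := sol_I S; last first.
  have [ax xb] : a <= x /\ x <= b by move: (xI); rewrite IE in_itv /= => /andP.
  have aI : a \in I by rewrite IE in_itv /= lexx ltW.
  have := incr a aI ax; have [-> _] := mass_endpoints IE tJ.
  by rewrite (distr_fun_left ht IE (lexx a)) !subr0.
have inI y : y \in I by rewrite IE in_itv.
suff h e : 0 < e -> `|distr_fun I (u ^~ t) x - mass x t| <= e.
  by apply/eqP; rewrite -subr_eq0 -normr_le0; apply/ler_addgt0Pr => e /h; rewrite add0r.
move=> e0; have e2 : 0 < e / 2 by lra.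
have [X X0 hX] := mass_limits e2 IE.
have [lo hlo] := distr_fun_cvgNy ht e2.
pose y := Num.min (Num.min (- X) lo) x.
have y1 : y <= - X by rewrite /y !ge_min lexx.
have y2 : y <= lo by rewrite /y !ge_min lexx orbT.
have y3 : y <= x by rewrite /y ge_min lexx orbT.
have := incr y (inI y) y3; have := (hX y t tJ).1 y1; have := hlo y y2.
have := distr_fun_ge0 ht y; rewrite !ler_norml; lra.
Qed.

End conservation_of_mass.

Lemma u_density {R : realType} {I : interval R} {T M N alpha : R}
    {f f1 f2 G G1 u0 u01 : R -> R} {u ux ut : R -> R -> R}
    (S : solution I T M N alpha f f1 f2 G G1 u0 u01 u ux ut)
    (hu0 : is_density I u0) t :
  t \in `[0, T] -> is_density I (u ^~ t).
Proof. by have [A [A0 dA]] := exists_total_flux S; exact: (u_density_flux S hu0 A0 dA). Qed.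

(** Differentiates a level curve already known to be continuous: the mean value theorem in space
    solves [w (y s) s = w (y s0) s0] exactly for [y s - y s0], with [wx] at an intermediate point
    that tends to [y s0]. *)
Lemma der_at_implicit {R : realType} (I J : interval R) (S : set R)
    (w wx : R -> R -> R) (wt : R) (y : R -> R) (s0 : R) :
  (forall x t, x \in I -> t \in J -> der_at [set` I] (w ^~ t) x (wx x t)) ->
  der_at [set` J] (w (y s0)) s0 wt ->
  {for (y s0, s0), continuous (fun p => wx p.1 p.2)} ->
  S `<=` [set` J] -> (forall s, S s -> y s \in I) -> S s0 ->
  y @ within S (nbhs s0) --> y s0 -> wx (y s0) s0 != 0 ->
  (forall s, S s -> w (y s) s = w (y s0) s0) ->
  der_at S y s0 (- wt / wx (y s0) s0).
Proof.
move=> hx ht cx SJ Sy Ss0 cy wx0 wcst.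
have yI := Sy _ Ss0.
have s0J : s0 \in J by exact: SJ.
have [eta heta] : {eta : R -> R & forall s, S s ->
    `|eta s - y s0| <= `|y s - y s0| /\
    w (y s) s - w (y s0) s = wx (eta s) s * (y s - y s0)}.
  apply: (@choice _ _ (fun s e => S s -> `|e - y s0| <= `|y s - y s0| /\
    w (y s) s - w (y s0) s = wx e s * (y s - y s0))) => s.
  have [Ss|nSs] := pselect (S s); last by exists 0.
  have sJ : s \in J by exact: SJ.
  have [c [_ h1] h2] := @MVT_itv_le _ I (w ^~ s) (wx ^~ s) (y s0) (y s) yI
    (Sy _ Ss) (fun x xI => hx x s xI sJ).
  by exists c.
have ceta : eta @ within S (nbhs s0) --> y s0.
  apply/cvgrPdist_le => e e0.
  have : \forall s \near within S (nbhs s0), `|y s0 - y s| <= e.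
    by move/cvgrPdist_le : cy; exact.
  rewrite !near_withinE; apply: filterS => s + Ss => /(_ Ss).
  by rewrite distrC => /(le_trans (heta s Ss).1); rewrite distrC.
have cw : wx (eta s) s @[s --> within S (nbhs s0)] --> wx (y s0) s0.
  apply: (@cvg_comp _ _ _ (fun s => (eta s, s)) (fun p => wx p.1 p.2) _
    (nbhs (y s0, s0))) => //.
  apply: (@cvg_pair _ _ _ (within S (nbhs s0)) (nbhs (y s0)) (nbhs s0)) => //.
  by move=> W; exact: cvg_within.
have cw' : wx (eta s) s @[s --> within S s0^'] --> wx (y s0) s0.
  by apply: cvg_trans cw; apply: cvg_app => W; exact: nbhs_dnbhs.
have H : - ((w (y s0) s - w (y s0) s0) / (s - s0)) / wx (eta s) s
    @[s --> within S s0^'] --> - wt / wx (y s0) s0.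
  apply: cvgM; last exact: cvgV.
  by apply: cvgN; exact: (der_at_sub SJ).
rewrite /der_at; apply: cvg_trans H; apply: near_eq_cvg.
have nz : \forall s \near within S s0^', wx (eta s) s != 0.
  by apply: cvgr_neq0 cw' _.
move: nz; rewrite !near_withinE; apply: filterS => s nz ss0 Ss.
have [_ h] := heta s Ss; have wz := nz ss0 Ss.
have {}h : y s - y s0 = - (w (y s0) s - w (y s0) s0) / wx (eta s) s.
  by rewrite -(wcst s Ss) -[in RHS]opprB opprK h mulrAC divff// mul1r.
by rewrite h; ring.
Qed.

(** * Quantile trajectories *)

Section trajectories.
Context {R : realType} {I : interval R} {T M N alpha : R}
  {f f1 f2 G G1 u0 u01 : R -> R} {u ux ut : R -> R -> R}
  (S : solution I T M N alpha f f1 f2 G G1 u0 u01 u ux ut)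
  (hu0 : is_density I u0).

Definition cumul x t := distr_fun I (u ^~ t) x.

Lemma cumul_x x t : x \in I -> t \in `[0, T] ->
  der_at [set` I] (cumul ^~ t) x (u x t).
Proof.
move=> xI tJ; apply: (distr_fun_der (u_density S hu0 tJ) _ xI).
exact: (continuous_u S).
Qed.

Lemma cumul_t x t : x \in I -> t \in `[0, T] ->
  der_at `[0, T] (cumul x) t (- f (u x t)).
Proof.
move=> xI tJ; have [A [A0 dA]] := exists_total_flux S.
apply: (@der_at_ext _ _ (fun t => distr_fun I u0 x + -1 * A x t)) => //.
  by move=> s; rewrite inE => sJ; rewrite /cumul (distr_fun_mass S hu0 A0 dA)// /mass mulN1r.
rewrite [X in der_at _ _ _ X](_ : _ = 0 + (0 * A x t + -1 * f (u x t))); last ring.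
apply: der_atD; first exact: der_at_cst.
by apply: der_atM; [exact: der_at_cst|exact: dA].
Qed.

Let cumul_curve s t (y : R -> R) c r : s <= t -> 0 <= s -> t <= T ->
  (forall r, r \in `[s, t] -> y r \in I) -> r \in `[s, t] ->
  der_at `[s, t] y r c ->
  der_at `[s, t] (fun r => cumul (y r) r) r (u (y r) r * c + - f (u (y r) r)).
Proof.
move=> st s0 tT yI rst dy.
have sub : [set` `[s, t]] `<=` [set` `[0, T]].
  by move=> z /=; rewrite !in_itv /= => /andP[sz zt]; apply/andP; split; lra.
apply: (@der_at_curve _ I `[0, T]) => //.
- exact: cumul_x.
- by apply: cumul_t; [exact: yI|exact: sub].
- exact: (sol_cu S).
Qed.

(** A point moving right at speed [K] outruns the mass, whose velocity is [G]: the mass to its left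
    changes at rate [u * (K - G) >= 0]. For [s < t] the same point is followed backwards in time, at
    rate [- u * (K + G) <= 0]. *)
Lemma cumul_transport K x s t : (forall v, v \in `[- M, M] -> `|G v| <= K) ->
  x \in I -> s \in `[0, T] -> t \in `[0, T] -> x + K * `|s - t| \in I ->
  cumul x t <= cumul (x + K * `|s - t|) s.
Proof.
move=> hK xI sJ tJ yI.
have [s0 sT] : 0 <= s /\ s <= T by move: sJ; rewrite in_itv => /andP.
have [t0 tT] : 0 <= t /\ t <= T by move: tJ; rewrite in_itv => /andP.
have K0 : 0 <= K by apply: le_trans (hK _ (sol_uM S 0 0)).
have sign y r : y \in I -> r \in `[0, T] ->
    - (u y r * K) <= f (u y r) <= u y r * K.
  move=> yI' rJ; rewrite (sol_fG S) ?(sol_uM S)// -mulrN.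
  have := hK _ (sol_uM S y r); rewrite ler_norml => /andP[h1 h2].
  by rewrite !ler_wpM2l ?(u_ge0 S).
have [ts|st] := leP t s.
  rewrite ger0_norm ?subr_ge0// in yI *.
  pose y r := x + K * (r - t).
  have yI' r : r \in `[t, s] -> y r \in I.
    rewrite in_itv /= => /andP[tr rs]; apply: itv_convex xI yI _.
    by rewrite lerDl mulr_ge0 ?subr_ge0//= lerD2l ler_wpM2l// lerD2r.
  have rJ r : r \in `[t, s] -> r \in `[0, T].
    by rewrite !in_itv /= => /andP[? ?]; apply/andP; split; lra.
  have -> : cumul x t = cumul (y t) t by rewrite /y subrr mulr0 addr0.
  apply: (@der_at_nondecreasing _ `[t, s] (fun r => cumul (y r) r)
    (fun r => u (y r) r * K + - f (u (y r) r))) => //.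
  - by rewrite in_itv /= lexx.
  - by rewrite in_itv /= lexx andbT.
  - move=> r rts; apply: cumul_curve => //; rewrite /y.
    rewrite [X in der_at _ _ _ X](_ : K = 0 + (0 * (r - t) + K * (1 + 0))); last ring.
    apply: der_atD; first exact: der_at_cst.
    apply: der_atM; first exact: der_at_cst.
    by apply: der_atD; [exact: der_at_id|exact: der_at_cst].
  - by move=> r rts; have /andP[_] := sign _ _ (yI' r rts) (rJ r rts); rewrite subr_ge0.
rewrite ltr0_norm ?subr_lt0// opprB in yI *.
pose y r := x + - K * (r - t).
have -> : x + K * (t - s) = y s by rewrite /y; ring.
have yI' r : r \in `[s, t] -> y r \in I.
  rewrite in_itv /= => /andP[tr rs]; apply: itv_convex xI yI _.
  by rewrite /y lerDl lerD2l; apply/andP; split; nra.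
have rJ r : r \in `[s, t] -> r \in `[0, T].
  by rewrite !in_itv /= => /andP[? ?]; apply/andP; split; lra.
have -> : cumul x t = cumul (y t) t by rewrite /y subrr mulr0 addr0.
suff : -1 * cumul (y s) s <= -1 * cumul (y t) t by lra.
apply: (@der_at_nondecreasing _ `[s, t] (fun r => -1 * cumul (y r) r)
  (fun r => 0 * cumul (y r) r + -1 * (u (y r) r * (- K) + - f (u (y r) r)))).
- exact: ltW.
- by rewrite in_itv /= lexx ltW.
- by rewrite in_itv /= lexx andbT ltW.
- move=> r rts; apply: der_atM; first exact: der_at_cst.
  apply: cumul_curve => //; first exact: ltW.
  rewrite [X in der_at _ _ _ X](_ : - K = 0 + (0 * (r - t) + - K * (1 + 0))); last ring.
  apply: der_atD; first exact: der_at_cst.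
  apply: der_atM; first exact: der_at_cst.
  by apply: der_atD; [exact: der_at_id|exact: der_at_cst].
- by move=> r rts; have /andP[+ _] := sign _ _ (yI' r rts) (rJ r rts); lra.
Qed.

Context (p : R) (p01 : 0 < p < 1).

Definition position t := quantile I (u ^~ t) p.

Lemma positionP t : t \in `[0, T] -> [/\ position t \in I,
  cumul (position t) t = p & forall x, (position t <= x) = (p <= cumul x t)].
Proof. by move=> tJ; apply: (quantileP (sol_I S) (u_density S hu0 tJ) p01). Qed.

(** The Galois connection turns the transport inequality into a bound on positions. Positivity of
    [u] plays no part, so this supplies the continuity that implicit differentiation requires. *)
Lemma position_lipschitz K s t : (forall v, v \in `[- M, M] -> `|G v| <= K) ->
  s \in `[0, T] -> t \in `[0, T] -> `|position s - position t| <= K * `|s - t|.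
Proof.
move=> hK.
have half s' t' : s' \in `[0, T] -> t' \in `[0, T] ->
    position s' <= position t' + K * `|s' - t'|.
  move=> sJ tJ.
  have [xI Fx _] := positionP tJ; have [yI _ hy] := positionP sJ.
  have K0 : 0 <= K by apply: le_trans (hK _ (sol_uM S 0 0)).
  have [zI|zI] := boolP (position t' + K * `|s' - t'| \in I).
    by rewrite hy -Fx; exact: cumul_transport.
  (* Were the bound to fail, the shifted point would lie between two points of [I] and so belong to
     [I]. *)
  apply: contraT; rewrite -ltNge => h; case/negP : zI.
  by apply: itv_convex xI yI _; rewrite (ltW h) andbT lerDl mulr_ge0.
move=> sJ tJ; rewrite ler_distl; apply/andP; split; last exact: half.
by rewrite lerBlDr distrC; exact: half.
Qed.

Lemma f_0 : f 0 = 0.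
Proof.
by rewrite (sol_fG S) ?mul0r// in_itv /=; have := sol_M S; lra.
Qed.

(* The mass flux f(u) - u f'(u) across a characteristic vanishes where u = 0. *)
Lemma cumul_const_zero x t s0 : x \in I -> t \in `[0, T] -> 0 <= s0 <= t ->
  u x t = 0 -> x - (t - s0) * f1 (u x t) \in I ->
  cumul (x - (t - s0) * f1 (u x t)) s0 = cumul x t.
Proof.
move=> xI tJ s0t ux0 yI.
have uz := char_const S xI tJ s0t yI.
have /andP[s00 s0t'] := s0t.
have tT : t <= T by move: tJ; rewrite in_itv => /andP[].
set c := f1 (u x t) in uz yI *.
pose y r := x - (t - r) * c.
have yt : y t = x by rewrite /y subrr mul0r subr0.
rewrite -/(y s0) -[X in _ = cumul X t]yt.
apply: (@der_at_eq0 _ `[s0, t] (fun r => cumul (y r) r)).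
- by rewrite in_itv /= lexx.
- by rewrite in_itv /= lexx andbT.
move=> r rst; have rst' : s0 <= r <= t by move: rst; rewrite in_itv.
rewrite (_ : 0 = u (y r) r * c + - f (u (y r) r)); last first.
  by rewrite uz// ux0 f_0; ring.
apply: cumul_curve => //; last exact: affine_der_at.
move=> r'; rewrite in_itv /= => /andP[h1 h2].
by apply: (@char_in _ I x t s0) => //.
Qed.

Hypothesis good : 0 < u (position 0) 0.

(** From a zero, go back along the characteristic: [u] stays 0 and [cumul] stays [p]. It cannot stop
    at an endpoint, where [cumul] is 0 or 1. At time 0 it reaches some [y0] of level [p] beyond
    [position 0], yet [u > 0] just right of [position 0] makes [cumul] exceed [p] there. *)
Lemma u_position_gt0 t : t \in `[0, T] -> 0 < u (position t) t.
Proof.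
move=> tJ; have [xI Fx _] := positionP tJ.
rewrite lt_neqAle (u_ge0 S)// andbT eq_sym; apply/negP => /eqP ux0.
have [s0 [y0 [s0t y0I y0E h]]] := char_foot S xI tJ.
have := cumul_const_zero xI tJ s0t ux0; rewrite -y0E => /(_ y0I).
rewrite Fx => Fy0.
have := char_const S xI tJ s0t; rewrite /= -y0E => /(_ y0I s0).
rewrite lexx (andP s0t).2 -y0E ux0 => /(_ isT) uy0.
case: h => [s00|bd]; last first.
  have s0J : s0 \in `[0, T].
    by move: s0t tJ; rewrite !in_itv /= => /andP[-> h1] /andP[_]; exact: le_trans.
  have hs := u_density S hu0 s0J; case: bd => a [b [ab IE hab]].
  case/andP: p01 => p0 p1; move: Fy0; rewrite /cumul; case: hab => ->.
    by rewrite (distr_fun_left hs IE (lexx a)); lra.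
  by rewrite (distr_fun_right hs IE (lexx b)); lra.
rewrite s00 in Fy0 uy0.
have J0 := in0T S.
have [qI Fq hq] := positionP J0.
have : position 0 <= y0 by rewrite hq Fy0.
rewrite le_eqVlt => /predU1P[E|qy].
  by move: good; rewrite E uy0 ltxx.
have [d /= d0 hd] := cvgr_gt _ (@continuous_u _ _ _ _ _ _ _ _ _ _ _ _ _ _ _ _ S 0 (position 0)) _ good.
(* A point right of [position 0], not past [y0], and within the range where [u] is still
   positive. *)
pose z := Num.min y0 (position 0 + d / 2).
have z1 : position 0 < z by rewrite lt_min qy; lra.
have z2 : z <= y0 by rewrite ge_min lexx.
have z3 : z <= position 0 + d / 2 by rewrite ge_min lexx orbT.
have zI : z \in I by apply: itv_convex qI y0I _; rewrite z2 ltW.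
have [c /andP[qc cz] E] := MVT_itv z1 qI zI (fun x xI => cumul_x xI J0).
have uc : 0 < u c 0 by apply: hd => /=; rewrite distrC gtr0_norm ?subr_gt0//; lra.
have : cumul z 0 <= cumul y0 0.
  exact: (distr_fun_nondecreasing (u_density S hu0 J0)).
have := mulr_gt0 uc (_ : 0 < z - position 0); rewrite subr_gt0 => /(_ z1).
by rewrite -E Fq Fy0; lra.
Qed.

(** Implicit differentiation with space derivative [u] and time derivative [- f u] of [cumul]; the
    quotient [f u / u] is [G u] because [u] is positive on the trajectory. *)
Lemma position_der t : t \in `[0, T] ->
  der_at `[0, T] position t (G (u (position t) t)).
Proof.
move=> tJ; have up := u_position_gt0 tJ; have [xI Fx _] := positionP tJ.
have -> : G (u (position t) t) = - - f (u (position t) t) / u (position t) t.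
  by rewrite opprK (sol_fG S) ?(sol_uM S)// mulrAC divff ?gt_eqF// mul1r.
apply: (@der_at_implicit _ I `[0, T] _ cumul u) => //.
- exact: cumul_x.
- exact: cumul_t.
- exact: (sol_cu S).
- by move=> s sJ; have [] := positionP sJ.
- have [K K0 hK] := G_bound S.
  apply/cvgrPdist_le => e e0.
  have e'0 : 0 < e / (K + 1) by rewrite divr_gt0//; lra.
  rewrite near_withinE; apply: filterS (nbhsx_ballx t _ e'0) => s.
  rewrite /ball /= => ts sJ; apply: (le_trans (position_lipschitz hK tJ sJ)).
  apply: (@le_trans _ _ (K * (e / (K + 1)))); first by rewrite ler_wpM2l// ltW.
  rewrite mulrCA ler_piMr ?(ltW e0)// ler_pdivrMr; lra.
- by rewrite gt_eqF.
- by move=> s sJ; rewrite Fx; have [] := positionP sJ.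
Qed.

Definition accel x t := - (u x t * G1 (u x t) ^+ 2 * ux x t).

(** Along the trajectory [u] changes at rate [ux * G + ut]; by the equation and [f1 = G + u * G1]
    the terms in [G] cancel and [- u * G1 * ux] remains. *)
Lemma velocity_der t : t \in `[0, T] ->
  der_at `[0, T] (fun t => G (u (position t) t)) t (accel (position t) t).
Proof.
move=> tJ; have [xI Fx _] := positionP tJ; have uV := sol_uM S (position t) t.
have -> : accel (position t) t = G1 (u (position t) t) *
    (ux (position t) t * G (u (position t) t) + ut (position t) t).
  have := sol_pde S xI tJ; rewrite (f1E S)// /accel => E.
  have -> : ut (position t) t = - (G (u (position t) t) + u (position t) t *
      G1 (u (position t) t)) * ux (position t) t by move: E; lra.
  by ring.
apply: (@der_at_comp _ _ `[- M, M] (fun t => u (position t) t) G) => //.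
- by move=> s _; exact: (sol_uM S).
- apply: (@der_at_curve _ I `[0, T]) => //.
  + exact: (sol_ux S).
  + exact: (sol_ut S).
  + exact: (sol_cux S).
  + by move=> s sJ; have [] := positionP sJ.
  + exact: position_der.
- exact: (sol_G S).
Qed.

Lemma accel_cvg t : t \in `[0, T] ->
  accel (position s) s @[s --> within `[0, T] (nbhs t)] --> accel (position t) t.
Proof.
move=> tJ.
have cp : position @ within `[0, T] (nbhs t) --> position t.
  exact: der_at_cvg (position_der tJ).
have cc (w : R -> R -> R) : continuous (fun p : R * R => w p.1 p.2) ->
    w (position s) s @[s --> within `[0, T] (nbhs t)] --> w (position t) t.
  move=> cw; apply: (@cvg_comp _ _ _ (fun s => (position s, s))
    (fun p : R * R => w p.1 p.2) _ (nbhs (position t, t))); last exact: (cw (_, _)).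
  apply: (@cvg_pair _ _ _ (within `[0, T] (nbhs t)) (nbhs (position t)) (nbhs t)) => //.
  by move=> W; exact: cvg_within.
apply: cvgN; apply: cvgM; last exact: cc (sol_cux S).
apply: cvgM; first exact: cc (sol_cu S).
have cG : G1 (u (position s) s) @[s --> within `[0, T] (nbhs t)] -->
    G1 (u (position t) t).
  by apply: (@cvg_comp _ _ _ (fun s => u (position s) s) G1 _
    (nbhs (u (position t) t))); [exact: cc (sol_cu S)|exact: (sol_cG1 S)].
by rewrite expr2; apply: cvgM.
Qed.

End trajectories.

(** * Interpolation and the width bound *)

Section interpolation.
Context {R : realType}.
Implicit Types (k : R -> R) (J : interval R).

Lemma convex_interpolation J k k1 k2 (a b t : R) : a \in J -> b \in J ->
  a <= t -> t <= b -> a < b ->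
  (forall x, x \in J -> der_at [set` J] k x (k1 x)) ->
  (forall x, x \in J -> der_at [set` J] k1 x (k2 x)) ->
  (forall x, x \in J -> 0 <= k2 x) ->
  (b - a) * k t <= (b - t) * k a + (t - a) * k b.
Proof.
move=> aJ bJ; rewrite le_eqVlt => /predU1P[<- _ _ _ _ _|ta].
  by rewrite subrr mul0r addr0.
rewrite le_eqVlt => /predU1P[-> _ _ _ _|tb ab d1 d2 k20].
  by rewrite subrr mul0r add0r.
have tJ : t \in J by apply: itv_convex aJ bJ _; rewrite !ltW.
have [c1 /andP[h1 h2] E1] := MVT_itv ta aJ tJ d1.
have [c2 /andP[h3 h4] E2] := MVT_itv tb tJ bJ d1.
have c1J : c1 \in J by apply: itv_convex aJ tJ _; rewrite !ltW.
have c2J : c2 \in J by apply: itv_convex tJ bJ _; rewrite !ltW.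
have c12 : c1 <= c2 by lra.
have h := der_at_nondecreasing c12 c1J c2J d2 k20.
have ta0 : 0 <= (b - t) * (t - a) by rewrite mulr_ge0//; lra.
have := ler_wpM2l ta0 h.
have -> : (b - t) * (t - a) * k1 c1 = (b - t) * (k t - k a) by rewrite E1; ring.
have -> : (b - t) * (t - a) * k1 c2 = (t - a) * (k b - k t) by rewrite E2; ring.
lra.
Qed.

(** Adding [C / 2 * x ^ 2] makes [k] convex, so its graph lies below the chord; the chord of the
    added parabola exceeds it by [C / 2 * (t - a) * (b - t)], at most [C * (b - a) ^ 2 / 8]. *)
Lemma interpolation_error J k k1 k2 (a b t C : R) : a \in J -> b \in J ->
  a <= t -> t <= b -> a < b -> 0 <= C ->
  (forall x, x \in J -> der_at [set` J] k x (k1 x)) ->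
  (forall x, x \in J -> der_at [set` J] k1 x (k2 x)) ->
  (forall x, x \in J -> - C <= k2 x) ->
  k t - ((b - t) / (b - a) * k a + (t - a) / (b - a) * k b) <=
  C * (b - a) ^+ 2 / 8.
Proof.
move=> aJ bJ at' tb ab C0 d1 d2 k2C.
have dsq x : der_at [set` J] (fun x => C / 2 * (x * x)) x (C * x).
  rewrite [X in der_at _ _ _ X](_ : _ = 0 * (x * x) + C / 2 * (1 * x + x * 1)); last first.
    by field.
  apply: der_atM; first exact: der_at_cst.
  by apply: der_atM; exact: der_at_id.
have dlin x : der_at [set` J] (fun x => C * x) x C.
  rewrite [X in der_at _ _ _ X](_ : _ = 0 * x + C * 1); last ring.
  by apply: der_atM; [exact: der_at_cst|exact: der_at_id].
have := @convex_interpolation J (fun x => k x + C / 2 * (x * x))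
  (fun x => k1 x + C * x) (fun x => k2 x + C) a b t aJ bJ at' tb ab
  (fun x xJ => der_atD (d1 x xJ) (dsq x)) (fun x xJ => der_atD (d2 x xJ) (dlin x)).
move=> /(_ _)/wrap[x xJ|h]; first by have := k2C x xJ; lra.
have ba0 : 0 < b - a by lra.
rewrite -(ler_pM2l ba0) mulrBr mulrDr !mulrA.
have E c : (b - a) * c / (b - a) = c by rewrite mulrAC divff ?mul1r// gt_eqF.
rewrite !E.
have sq : (t - a) * (b - t) <= (b - a) ^+ 2 / 4.
  have := sqr_ge0 ((t - a) - (b - t)); rewrite !expr2; lra.
have := ler_wpM2l C0 sq => h2.
apply: (@le_trans _ _ ((b - a) * (C / 2 * ((t - a) * (b - t))))).
  by move: h; lra.
by rewrite -!mulrA ler_pM2l//; lra.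
Qed.

End interpolation.

(** * Linear structure and inner product of L2 *)

Section L2_lemmas.
Context {d} {T : measurableType d} {R : realType}.
Variable mu : {measure set T -> \bar R}.
Implicit Types (f h : T -> R).
Local Notation L2 := (Lfun mu 2%:E).

Lemma Lnorm2E f : Lnorm mu 2%:E (EFin \o f) = sqrte (\int[mu]_x (f x ^+ 2)%:E)%E.
Proof.
rewrite -poweR12_sqrt; last by apply: integral_ge0 => x _; rewrite lee_fin sqr_ge0.
rewrite unlock /=; congr (_ `^ _)%E.
apply: eq_integral => x _ /=.
by rewrite powR_mulrn// -normrX ger0_norm// sqr_ge0.
Qed.

Lemma L2distE f h : L2dist mu f h = sqrte (\int[mu]_x ((f x - h x) ^+ 2)%:E)%E.
Proof. by rewrite /L2dist -Lnorm2E. Qed.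

Lemma L2dist_le f h c : 0 <= c ->
  (\int[mu]_x ((f x - h x) ^+ 2)%:E <= (c ^+ 2)%:E)%E -> (L2dist mu f h <= c%:E)%E.
Proof.
move=> c0 fhc; rewrite L2distE.
have -> : c%:E = sqrte (c ^+ 2)%:E by rewrite /= sqrtr_sqr ger0_norm.
by rewrite lee_sqrt// lee_fin sqr_ge0.
Qed.

Lemma L2dist_ge0 f h : (0 <= L2dist mu f h)%E.
Proof. exact: Lnorm_ge0. Qed.

Lemma measurable_L2 f : f \in L2 -> measurable_fun setT f.
Proof. by rewrite inE => /andP[/[!inE]]. Qed.

Lemma L2P f : measurable_fun setT f ->
  (\int[mu]_x (f x ^+ 2)%:E < +oo)%E -> f \in L2.
Proof.
move=> mf foo; rewrite inE; apply/andP; split; rewrite inE//=.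
rewrite /finite_norm Lnorm2E.
have i0 : (0 <= \int[mu]_x (f x ^+ 2)%:E)%E.
  by apply: integral_ge0 => x _; rewrite lee_fin sqr_ge0.
have : sqrte (\int[mu]_x (f x ^+ 2)%:E)%E \is a fin_num.
  by rewrite sqrte_fin_num// ge0_fin_numE.
by rewrite ge0_fin_numE// sqrte_ge0.
Qed.

Lemma L2_mul_integrable f h : f \in L2 -> h \in L2 ->
  mu.-integrable setT (EFin \o (fun x => f x * h x)).
Proof.
move=> fL hL.
exact: (Lfun1_integrable _ _).1 (Lfun2_mul_Lfun1 fL hL).
Qed.

Definition dot f h := \int[mu]_x (f x * h x).

Lemma dotDl f1 f2 h : f1 \in L2 -> f2 \in L2 -> h \in L2 ->
  dot (fun x => f1 x + f2 x) h = dot f1 h + dot f2 h.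
Proof.
move=> f1L f2L hL; rewrite /dot -RintegralD//; try exact: L2_mul_integrable.
by apply: eq_Rintegral => x _; rewrite mulrDl.
Qed.

Lemma dotZl c f h : f \in L2 -> h \in L2 ->
  dot (fun x => c * f x) h = c * dot f h.
Proof.
move=> fL hL; rewrite /dot -RintegralZl//; last exact: L2_mul_integrable.
by apply: eq_Rintegral => x _; rewrite mulrA.
Qed.

Lemma L2_lin c f h : f \in L2 -> h \in L2 -> (fun x => c * f x + h x) \in L2.
Proof.
have p1 : (1 <= 2%:E :> \bar R)%E by rewrite lee_fin; lra.
move=> fL hL; have [_ lin] := @Lfun_submod_closed _ _ _ mu _ p1.
exact: (lin c f h).
Qed.

Lemma L2D f h : f \in L2 -> h \in L2 -> (fun x => f x + h x) \in L2.
Proof.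
move=> fL hL; have -> : (fun x => f x + h x) = (fun x => 1 * f x + h x).
  by apply/funext => x; rewrite mul1r.
exact: L2_lin.
Qed.

Lemma L2_0 : (fun=> 0) \in L2.
Proof.
apply: L2P; first exact: measurable_cst.
by under eq_integral do rewrite expr0n /=; rewrite integral0.
Qed.

Lemma L2Z c f : f \in L2 -> (fun x => c * f x) \in L2.
Proof.
move=> fL; have -> : (fun x => c * f x) = (fun x => c * f x + 0).
  by apply/funext => x; rewrite addr0.
by apply: L2_lin => //; exact: L2_0.
Qed.

Lemma L2B f h : f \in L2 -> h \in L2 -> (fun x => f x - h x) \in L2.
Proof.
move=> fL hL; have -> : (fun x => f x - h x) = (fun x => f x + (-1) * h x).
  by apply/funext => x; rewrite mulN1r.
by apply: L2D => //; exact: L2Z.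
Qed.

Lemma L2_fin_num f h : f \in L2 -> h \in L2 -> L2dist mu f h \is a fin_num.
Proof.
move=> fL hL; rewrite ge0_fin_numE ?L2dist_ge0//.
by have := L2B fL hL; rewrite inE => /andP[_]; rewrite inE.
Qed.

Lemma dot_le f h : f \in L2 -> h \in L2 ->
  `|dot f h| <= fine (Lnorm mu 2%:E (EFin \o f)) * fine (Lnorm mu 2%:E (EFin \o h)).
Proof.
move=> fL hL; have mf := measurable_L2 fL; have mh := measurable_L2 hL.
have fin g : g \in L2 -> Lnorm mu 2%:E (EFin \o g) \is a fin_num.
  rewrite inE => /andP[_]; rewrite inE /= /finite_norm => ?.
  by rewrite ge0_fin_numE ?Lnorm_ge0.
rewrite -lee_fin EFinM !fineK ?fin//.
rewrite EFin_normr_Rintegral//; last exact: L2_mul_integrable.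
have mfh : measurable_fun setT (EFin \o (fun x => f x * h x)).
  by apply/measurable_EFinP; exact: measurable_funM.
apply: (le_trans (le_abse_integral mu measurableT mfh)).
have := @hoelder _ _ _ mu f h 2 2 mf mh; rewrite Lnorm1; apply; [lra|lra|].
by rewrite -[RHS](@divff _ 2) // mulrDl !mul1r.
Qed.

End L2_lemmas.

(** * Piecewise linear interpolation of a C2 curve in L2 *)

Section width.
Context {d} {Y : measurableType d} {R : realType}.
Variable mu : {measure set Y -> \bar R}.
Implicit Types (g : R -> Y -> R) (A : set R).
Local Notation L2 := (Lfun mu 2%:E).

(** By Cauchy-Schwarz, pairing with a fixed [e] is a continuous linear functional, so it commutes
    with the [L2] derivative. *)
Lemma dot_der A g t (l e : Y -> R) : A t -> (forall s, A s -> g s \in L2) ->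
  l \in L2 -> e \in L2 -> L2_is_derive_in mu A g t l ->
  der_at A (fun s => dot mu (g s) e) t (dot mu l e).
Proof.
move=> At gL lL eL /fine_cvgP[_ /= cv].
pose ne := fine (Lnorm mu 2%:E (EFin \o e)).
have ne0 : 0 <= ne by rewrite fine_ge0// Lnorm_ge0.
apply/cvgrPdist_le => eps eps0.
have d0 : 0 < eps / (ne + 1) by rewrite divr_gt0//; lra.
move/cvgrPdist_le : cv => /(_ _ d0); rewrite !near_withinE; apply: filterS => s + st As.
move=> /(_ st As) /=; rewrite sub0r normrN => h.
have qL : (fun x => (g s x - g t x) / (s - t)) \in L2.
  have -> : (fun x => (g s x - g t x) / (s - t)) =
      (fun x => (s - t)^-1 * (g s x - g t x)).
    by apply/funext => x; rewrite mulrC.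
  by apply: L2Z; apply: L2B; exact: gL.
have qlL := L2B qL lL.
have -> : dot mu l e - (dot mu (g s) e - dot mu (g t) e) / (s - t) =
    - dot mu (fun x => (g s x - g t x) / (s - t) - l x) e.
  have -> : (fun x => (g s x - g t x) / (s - t) - l x) =
      (fun x => (s - t)^-1 * (g s x + (-1) * g t x) + (-1) * l x).
    by apply/funext => x; ring.
  have g1L : (fun x => (-1) * g t x) \in L2 by apply: L2Z; exact: gL.
  have l1L : (fun x => (-1) * l x) \in L2 by exact: L2Z.
  have gsL := gL s As; have gtL := gL t At.
  have gg := L2D gsL g1L.
  rewrite dotDl//; last exact: L2Z.
  by rewrite dotZl// dotDl// !dotZl//; ring.
rewrite normrN; apply: (le_trans (dot_le qlL eL)); rewrite -/ne.
have h' : fine (L2dist mu (fun x => (g s x - g t x) / (s - t)) l) <= eps / (ne + 1).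
  exact: le_trans (ler_norm _) h.
apply: (@le_trans _ _ (eps / (ne + 1) * ne)); first exact: ler_wpM2r.
by rewrite mulrAC ler_pdivrMr; [rewrite ler_wpM2l ?(ltW eps0)//; lra|lra].
Qed.

Context (T : R) (g g1 g2 : R -> Y -> R) (B : R).
Hypotheses (T0 : 0 < T) (B0 : 0 <= B).
Hypothesis gL : forall t, t \in `[0, T] -> [/\ g t \in L2, g1 t \in L2 & g2 t \in L2].
Hypothesis dg : forall t, t \in `[0, T] -> L2_is_derive_in mu `[0, T] g t (g1 t).
Hypothesis dg1 : forall t, t \in `[0, T] -> L2_is_derive_in mu `[0, T] g1 t (g2 t).
Hypothesis g2B : forall t, t \in `[0, T] ->
  (\int[mu]_x (g2 t x ^+ 2)%:E <= (B ^+ 2)%:E)%E.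

(* Testing the interpolation error e against e itself reduces the estimate to
   the scalar function s |-> <g s, e>. *)
Lemma L2_interpolation_error a b t : a \in `[0, T] -> b \in `[0, T] ->
  a <= t -> t <= b -> a < b ->
  (L2dist mu (g t) (fun x => (b - t) / (b - a) * g a x + (t - a) / (b - a) * g b x)%R
   <= (B * (b - a) ^+ 2 / 8)%:E)%E.
Proof.
move=> aJ bJ at' tb ab.
have tJ : t \in `[0, T] by apply: itv_convex aJ bJ _; rewrite at'.
set p := _ / _; set q := (t - a) / _.
pose h x := p * g a x + q * g b x.
have [gaL _ _] := gL aJ; have [gbL _ _] := gL bJ; have [gtL _ _] := gL tJ.
have hL : h \in L2 by apply: L2_lin => //; exact: L2Z.
pose e x := g t x - h x.
have eL : e \in L2 by exact: L2B.
pose ne := fine (Lnorm mu 2%:E (EFin \o e)).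
have neE : L2dist mu (g t) h = ne%:E.
  by rewrite fineK//; exact: (L2_fin_num gtL hL).
have ne0 : 0 <= ne by rewrite fine_ge0// Lnorm_ge0.
have dotee : dot mu e e = ne ^+ 2.
  apply: EFin_inj; rewrite EFin_expe -neE L2distE.
  rewrite sqr_sqrte; last by apply: integral_ge0 => x _; rewrite lee_fin sqr_ge0.
  rewrite /dot /Rintegral fineK; last first.
    by apply: integrable_fin_num => //; exact: L2_mul_integrable.
  by apply: eq_integral => x _; rewrite expr2.
have n2 s : s \in `[0, T] -> fine (Lnorm mu 2%:E (EFin \o g2 s)) <= B.
  move=> sJ; have [_ _ g2L] := gL sJ.
  have fn : Lnorm mu 2%:E (EFin \o g2 s) \is a fin_num.
    move: g2L; rewrite inE => /andP[_]; rewrite inE /= /finite_norm => ?.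
    by rewrite ge0_fin_numE ?Lnorm_ge0.
  rewrite -lee_fin fineK// Lnorm2E.
  have -> : B%:E = sqrte (B ^+ 2)%:E by rewrite /= sqrtr_sqr ger0_norm.
  by rewrite lee_sqrt ?g2B// lee_fin sqr_ge0.
have d1 s : s \in `[0, T] -> der_at `[0, T] (fun s => dot mu (g s) e) s (dot mu (g1 s) e).
  move=> sJ; apply: dot_der => //; last exact: dg.
    by move=> s' /gL[].
  by have [] := gL sJ.
have d2 s : s \in `[0, T] -> der_at `[0, T] (fun s => dot mu (g1 s) e) s (dot mu (g2 s) e).
  move=> sJ; apply: dot_der => //; last exact: dg1.
    by move=> s' /gL[].
  by have [] := gL sJ.
have Bne : 0 <= B * ne by rewrite mulr_ge0.
have lo s : s \in `[0, T] -> - (B * ne) <= dot mu (g2 s) e.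
  move=> sJ; have [_ _ g2L] := gL sJ.
  have := le_trans (dot_le g2L eL) (ler_wpM2r ne0 (n2 s sJ)).
  by rewrite ler_norml => /andP[].
have := interpolation_error aJ bJ at' tb ab Bne d1 d2 lo.
have -> : dot mu (g t) e - (p * dot mu (g a) e + q * dot mu (g b) e) = dot mu e e.
  have -> : dot mu e e = dot mu (fun x => g t x + (-1) * (p * g a x + q * g b x)) e.
    by congr (dot mu _ e); apply/funext => x; rewrite /e /h; ring.
  have pL : (fun x => p * g a x) \in L2 by exact: L2Z.
  have qL : (fun x => q * g b x) \in L2 by exact: L2Z.
  rewrite dotDl//; last by apply: L2Z; exact: L2D.
  have -> : dot mu (fun x => -1 * (p * g a x + q * g b x)) e =
      -1 * dot mu (fun x => p * g a x + q * g b x) e.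
    by apply: dotZl => //; exact: L2D.
  by rewrite dotDl// !dotZl//; ring.
(* The scalar estimate reads [ne ^ 2 <= B * ne * (b - a) ^ 2 / 8]; one factor [ne] is divided out
   unless it is zero. *)
rewrite dotee => key; rewrite neE lee_fin.
have [ne1|ne1] := leP ne 0.
  apply: (le_trans ne1); rewrite divr_ge0// mulr_ge0// sqr_ge0//.
by rewrite -(ler_pM2l ne1) -expr2; move: key; lra.
Qed.

Lemma kolmogorov_width_C2 n : (2 <= n)%N ->
  (kolmogorov_width mu n [set g t | t in `[0%R, T]] <=
   (B * (T ^+ 2 / (8 * (n%:R - 1) ^+ 2)))%:E)%E.
Proof.
(* From here on the dimension is [n.+2]: that many nodes bound [n.+1] cells, the [n - 1] of the
   estimate. *)
case: n => [//|[//|n]] _.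
have n0 : (0 : R) < n.+1%:R by rewrite ltr0n.
have -> : n.+2%:R - 1 = n.+1%:R :> R by rewrite -[n.+2%:R]natr1 addrK.
pose D := T / n.+1%:R.
have D0 : 0 < D by rewrite divr_gt0.
have DT : n.+1%:R * D = T by rewrite /D mulrC divfK// gt_eqF.
have node (j : nat) : (j <= n.+1)%N -> j%:R * D \in `[0, T].
  move=> jn; rewrite in_itv /= mulr_ge0 ?(ltW D0)//= -DT ler_pM2r// ler_nat.
  by [].
pose e (j : 'I_n.+2) : Y -> R := g (j%:R * D).
pose V := [set h | exists c : 'I_n.+2 -> R, h = fun x => \sum_(i < n.+2) c i * e i x].
apply: ge_ereal_inf; exists (ereal_sup [set ereal_inf [set L2dist mu w h | h in V] |
  w in [set g t | t in `[0, T]]]).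
  exists V => //; exists e; split => // i.
  by have [] := gL (node i (leq_ord i)).
apply: ge_ereal_sup => _ [_ [t tJ <-] <-].
have /andP[t0 tT] : 0 <= t <= T by move: tJ; rewrite /= in_itv.
have [i [inn a1 a2]] : exists i, [/\ (i <= n)%N, i%:R * D <= t & t <= i.+1%:R * D].
  have tD0 : 0 <= t / D by rewrite divr_ge0// ltW.
  have [h1 h2] := andP (truncn_itv tD0).
  (* The cell of [t] has index the integer part of [t / D], except at [t = T], which is put in the
     last cell. *)
  have [k|k] := leqP (Num.truncn (t / D)) n.
    exists (Num.truncn (t / D)); split => //.
      by rewrite -ler_pdivlMr.
    by rewrite -ler_pdivrMr// ltW.
  exists n; split => //; last by rewrite DT.
  rewrite -ler_pdivlMr//; apply: le_trans h1.
  by rewrite ler_nat ltnW.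
have i1 : (i.+1 < n.+2)%N by [].
have i0 : (i < n.+2)%N by exact: leq_trans i1.
have aJ := node i (leqW inn); have bJ := node i.+1 inn.
set a := i%:R * D in a1 aJ; set b := i.+1%:R * D in a2 bJ.
have bDa : b - a = D by rewrite /a /b -natr1; ring.
have ab : a < b by rewrite -subr_gt0 bDa.
apply: ge_ereal_inf.
exists (L2dist mu (g t) (fun x => (b - t) / (b - a) * g a x + (t - a) / (b - a) * g b x)).
  exists (fun x => (b - t) / (b - a) * g a x + (t - a) / (b - a) * g b x) => //.
  (* Written as a sum of two indicators, so that the linear combination splits into two one-term
     sums. *)
  exists (fun j : 'I_n.+2 => (b - t) / (b - a) * (j == Ordinal i0)%:R +
                 (t - a) / (b - a) * (j == Ordinal i1)%:R).
  apply/funext => x.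
  under eq_bigr do rewrite mulrDl.
  rewrite big_split /= (bigD1 (Ordinal i0))//= big1 ?addr0; last first.
    by move=> j /negbTE ->; rewrite mulr0 mul0r.
  rewrite (bigD1 (Ordinal i1))//= big1 ?addr0; last first.
    by move=> j /negbTE ->; rewrite mulr0 mul0r.
  by rewrite !eqxx !mulr1.
apply: (le_trans (L2_interpolation_error aJ bJ a1 a2 ab)).
rewrite bDa lee_fin /D expr_div_n.
by rewrite le_eqVlt; apply/orP; left; apply/eqP; field; rewrite gt_eqF.
Qed.

End width.

(** * Bounded convergence in L2 over a probability space *)

Section bounded_convergence.
Context {d} {Y : measurableType d} {R : realType}.
Variable mu : probability Y R.
Local Notation L2 := (Lfun mu 2%:E).

Lemma L2_ae_bounded (h : Y -> R) B : measurable_fun setT h ->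
  {ae mu, forall x, `|h x| <= B} -> h \in L2.
Proof.
move=> mh hB; apply: L2P => //.
apply: (@le_lt_trans _ _ (\int[mu]_x (B ^+ 2)%:E)%E).
  apply: ae_ge0_le_integral => //.
  - by move=> x _; rewrite lee_fin sqr_ge0.
  - by apply/measurable_EFinP; exact: measurable_funX.
  - by move=> x _; rewrite lee_fin sqr_ge0.
  apply: filterS hB => x hx _; rewrite lee_fin -(real_normK (num_real (h x))).
  by apply: lerXn2r; rewrite ?nnegrE// (le_trans _ hx).
by rewrite integral_cst//= [X in (_ * X)%E](@probability_setT _ _ _ mu) mule1 ltry.
Qed.

(** Dominated convergence is a statement on sequences: were the limit along [D] to fail, points
    [s_ n] of [D] within [1 / (n + 1)] of [s0] would stay at distance above [e]. The constant
    [B ^ 2] dominates, as the measure is finite. *)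
Lemma L2_cvg_bounded (D : set R) (Q : R -> Y -> R) (Q0 : Y -> R) (s0 B : R) :
  (forall s, D s -> measurable_fun setT (Q s)) -> measurable_fun setT Q0 ->
  {ae mu, forall x, (forall s, D s -> `|Q s x - Q0 x| <= B) /\
    Q s x @[s --> within D (nbhs s0)] --> Q0 x} ->
  L2dist mu (Q s) Q0 @[s --> within D (nbhs s0)] --> 0%E.
Proof.
move=> mQ mQ0 ae_Q.
suff key e : 0 < e -> \forall s \near within D (nbhs s0),
    (L2dist mu (Q s) Q0 <= e%:E)%E.
  apply/fine_cvgP; split.
    apply: filterS (key 1 ltr01) => s h.
    by rewrite ge0_fin_numE ?L2dist_ge0// (le_lt_trans h) ?ltry.
  apply/cvgrPdist_le => e e0; apply: filterS (key e e0) => s h /=.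
  have fn : L2dist mu (Q s) Q0 \is a fin_num.
    by rewrite ge0_fin_numE ?L2dist_ge0// (le_lt_trans h) ?ltry.
  rewrite sub0r normrN ger0_norm ?fine_ge0 ?L2dist_ge0//.
  by rewrite -lee_fin fineK.
move=> e0; apply: contrapT => nnear.
have H n : exists s, [/\ D s, `|s0 - s| < n.+1%:R^-1 &
    ~ (L2dist mu (Q s) Q0 <= e%:E)%E].
  apply: contrapT => nex; apply: nnear; rewrite near_withinE.
  have n0 : (0 : R) < n.+1%:R^-1 by rewrite invr_gt0 ltr0n.
  apply: filterS (nbhsx_ballx s0 _ n0) => s; rewrite /ball /= => hs Ds.
  by apply: contrapT => nh; apply: nex; exists s.
have [s_ hs] := choice H.
have scvg : s_ n @[n --> \oo] --> within D (nbhs s0).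
  move=> W; rewrite /within /= => -[eps /= eps0 hW].
  have [n hn] : exists n : nat, n.+1%:R^-1 < eps.
    exists (Num.truncn (eps^-1)).
    by rewrite -[ltRHS]invrK ltf_pV2 ?posrE ?invr_gt0// truncnS_gt.
  exists n => // m /= nm; have [Ds sm _] := hs m.
  apply: hW => //=; apply: lt_trans sm _; apply: le_lt_trans hn.
  by rewrite lef_pV2 ?posrE ?ltr0n// ler_nat.
pose f_ n x := ((Q (s_ n) x - Q0 x) ^+ 2)%:E.
have mf n : measurable_fun setT (f_ n).
  apply/measurable_EFinP; apply: measurable_funX; apply: measurable_funB => //.
  by apply: mQ; have [] := hs n.
have f_0 : {ae mu, forall x, setT x -> f_ ^~ x @ \oo --> (cst 0%E : Y -> \bar R) x}.
  apply: filterS ae_Q => x [_ cvx] _.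
  rewrite /f_ /cst; apply: cvg_EFin; first exact: nearW.
  have c1 : Q (s_ n) x @[n --> \oo] --> Q0 x.
    by apply: (@cvg_comp _ _ _ s_ (Q ^~ x) _ (within D (nbhs s0))).
  rewrite [X in _ --> X](_ : _ = (Q0 x - Q0 x) * (Q0 x - Q0 x)); last first.
    by rewrite subrr mul0r.
  rewrite /comp /=; under eq_fun do rewrite expr2.
  by apply: cvgM; apply: cvgB => //; exact: cvg_cst.
have iB : mu.-integrable setT (cst (B ^+ 2)%:E).
  exact: finite_measure_integrable_cst.
have f_B : {ae mu, forall x n, setT x -> (`|f_ n x| <= cst (B ^+ 2)%:E x)%E}.
  apply: filterS ae_Q => x [bx _] n _ /=.
  have [Ds _ _] := hs n; have h := bx _ Ds.
  rewrite /f_ /= lee_fin ger0_norm ?sqr_ge0// -(real_normK (num_real (_ - _))).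
  by apply: lerXn2r; rewrite ?nnegrE// (le_trans _ h).
have [_ _] := dominated_convergence measurableT mf (measurable_cst _) f_0 iB f_B.
rewrite integral0 => /fine_cvgP[fn cv].
have e2 : 0 < e ^+ 2 by rewrite exprn_gt0.
have := cvgr_lt 0 cv _ e2.
move=> cvlt; have [n _ /(_ n (leqnn n)) /= [fnn lt]] := filterI fn (cvlt _).
have [_ _] := hs n; apply; apply: L2dist_le; first exact: ltW.
by rewrite -[leLHS]fineK// lee_fin ltW.
Qed.

End bounded_convergence.

Lemma ae_imp {d} {Y : measurableType d} {R : realType} (mu : probability Y R)
    (P Q : Y -> Prop) :
  (forall x, P x -> Q x) -> {ae mu, forall x, P x} -> {ae mu, forall x, Q x}.
Proof. by move=> PQ; apply: filterS. Qed.

(** * The curve of transforms *)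

Section transform_curve.
Context {R : realType} {I : interval R} {T M N alpha : R}
  {f f1 f2 G G1 u0 u01 r : R -> R} {u ux ut : R -> R -> R}
  (S : solution I T M N alpha f f1 f2 G G1 u0 u01 u ux ut)
  (hu0 : is_density I u0) (hr : is_density I r)
  (hu02 : I = `]-oo, +oo[ -> finite_second_moment I u0).
Local Notation mu := (density_measure hr).
Local Notation leb := (@lebesgue_measure R).
Local Notation L2 := (Lfun mu 2%:E).

Definition uhat t := CDT I r (u ^~ t).
Definition uhat1 t xi := G (u (uhat t xi) t).
Definition uhat2 t xi := @accel R G1 u ux (uhat t xi) t.

Lemma uhat_in t xi : t \in `[0, T] -> uhat t xi \in I.
Proof. by move=> tJ; apply: (CDT_in (sol_I S) hr (u_density S hu0 tJ)). Qed.

Lemma measurable_uhat t : t \in `[0, T] ->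
  measurable_fun (setT : set (measurableTypeR R)) (uhat t).
Proof. by move=> tJ; apply: (measurable_CDT (sol_I S) hr (u_density S hu0 tJ)). Qed.

Lemma measurable_comp_uhat (k : R -> R) t : continuous k -> t \in `[0, T] ->
  measurable_fun (setT : set (measurableTypeR R)) (fun xi => k (uhat t xi)).
Proof.
move=> ck tJ; apply: (@measurableT_comp _ _ _ _ _ _ k _ (uhat t)).
  by apply: continuous_measurable.
exact: measurable_uhat.
Qed.

Lemma continuous_G1u t : continuous (fun x => G1 (u x t)).
Proof.
by move=> y; apply: (@cvg_comp _ _ _ (u ^~ t) G1);
  [exact: (continuous_u S)|exact: (sol_cG1 S)].
Qed.

Lemma continuous_Gu t : continuous (fun x => G (u x t)).
Proof.
by move=> y; apply: (@cvg_comp _ _ _ (u ^~ t) G);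
  [exact: (continuous_u S)|exact: (sol_cG S)].
Qed.

Lemma continuous_accel t : continuous ((@accel R G1 u ux) ^~ t).
Proof.
move=> x; have cux : continuous (ux ^~ t).
  by apply: (continuous_curve (sol_cux S)) => y; [exact: cvg_id|exact: cvg_cst].
apply: cvgN; apply: cvgM; last exact: cux.
apply: cvgM; first exact: (continuous_u S).
exact: (@continuousX_fun R (fun x => G1 (u x t)) 2 (@continuous_G1u t) x).
Qed.

(** On the line every foot is interior, and [ux * D = u01] with [D >= alpha] gives [N / alpha]. On a
    segment [ux] is continuous on a compact rectangle. *)
Lemma ux_bound : exists2 B, 0 <= B & forall x t, x \in I -> t \in `[0, T] ->
  `|ux x t| <= B.
Proof.
have a0 := sol_alpha S.
have N0 : 0 <= N by apply: le_trans (sol_u01 S 0).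
have [IE|[a [b [ab IE]]]] := sol_I S.
  exists (N / alpha); first by rewrite divr_ge0// ltW.
  move=> x t xI tJ.
  have yI : nbhs (@foot R f1 u t x) [set` I] by rewrite IE set_itvE; exact: filterT.
  have [_ E _] := ux_inner S xI tJ yI.
  have yI' : @foot R f1 u t x \in I by rewrite IE in_itv.
  have aD := sol_char S tJ yI'.
  rewrite ler_pdivlMr//; apply: le_trans (sol_u01 S (@foot R f1 u t x)).
  rewrite -E normrM ler_wpM2l//; apply: le_trans aD (ler_norm _).
have cK : compact (`[a, b] `*` `[0, T] : set (R * R)).
  by apply: compact_setX; exact: segment_compact.
have K0 : (`[a, b] `*` `[0, T] : set (R * R)) !=set0.
  exists (a, 0); split => /=; rewrite in_itv /= lexx; first exact: ltW.
  by rewrite ltW// (sol_T S).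
have cux : {within (`[a, b] `*` `[0, T]), continuous (fun p : R * R => `|ux p.1 p.2|)}.
  apply: continuous_subspaceT => p.
  apply: (@cvg_comp _ _ _ (fun p : R * R => ux p.1 p.2) (@Num.norm R R)).
    exact: (sol_cux S).
  exact: norm_continuous.
have [p _ hp] := compact_EVT_max K0 cK cux.
exists `|ux p.1 p.2| => // x t xI tJ.
apply: (hp (x, t)); rewrite inE; split => //=.
by rewrite -IE.
Qed.

Lemma accel_bound : exists2 B, 0 <= B & forall x t, x \in I -> t \in `[0, T] ->
  `|@accel R G1 u ux x t| <= B.
Proof.
have [B B0 hB] := ux_bound.
have [K K0 hK] := @continuous_bounded_segment R G1 (- M) M
  (continuous_subspaceT (sol_cG1 S)).
have M0 := sol_M S.
exists (M * K ^+ 2 * B); first by rewrite !mulr_ge0 ?sqr_ge0// ltW.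
move=> x t xI tJ; rewrite /accel normrN !normrM.
apply: ler_pM; rewrite ?hB//.
apply: ler_pM => //.
  by rewrite ler_norml; have := sol_uM S x t; rewrite in_itv.
by rewrite expr2; apply: ler_pM => //; apply: hK; exact: (sol_uM S).
Qed.

(** These are the two assumptions on the level [p = distr_fun I r xi] under which trajectories are
    differentiable. The second fails on a null set because [uhat 0] has law [u(.,0)], which gives no
    mass to its own zeros. *)
Lemma good_ae : {ae mu, forall xi, 0 < distr_fun I r xi < 1 /\
  0 < u (uhat 0 xi) 0}.
Proof.
have J0 := in0T S; have hw := u_density S hu0 J0.
pose Z : set (measurableTypeR R) := [set z | u z 0 <= 0].
have mZ : measurable Z.
  have mu0 : measurable_fun (setT : set (measurableTypeR R)) (u ^~ 0).
    by apply: continuous_measurable; exact: (continuous_u S).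
  have -> : Z = setT `&` (u ^~ 0) @^-1` [set` `]-oo, 0]].
    by rewrite setTI; apply/seteqP; split => y; rewrite /Z /= in_itv.
  exact: mu0 measurableT _ (measurable_line _).
have N2 : mu (uhat 0 @^-1` Z) = 0%E.
  rewrite (CDT_measure (sol_I S) hr hw mZ) /density_measure.
  apply: integral0_eq => z [/= uz zI]; congr (_%:E); apply/eqP.
  by rewrite eq_le uz (u_ge0 S).
have mN2 : measurable (uhat 0 @^-1` Z : set (measurableTypeR R)).
  by rewrite -[X in measurable X]setTI; apply: (measurable_uhat J0).
have N1 := distr_fun_extreme_null hr.
have mN1 := measurableU _ _ (measurable_level hr 0) (measurable_level_ge hr 1).
exists (([set y | distr_fun I r y <= 0] `|` [set y | 1 <= distr_fun I r y]) `|`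
  uhat 0 @^-1` Z); split.
- exact: measurableU.
- exact: null_set_setU.
move=> xi /= h; apply: contrapT => nh; apply: h.
split; last by rewrite ltNge; apply/negP => uz; apply: nh; right.
apply/andP; split; rewrite ltNge; apply/negP => hF; apply: nh; left; [left|right] => //.
Qed.

Lemma uhat_sub_bound K s t xi : (forall v, v \in `[- M, M] -> `|G v| <= K) ->
  0 < distr_fun I r xi < 1 -> s \in `[0, T] -> t \in `[0, T] ->
  `|uhat s xi - uhat t xi| <= K * `|s - t|.
Proof. by move=> hK h sJ tJ; apply: (position_lipschitz S hu0 h hK sJ tJ). Qed.

(** On the line the squared norm is the second moment of [u0], by the change of variables; on a
    segment the transform is bounded. Later times differ from [uhat 0] by a bounded function. *)
Lemma uhat0_L2 : uhat 0 \in L2.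
Proof.
have J0 := in0T S; have hw := u_density S hu0 J0.
have [IE|[a [b [ab IE]]]] := sol_I S; last first.
  apply: (@L2_ae_bounded _ _ _ mu _ (`|a| + `|b|)); first exact: measurable_uhat.
  apply: nearW => xi; have := uhat_in xi J0; rewrite IE in_itv /= => /andP[h1 h2].
  rewrite ler_norml; have := ler_norm (- a); have := ler_norm b; rewrite normrN.
  by have := normr_ge0 a; have := normr_ge0 b; lra.
apply: L2P; first exact: measurable_uhat.
have k0 (x : R) : (0 <= (x ^+ 2)%:E)%E by rewrite lee_fin sqr_ge0.
have mk : measurable_fun (setT : set (measurableTypeR R)) (fun x : R => (x ^+ 2)%:E).
  apply/measurable_EFinP; apply: continuous_measurable => x.
  exact: exprn_continuous.
rewrite (integral_CDT (sol_I S) hr hw k0 mk).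
apply: le_lt_trans (hu02 IE); rewrite le_eqVlt; apply/orP; left; apply/eqP.
apply: eq_integral.
by move=> x; rewrite inE /= => xI; rewrite -EFinM (sol_init S).
Qed.

Lemma uhat_L2 t : t \in `[0, T] -> uhat t \in L2.
Proof.
move=> tJ; have J0 := in0T S.
have [K K0 hK] := G_bound S.
have -> : uhat t = (fun xi => uhat 0 xi + (uhat t xi - uhat 0 xi)).
  by apply/funext => xi; rewrite subrKC.
apply: L2D; first exact: uhat0_L2.
apply: (@L2_ae_bounded _ _ _ mu _ (K * `|t - 0|)).
  by apply: measurable_funB; exact: measurable_uhat.
by apply: (ae_imp _ good_ae) => xi [h _]; exact: uhat_sub_bound.
Qed.

Lemma uhat1_L2 t : t \in `[0, T] -> uhat1 t \in L2.
Proof.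
move=> tJ; have [K K0 hK] := G_bound S.
apply: (@L2_ae_bounded _ _ _ mu _ K).
  exact: (measurable_comp_uhat (@continuous_Gu t)).
by apply: nearW => xi; apply: hK; exact: (sol_uM S).
Qed.

Lemma measurable_uhat2 t : t \in `[0, T] ->
  measurable_fun (setT : set (measurableTypeR R)) (uhat2 t).
Proof. by move=> tJ; exact: (measurable_comp_uhat (@continuous_accel t)). Qed.

Lemma uhat2_L2 t : t \in `[0, T] -> uhat2 t \in L2.
Proof.
move=> tJ; have [B B0 hB] := accel_bound.
apply: (@L2_ae_bounded _ _ _ mu _ B); first exact: measurable_uhat2.
by apply: nearW => xi; apply: hB => //; exact: uhat_in.
Qed.

(** Moves the puncture into the set, so that the convergence lemma for [within D (nbhs t)] applies
    to difference quotients. *)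
Let within_dnbhs (A : set R) (t : R) :
  within A t^' = within (A `&` [set s | s != t]) (nbhs t).
Proof.
apply/funext => W /=; apply/propext; split => h.
  have h' : \forall s \near t, s != t -> A s -> W s := h.
  have : \forall s \near t, (A `&` [set s | s != t]) s -> W s.
    by apply: filterS h' => s hs [As st]; exact: hs.
  exact.
have h' : \forall s \near t, (A `&` [set s | s != t]) s -> W s := h.
have : \forall s \near t, s != t -> A s -> W s.
  by apply: filterS h' => s hs st As; exact: hs.
exact.
Qed.

Lemma uhat_der t : t \in `[0, T] ->
  L2_is_derive_in mu `[0, T] uhat t (uhat1 t).
Proof.
move=> tJ; rewrite /L2_is_derive_in within_dnbhs.
have [K K0 hK] := G_bound S.
(* One [K] bounds the quotient, by the Lipschitz estimate on positions; the other bounds its limit,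
   the velocity. *)
apply: (@L2_cvg_bounded _ _ _ mu _ (fun s xi => (uhat s xi - uhat t xi) / (s - t))
  (uhat1 t) t (K + K)).
- move=> s [sJ _]; apply: measurable_funM; last exact: measurable_cst.
  by apply: measurable_funB; exact: measurable_uhat.
- by apply: measurable_L2; exact: uhat1_L2.
apply: (ae_imp _ good_ae) => xi [h pos]; split; last first.
  by rewrite -within_dnbhs; apply: (position_der S hu0 h pos tJ).
move=> s [sJ /= st].
apply: (le_trans (ler_normB _ _)); apply: lerD; last by apply: hK; exact: (sol_uM S).
rewrite normrM normfV ler_pdivrMr ?normr_gt0 ?subr_eq0//.
exact: uhat_sub_bound.
Qed.

Lemma uhat1_der t : t \in `[0, T] ->
  L2_is_derive_in mu `[0, T] uhat1 t (uhat2 t).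
Proof.
move=> tJ; rewrite /L2_is_derive_in within_dnbhs.
have [B B0 hB] := accel_bound.
apply: (@L2_cvg_bounded _ _ _ mu _ (fun s xi => (uhat1 s xi - uhat1 t xi) / (s - t))
  (uhat2 t) t (B + B)).
- move=> s [sJ _]; apply: measurable_funM; last exact: measurable_cst.
  by apply: measurable_funB; apply: measurable_L2; exact: uhat1_L2.
- exact: measurable_uhat2.
apply: (ae_imp _ good_ae) => xi [h pos].
have dv s (sJ : s \in `[0, T]) := velocity_der S hu0 h pos sJ.
split; last by rewrite -within_dnbhs; exact: (dv t tJ).
move=> s [sJ /= st].
apply: (le_trans (ler_normB _ _)); apply: lerD; last by apply: hB => //; exact: uhat_in.
rewrite normrM normfV ler_pdivrMr ?normr_gt0 ?subr_eq0//.
(* The quotient of velocities is an acceleration at an intermediate time [c], hence bounded by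
   [B]. *)
have [c [cJ _] E] := MVT_itv_le tJ sJ dv.
rewrite [X in `|X| <= _]E normrM; apply: ler_wpM2r => //.
by apply: hB => //; exact: (@uhat_in c xi).
Qed.

Lemma uhat2_continuous t : t \in `[0, T] ->
  L2_continuous_in mu `[0, T] uhat2 t.
Proof.
move=> tJ; rewrite /L2_continuous_in.
have [B B0 hB] := accel_bound.
apply: (@L2_cvg_bounded _ _ _ mu _ uhat2 (uhat2 t) t (B + B)).
- by move=> s sJ; exact: measurable_uhat2.
- exact: measurable_uhat2.
apply: (ae_imp _ good_ae) => xi [h pos]; split; last first.
  exact: (accel_cvg S hu0 h pos tJ).
move=> s sJ; apply: (le_trans (ler_normB _ _)).
by apply: lerD; apply: hB => //; exact: uhat_in.
Qed.

Lemma uhat_C2 : L2_C2_on mu `[0, T] uhat.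
Proof.
exists uhat1, uhat2; split.
- by move=> t tJ; split; [exact: uhat_L2|exact: uhat1_L2|exact: uhat2_L2].
- exact: uhat_der.
- exact: uhat1_der.
- exact: uhat2_continuous.
Qed.

Lemma uhat2_norm t : t \in `[0, T] ->
  (\int[mu]_xi (uhat2 t xi ^+ 2)%:E <=
   alpha^-1%:E * \int[leb]_(x in [set` I]) (@energy_density0 R G1 u0 u01 x)%:E)%E.
Proof.
move=> tJ; have hw := u_density S hu0 tJ.
have ca := @continuousX_fun R ((@accel R G1 u ux) ^~ t) 2 (@continuous_accel t).
have k0 (x : R) : (0 <= (@accel R G1 u ux x t ^+ 2)%:E)%E by rewrite lee_fin sqr_ge0.
have mk : measurable_fun (setT : set (measurableTypeR R))
    (fun x : R => (@accel R G1 u ux x t ^+ 2)%:E).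
  by apply/measurable_EFinP; exact: continuous_measurable.
rewrite (integral_CDT (sol_I S) hr hw k0 mk).
under eq_integral => x _.
  rewrite -EFinM (_ : _ * _ = @energy_density R G1 u ux x t); last first.
    by rewrite /energy_density /accel; ring.
  over.
apply: (integral_line_le (sol_I S)).
- by apply: continuous_measurable; exact: (continuous_energy_density S).
- by move=> x xI; exact: (energy_density_ge0 S).
- by move=> a b ab aI bI; exact: (energy_segment S).
Qed.

Lemma uhat_width n : (2 <= n)%N ->
  (kolmogorov_width mu n [set uhat t | t in `[0%R, T]] <=
   sqrte (\int[leb]_(x in [set` I]) (@energy_density0 R G1 u0 u01 x)%:E) *
   (T ^+ 2 / (8 * Num.sqrt alpha * (n%:R - 1) ^+ 2))%:E)%E.
Proof.
move=> n2; have T0 := sol_T S; have a0 := sol_alpha S.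
have n1 : (0 : R) < n%:R - 1 by rewrite subr_gt0 ltr1n.
have sa : 0 < Num.sqrt alpha by rewrite sqrtr_gt0.
have q0 : 0 < T ^+ 2 / (8 * Num.sqrt alpha * (n%:R - 1) ^+ 2).
  by rewrite divr_gt0 ?exprn_gt0// !mulr_gt0// exprn_gt0.
have := uhat2_norm; set E := integral _ _ _ => hE.
have E0 : (0 <= E)%E by apply: integral_ge0 => x _; rewrite lee_fin (energy_density0_ge0 S).
(* If the integral is infinite, the right-hand side is [+oo] because its other factor is positive by
   [q0]. *)
case: E E0 hE => [c c0 hE| _ _|//]; last by rewrite gt0_mulye ?leey// lte_fin.
rewrite lee_fin in c0.
have B0 : 0 <= Num.sqrt c / Num.sqrt alpha by rewrite divr_ge0// sqrtr_ge0.
apply: (le_trans (@kolmogorov_width_C2 _ _ _ mu T uhat uhat1 uhat2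
  (Num.sqrt c / Num.sqrt alpha) T0 B0 _ uhat_der uhat1_der _ n n2)).
- by move=> t tJ; split; [exact: uhat_L2|exact: uhat1_L2|exact: uhat2_L2].
- move=> t tJ; apply: (le_trans (hE t tJ)).
  rewrite -EFinM lee_fin expr_div_n !sqr_sqrtr ?(ltW a0)//.
  by rewrite mulrC.
rewrite /= -EFinM lee_fin le_eqVlt; apply/orP; left; apply/eqP.
by field; rewrite !gt_eqF.
Qed.

End transform_curve.

(** * From the hypotheses of the theorem to the retracted solution *)

Section instantiation.
Context {R : realType}.

Lemma continuous_within_comp2 (A B : set R) (w : R -> R -> R) (c d : R -> R) :
  {within A `*` B, continuous (fun p : R * R => w p.1 p.2)} ->
  continuous c -> continuous d -> (forall x, A (c x)) -> (forall x, B (d x)) ->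
  continuous (fun p : R * R => w (c p.1) (d p.2)).
Proof.
move=> cw cc cd cA dB.
have h := @continuous_comp_within (R * R)%type (R * R)%type R (A `*` B) (fun p : R * R => w p.1 p.2)
  (fun p : R * R => (c p.1, d p.2)) cw (continuous_pair_map cc cd)
  (fun p => conj (cA p.1) (dB p.2)).
exact: h.
Qed.

Lemma line_or_segment_lt (I : interval R) : line_or_segment I ->
  exists a b, [/\ a < b, a \in I & b \in I].
Proof.
case=> [->|[a [b [ab ->]]]].
  by exists 0, 1; rewrite !in_itv ltr01.
by exists a, b; rewrite ab !in_itv /= !lexx ltW.
Qed.

Lemma derive_inE (I : interval R) k x l : line_or_segment I -> x \in I ->
  der_at [set` I] k x l -> derive_in [set` I] k x = l.
Proof.
move=> /line_or_segment_lt[a [b [ab aI bI]]] xI kl.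
have dk : derivable_in [set` I] k x by exact: (cvgP _ kl).
by apply: (der_at_unique ab aI bI xI _ kl); exact: derivable_in_der_at.
Qed.

Lemma C1_on_continuous (I : interval R) k : C1_on [set` I] k ->
  {within [set` I], continuous k}.
Proof.
move=> [dk _]; apply: (@der_at_within_continuous _ I k (derive_in [set` I] k)) => x xI.
by apply: derivable_in_der_at; exact: dk.
Qed.

Lemma sup_norm_lt (A : set R) k (M : R) x : (sup_norm A k < M%:E)%E -> A x ->
  `|k x| < M.
Proof.
move=> kM Ax; rewrite -lte_fin; apply: le_lt_trans kM.
by apply: ereal_sup_ubound; exists x.
Qed.

Lemma eq_distr_fun (I : interval R) (w v : R -> R) : {in I, w =1 v} ->
  distr_fun I w = distr_fun I v.
Proof.
move=> wv; apply/funext => x; apply: eq_Rintegral => y; rewrite inE => -[yI _].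
exact: wv.
Qed.

Lemma eq_CDT (I : interval R) (r w v : R -> R) : {in I, w =1 v} ->
  CDT I r w = CDT I r v.
Proof.
by move=> wv; apply/funext => xi; rewrite /CDT /quantile (eq_distr_fun wv).
Qed.

Lemma L2_C2_on_ext {d} {Y : measurableType d} (mu : {measure set Y -> \bar R})
    (A : set R) (g h : R -> Y -> R) : (forall t, A t -> g t = h t) ->
  L2_C2_on mu A g -> L2_C2_on mu A h.
Proof.
move=> gh [g1 [g2 [gL dg dg1 cg2]]]; exists g1, g2; split => // t At.
  by rewrite -gh//; exact: gL.
have := dg t At; apply: cvg_trans; apply: near_eq_cvg.
by rewrite near_withinE; apply: nearW => s Bs; rewrite !gh.
Qed.

End instantiation.

Section theorem_data.
Context {R : realType} (I : interval R) (T M N alpha : R)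
    (u0 f G : R -> R) (u : R -> R -> R)
    (hI : line_or_segment I)
    (hT : 0 < T)
    (hu0C1 : C1_on [set` I] u0)
    (hu0 : is_density I u0)
    (hM : (sup_norm [set` I] u0 < M%:E)%E)
    (hN : (sup_norm [set` I] (derive_in [set` I] u0) < N%:E)%E)
    (hf : C2_on `[- M, M] f)
    (hGC1 : C1_on `[- M, M] G)
    (hG : forall x, x \in `[- M, M] -> x != 0 -> G x = f x / x)
    (hu : classical_solution I T M f u0 u)
    (halpha : 0 < alpha)
    (hchar : forall t xi, t \in `[0, T] -> xi \in I ->
      alpha <= 1 + t * derive_in `[- M, M] (derive_in `[- M, M] f) (u0 xi)
                     * derive_in [set` I] u0 xi)
    (hout : forall a b, I = `[a, b] -> forall t, t \in `[0, T] ->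
      G (u a t) = 0 /\ G (u b t) = 0).

Lemma bound_gt0 : 0 < M.
Proof.
have [a [b [_ aI _]]] := line_or_segment_lt hI.
exact: le_lt_trans (sup_norm_lt hM aI).
Qed.

Lemma u0_in xi : xi \in I -> u0 xi \in `[- M, M].
Proof.
move=> xiI; rewrite in_itv /= -ler_norml; apply: ltW.
exact: sup_norm_lt hM xiI.
Qed.

(** The quotient defines [G] only away from 0, so the point is [f 0 = 0]: the continuous function
    [f v - v * G v] vanishes for [v != 0], hence also at 0. *)
Lemma fluxE v : v \in `[- M, M] -> f v = v * G v.
Proof.
have M0 := bound_gt0.
have hV : line_or_segment `[- M, M] by right; exists (- M), M; split => //; lra.
have [c [cc cV cid _]] := exists_retraction hV.
have cf : continuous (f \o c).
  by apply: continuous_comp_within cc cV; exact: (@C1_on_continuous R `[- M, M] f hf.1).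
have cG : continuous (G \o c).
  by apply: continuous_comp_within cc cV; exact: (@C1_on_continuous R `[- M, M] G hGC1).
have cz v' : v' \in `[- M, M] -> v' != 0 -> f v' = v' * G v'.
  by move=> vV v0; rewrite hG// mulrC divfK.
have [->|v0 vV] := eqVneq v 0; last exact: cz.
move=> V0; rewrite mul0r; apply/eqP/negPn/negP => f0.
have n0 : (f \o c) 0 != 0 by rewrite /= cid.
pose k x := (f \o c) x - x * (G \o c) x.
have ck : continuous k.
  move=> x; apply: cvgB; first exact: cf.
  by apply: cvgM; [exact: cvg_id|exact: cG].
have k0 : k 0 != 0 by rewrite /k mul0r subr0.
have [e /= e0 he] : \forall z \near (0 : R), k z != 0.
  by apply: cvgr_neq0 (ck 0) _.
(* A positive point of [[-M, M]], near enough to 0 that [k] would still be nonzero there. *)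
pose x := Num.min (e / 2) M.
have x0 : 0 < x by rewrite lt_min M0 divr_gt0.
have xV : x \in `[- M, M].
  by rewrite in_itv /= ge_min lexx orbT andbT; lra.
have : k x != 0.
  apply: he => /=; rewrite sub0r normrN gtr0_norm// gt_min.
  by apply/orP; left; lra.
have xn0 : x != 0 by rewrite gt_eqF.
by rewrite /k /= cid// (cz _ xV xn0) subrr eqxx.
Qed.

Lemma derive_flux v : v \in `[- M, M] ->
  derive_in `[- M, M] f v = G v + v * derive_in `[- M, M] G v.
Proof.
move=> vV; have M0 := bound_gt0.
have hV : line_or_segment `[- M, M] by right; exists (- M), M; split => //; lra.
apply: (derive_inE hV vV); rewrite -(mul1r (G v)).
apply: (@der_at_ext _ _ (fun v => v * G v)) => //.
  by move=> y; rewrite inE => yV; rewrite fluxE.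
apply: der_atM; first exact: der_at_id.
by apply: derivable_in_der_at; exact: hGC1.1.
Qed.

Context (cI cT cV : R -> R).
Hypotheses (cI_cont : continuous cI) (cI_in : forall x, cI x \in I)
  (cI_id : forall x, x \in I -> cI x = x).
Hypotheses (cT_cont : continuous cT) (cT_in : forall t, cT t \in `[0, T])
  (cT_id : forall t, t \in `[0, T] -> cT t = t).
Hypotheses (cV_cont : continuous cV) (cV_in : forall v, cV v \in `[- M, M])
  (cV_id : forall v, v \in `[- M, M] -> cV v = v).

(** Clamping the arguments turns continuity within a set into continuity everywhere. Derivatives
    relative to a set only see points of that set, where the retractions are the identity, so they
    are unchanged. *)
Lemma retracted_solution : solution I T M N alpha
  (f \o cV) (derive_in `[- M, M] f \o cV)
  (derive_in `[- M, M] (derive_in `[- M, M] f) \o cV)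
  (G \o cV) (derive_in `[- M, M] G \o cV)
  (u0 \o cI) (derive_in [set` I] u0 \o cI)
  (fun x t => u (cI x) (cT t))
  (fun x t => derive_in [set` I] (u ^~ (cT t)) (cI x))
  (fun x t => derive_in `[0, T] (u (cI x)) (cT t)).
Proof.
have M0 := bound_gt0.
have [[dux dut cu cux cut] uV pde init] := hu.
have dfV v : v \in `[- M, M] -> der_at `[- M, M] f v (derive_in `[- M, M] f v).
  by move=> vV; apply: derivable_in_der_at; exact: hf.1.1.
have extV k l v : v \in `[- M, M] -> der_at `[- M, M] k v l ->
    der_at `[- M, M] (k \o cV) v l.
  by move=> vV; apply: der_at_ext => // y; rewrite inE => yV; rewrite /= cV_id.
have compV (k : R -> R) : {within `[- M, M], continuous k} -> continuous (k \o cV).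
  by move=> ck; exact: (continuous_comp_within ck cV_cont cV_in).
have compI (k : R -> R) : {within [set` I], continuous k} -> continuous (k \o cI).
  by move=> ck; exact: (continuous_comp_within ck cI_cont cI_in).
split; [exact: hI|exact: hT|exact: M0|exact: halpha|..].
- exact: (continuous_within_comp2 cu cI_cont cT_cont cI_in cT_in).
- exact: (@continuous_within_comp2 _ _ _ (fun x t => derive_in [set` I] (u ^~ t) x)
    _ _ cux cI_cont cT_cont cI_in cT_in).
- exact: (@continuous_within_comp2 _ _ _ (fun x t => derive_in `[0, T] (u x) t)
    _ _ cut cI_cont cT_cont cI_in cT_in).
- by apply: compV; exact: (@C1_on_continuous R `[- M, M] f hf.1).
- by apply: compV; exact: hf.1.2.
- by apply: compV; exact: hf.2.2.
- by apply: compV; exact: (@C1_on_continuous R `[- M, M] G hGC1).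
- by apply: compV; exact: hGC1.2.
- by apply: compI; exact: C1_on_continuous.
- by apply: compI; exact: hu0C1.2.
- by move=> x t; exact: uV.
- move=> x t xI tJ; rewrite cI_id// cT_id//.
  apply: (@der_at_ext _ _ (u ^~ t)) => //; last first.
    by apply: derivable_in_der_at; exact: dux.
  by move=> y; rewrite inE => yI; rewrite cI_id.
- move=> x t xI tJ; rewrite cI_id// cT_id//.
  apply: (@der_at_ext _ _ (u x)) => //; last first.
    by apply: derivable_in_der_at; exact: dut.
  by move=> s; rewrite inE => sJ; rewrite cT_id.
- by move=> v vV; apply: extV => //; rewrite /= cV_id//; exact: dfV.
- move=> v vV; apply: extV => //; rewrite /= cV_id//.
  by apply: derivable_in_der_at; exact: hf.2.1.
- move=> v vV; apply: extV => //; rewrite /= cV_id//.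
  by apply: derivable_in_der_at; exact: hGC1.1.
- by move=> v vV; rewrite /= cV_id// fluxE.
- move=> x t xI tJ; rewrite /= cI_id// cT_id// cV_id; last exact: uV.
  apply: etrans (pde x t xI tJ); congr (_ + _); apply/esym.
  apply: (derive_inE hI xI).
  apply: (@der_at_comp _ _ `[- M, M] (u ^~ t) f) => //.
  + by move=> y yI; exact: uV.
  + by apply: derivable_in_der_at; exact: dux.
  + by apply: dfV; exact: uV.
- move=> x xI; rewrite /= cI_id// cT_id ?init//.
  by rewrite in_itv /= lexx ltW.
- move=> x xI; apply: (@der_at_ext _ _ u0) => //.
    by move=> y; rewrite inE => yI; rewrite /= cI_id.
  by rewrite /= cI_id//; apply: derivable_in_der_at; exact: hu0C1.1.
- by move=> x; have [_ h _] := hu0; exact: h.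
- by move=> x; apply: ltW; exact: sup_norm_lt hN (cI_in x).
- by move=> t x tJ xI; rewrite /= cI_id// cV_id ?u0_in//; exact: hchar.
- move=> x t bx tJ; have xI := boundary_pt_in bx.
  rewrite /= cI_id// cT_id// cV_id; last exact: uV.
  case: bx => a [b [ab IE h]]; have [h1 h2] := hout IE tJ.
  by case: h => ->.
Qed.

Lemma retracted_density : is_density I (u0 \o cI).
Proof.
have [mu0 u0_ge0 u0_1] := hu0; split.
- apply: (eq_measurable_fun u0) mu0 => x; rewrite inE => xI.
  by rewrite /= cI_id.
- by move=> x _; exact: u0_ge0.
- rewrite -u0_1; apply: eq_integral => x; rewrite inE /= => xI.
  by rewrite cI_id.
Qed.

Lemma energy_density0_retracted xi : xi \in I ->
  energy_density0 (G1 := derive_in `[- M, M] G \o cV) (u0 := u0 \o cI)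
    (u01 := derive_in [set` I] u0 \o cI) xi = Csq_integrand_G I M G u0 xi.
Proof.
move=> xiI; rewrite /energy_density0 /comp cI_id//.
by rewrite cV_id//; exact: u0_in xiI.
Qed.

(** For [v = u0 xi], the product rule gives [v * f' - f = v ^ 2 * G']; its fourth power over [v ^ 5]
    is [v ^ 3 * G' ^ 4]. *)
Lemma Csq_integrand_fE xi : xi \in I ->
  Csq_integrand_f I M f G u0 xi = Csq_integrand_G I M G u0 xi.
Proof.
move=> xiI; have vV := u0_in xiI; rewrite /Csq_integrand_f.
case: eqVneq => // v0; rewrite derive_flux// fluxE// /Csq_integrand_G.
by field.
Qed.

End theorem_data.

Theorem theorem4p5 (R : realType) (I : interval R) (T M N alpha : R)
    (r u0 f G : R -> R) (u : R -> R -> R)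
    (hI : line_or_segment I)
    (hr : is_density I r)
    (hr2 : I = `]-oo, +oo[ -> finite_second_moment I r)
    (hT : 0 < T)
    (hu0C1 : C1_on [set` I] u0)
    (hu0 : is_density I u0)
    (hu02 : I = `]-oo, +oo[ -> finite_second_moment I u0)
    (hM : (sup_norm [set` I] u0 < M%:E)%E)
    (hN : (sup_norm [set` I] (derive_in [set` I] u0) < N%:E)%E)
    (hf : C2_on `[- M, M] f)
    (hGC1 : C1_on `[- M, M] G)
    (hG : forall x, x \in `[- M, M] -> x != 0 -> G x = f x / x)
    (hu : classical_solution I T M f u0 u)
    (hflux : zero_flux I T f u)
    (halpha : 0 < alpha)
    (hchar : forall t xi, t \in `[0, T] -> xi \in I ->
      alpha <= 1 + t * derive_in `[- M, M] (derive_in `[- M, M] f) (u0 xi)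
                     * derive_in [set` I] u0 xi)
    (hout : forall a b, I = `[a, b] -> forall t, t \in `[0, T] ->
      G (u a t) = 0 /\ G (u b t) = 0) :
  let uhat := fun t : R => CDT I r (u ^~ t) in
  let Csq := (\int[lebesgue_measure]_(xi in [set` I])
                (Csq_integrand_f I M f G u0 xi)%:E)%E in
  [/\ L2_C2_on (density_measure hr) `[0, T] uhat,
      (Csq = \int[lebesgue_measure]_(xi in [set` I])
               (Csq_integrand_G I M G u0 xi)%:E)%E &
      forall n : nat, (2 <= n)%N ->
        (kolmogorov_width (density_measure hr) n [set uhat t | t in `[0%R, T]]
         <= sqrte Csq
            * (T ^+ 2 / (8 * Num.sqrt alpha * (n%:R - 1) ^+ 2))%:E)%E].
Proof.
move=> uh Csq.
have CsqE : (Csq = \int[lebesgue_measure]_(xi in [set` I])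
               (Csq_integrand_G I M G u0 xi)%:E)%E.
  apply: eq_integral => xi; rewrite inE /= => xiI.
  by rewrite (Csq_integrand_fE hI hM hf hGC1 hG).
have M0 := bound_gt0 hI hM.
have hV : line_or_segment `[- M, M] by right; exists (- M), M; split => //; lra.
have hJ : line_or_segment `[0, T] by right; exists 0, T.
have [cI [cI1 cI2 cI3 _]] := exists_retraction hI.
have [cT [cT1 cT2 cT3 _]] := exists_retraction hJ.
have [cV [cV1 cV2 cV3 _]] := exists_retraction hV.
have S := retracted_solution hI hT hu0C1 hu0 hM hN hf hGC1 hG hu halpha hchar hout
  cI1 cI2 cI3 cT1 cT2 cT3 cV1 cV2 cV3.
have hu0' := retracted_density hu0 cI2 cI3.
have hu02' : I = `]-oo, +oo[ -> finite_second_moment I (u0 \o cI).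
  move=> IE; apply: le_lt_trans (hu02 IE); rewrite le_eqVlt; apply/orP; left; apply/eqP.
  by apply: eq_integral => x; rewrite inE /= => xI; rewrite cI3.
have uhE t : t \in `[0, T] -> CDT I r (fun x => u (cI x) (cT t)) = uh t.
  by move=> tJ; apply: eq_CDT => x xI; rewrite cI3// cT3.
split; [| exact: CsqE |].
  apply: (L2_C2_on_ext _ (uhat_C2 S hu0' hr hu02')) => t tJ; exact: uhE.
move=> n n2.
have -> : [set uh t | t in `[0%R, T]] =
    [set CDT I r (fun x => u (cI x) (cT t)) | t in `[0%R, T]].
  by apply/seteqP; split => _ [t tJ <-]; exists t => //; rewrite uhE.
have -> : Csq = (\int[lebesgue_measure]_(xi in [set` I])
    (@energy_density0 R (derive_in `[- M, M] G \o cV) (u0 \o cI)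
      (derive_in [set` I] u0 \o cI) xi)%:E)%E.
  rewrite CsqE; apply: eq_integral => xi; rewrite inE /= => xiI.
  by rewrite (energy_density0_retracted G hM cI3 cV3).
exact: (uhat_width S hu0' hr hu02').
Qed.
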